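(* Let $f_x(x,a):=x$ and $f_a(x,a):=a$ be the coordinate functions on $\mathrm{Aff}$. The affine Weyl quantizations $A_{f_x}$ and $A_{f_a}$ satisfy the commutation relation $$[A_{f_x},A_{f_a}]=\frac{1}{2\pi i}A_{f_a}.$$ This is, up to re-normalization, precisely the infinitesimal structure of the affine group, i.e. the Lie algebra structure of $\mathfrak{aff}$.
   Context: $\mathrm{Aff}=\mathbb{R}\times\mathbb{R}_+$, with $\mathbb{R}_+=(0,\infty)$, is the affine group with group operation $(x,a)\cdot(y,b)=(ay+x,ab)$ and right Haar measure $\frac{dx\,da}{a}$. Its Lie algebra is $\mathfrak{aff}=\left\{\begin{pmatrix}u&v\\0&0\end{pmatrix}: u,v\in\mathbb{R}\right\}$, whose structure is completely determined by $[X,Y]=Y$ for $X=\begin{pmatrix}1&0\\0&0\end{pmatrix}$, $Y=\begin{pmatrix}0&1\\0&0\end{pmatrix}$. $\mathscr{S}(\mathbb{R}_+)$ is the space of smooth functions $\psi:\mathbb{R}_+\to\mathbb{C}$ such that $x\mapsto\psi(e^x)$ is a Schwartz function on $\mathbb{R}$, and $\mathscr{S}'(\mathbb{R}_+)$ is the space of bounded anti-linear functionals on it. $\mathscr{S}(\mathrm{Aff})$ is the space of smooth $f:\mathrm{Aff}\to\mathbb{C}$ such that $(x,\omega)\mapsto f(x,e^\omega)$ is a Schwartz function on $\mathbb{R}^2$, and $\mathscr{S}'(\mathrm{Aff})$ is the space of bounded anti-linear functionals on it. With $\lambda(u)=\frac{ue^u}{e^u-1}$ ($\lambda(0)=1$),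 the affine cross-Wigner distribution of $\phi,\psi\in\mathscr{S}(\mathbb{R}_+)$ is $$W^{\phi,\psi}_{\mathrm{Aff}}(x,a)=\int_{-\infty}^\infty\phi(a\lambda(u))\overline{\psi(a\lambda(-u))}e^{-2\pi i xu}\,du,$$ which belongs to $\mathscr{S}(\mathrm{Aff})$. The affine Weyl quantization of $f$ is the map $A_f:\mathscr{S}(\mathbb{R}_+)\to\mathscr{S}'(\mathbb{R}_+)$ defined by $$\langle A_f\psi,\phi\rangle_{\mathscr{S}',\mathscr{S}}=\left\langle f,W^{\phi,\psi}_{\mathrm{Aff}}\right\rangle_{\mathscr{S}',\mathscr{S}},\qquad \psi,\phi\in\mathscr{S}(\mathbb{R}_+).$$ For the functions $f=f_x$ and $f=f_a$ the pairing on the right is $\int_{\mathrm{Aff}}f(x,a)\overline{W^{\phi,\psi}_{\mathrm{Aff}}(x,a)}\,\frac{da\,dx}{a}$, and functions $g$ on $\mathbb{R}_+$ act on $\mathscr{S}(\mathbb{R}_+)$ by $\langle g,\phi\rangle_{\mathscr{S}',\mathscr{S}}=\int_0^\infty g(r)\overline{\phi(r)}\,\frac{dr}{r}$. The commutator is $[A,B]=A\circ B-B\circ A$.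
   Formalization: As f_a grows exponentially in log a, A_{f_a} is not defined on all of S(R_+); the operators are taken as partially defined (pairing tested only on φ where it converges absolutely), and the relation holds exactly for ψ with rψ in S(R_+), where the commutator is defined. *)

(* Defs.v *)
From HB Require Import structures.
From mathcomp Require Import all_boot all_order all_algebra.
From mathcomp Require Import all_classical all_reals all_analysis.
From mathcomp Require Export complex.
From mathcomp Require Import ring.

Set Implicit Arguments.
Unset Strict Implicit.
Unset Printing Implicit Defensive.

Import Order.TTheory GRing.Theory Num.Theory.
Import numFieldNormedType.Exports.
Import ComplexField.

Local Open Scope classical_set_scope.
Local Open Scope ring_scope.
Local Open Scope complex_scope.

Section ComplexCalculus.
Variable R : realType.
Implicit Types (f g : R -> R[i]) (D : set R).

Definition cderivable f (x : R) : Prop :=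
  derivable (fun t => complex.Re (f t)) x 1 /\
  derivable (fun t => complex.Im (f t)) x 1.

Definition cderive1 f : R -> R[i] := fun x =>
  derive1 (fun t => complex.Re (f t)) x +i* derive1 (fun t => complex.Im (f t)) x.

Definition cderiven (k : nat) f : R -> R[i] := iter k cderive1 f.

Definition csmooth_on D f : Prop :=
  forall k x, D x -> cderivable (cderiven k f) x.

Definition cintegral d (T : measurableType d)
    (mu : {measure set T -> \bar R}) (D : set T) (h : T -> R[i]) : R[i] :=
  (\int[mu]_(x in D) complex.Re (h x)) +i* (\int[mu]_(x in D) complex.Im (h x)).

Definition cintegrable d (T : measurableType d)
    (mu : {measure set T -> \bar R}) (D : set T) (h : T -> R[i]) : Prop :=
  mu.-integrable D (fun x => (complex.Re (h x))%:E) /\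
  mu.-integrable D (fun x => (complex.Im (h x))%:E).

(* [cis t] is e^{i t} *)
Definition cis (t : R) : R[i] := cos t +i* sin t.

End ComplexCalculus.

Section Schwartz.
Variable R : realType.
Implicit Types (f g : R -> R[i]).

Definition schwartz_weight (j k : nat) f (x : R) : R :=
  `|x| ^+ j * Normc.normc (cderiven k f x).

Definition schwartz f : Prop :=
  csmooth_on setT f /\
  forall j k, exists M : R, forall x, schwartz_weight j k f x <= M.

Definition schwartz_seminorm (j k : nat) f : R :=
  sup (range (schwartz_weight j k f)).

(* A function on the multiplicative half-line is encoded by its extension by
   zero to the whole line, so that equality of functions on the half-line is
   Leibniz equality. *)
Definition schwartz_pos : {pred R -> R[i]^o} := fun f =>
  `[< [/\ forall x, x <= 0 -> f x = 0,
          csmooth_on `]0, +oo[ f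
        & schwartz (fun t => f (expR t))] >].

End Schwartz.

Section SchwartzPosModule.
Variable R : realType.
Implicit Types (f g : R -> R[i]^o) (D : set R) (c : R[i]).

Let cderive_lin c f g x : cderivable f x -> cderivable g x ->
  cderivable (c *: f + g) x /\
  cderive1 (c *: f + g) x = c * cderive1 f x + cderive1 g x.
Proof.
move=> [fr fi] [gr gi].
case: c => a b.
have eR : (fun t => complex.Re (((a +i* b) *: f + g) t)) =
    a *: (fun t => complex.Re (f t)) - b *: (fun t => complex.Im (f t))
      + (fun t => complex.Re (g t)).
  apply/funext => t /=; rewrite !fctE.
  by move: (f t) (g t) => /= [u v] [u' v'].
have eI : (fun t => complex.Im (((a +i* b) *: f + g) t)) =
    a *: (fun t => complex.Im (f t)) + b *: (fun t => complex.Re (f t))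
      + (fun t => complex.Im (g t)).
  apply/funext => t /=; rewrite !fctE.
  by move: (f t) (g t) => /= [u v] [u' v'].
have dR : is_derive x (1 : R) (fun t => complex.Re (((a +i* b) *: f + g) t))
   (a * 'D_1 (fun t => complex.Re (f t)) x
    - b * 'D_1 (fun t => complex.Im (f t)) x
    + 'D_1 (fun t => complex.Re (g t)) x).
  rewrite eR; apply: is_deriveD; last exact/derivableP.
  by apply: is_deriveB; apply: is_deriveZ; exact/derivableP.
have dI : is_derive x (1 : R) (fun t => complex.Im (((a +i* b) *: f + g) t))
   (a * 'D_1 (fun t => complex.Im (f t)) x
    + b * 'D_1 (fun t => complex.Re (f t)) x
    + 'D_1 (fun t => complex.Im (g t)) x).
  rewrite eI; apply: is_deriveD; last exact/derivableP.
  by apply: is_deriveD; apply: is_deriveZ; exact/derivableP.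
split; first by split; [exact: (@ex_derive _ _ _ _ _ _ _ dR)|exact: (@ex_derive _ _ _ _ _ _ _ dI)].
by rewrite /cderive1 !derive1E (@derive_val _ _ _ _ _ _ _ dR)
  (@derive_val _ _ _ _ _ _ _ dI); congr (_ +i* _); rewrite /=; ring.
Qed.

Let cderive_near f g x : (\near x, f x = g x) ->
  (cderivable f x -> cderivable g x) /\ cderive1 f x = cderive1 g x.
Proof.
move=> fg.
have fR : \forall t \near x, complex.Re (f t) = complex.Re (g t).
  by apply: filterS fg => t ->.
have fI : \forall t \near x, complex.Im (f t) = complex.Im (g t).
  by apply: filterS fg => t ->.
split; last by rewrite /cderive1 !derive1E (near_eq_derive _ fR)
  (near_eq_derive _ fI).
by move=> [dR dI]; split;
  [apply: near_eq_derivable fR dR|apply: near_eq_derivable fI dI].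
Qed.

Let cderiven_lin D c f g : open D -> csmooth_on D f -> csmooth_on D g ->
  forall k x, D x -> cderivable (cderiven k (c *: f + g)) x /\
    cderiven k (c *: f + g) x = c * cderiven k f x + cderiven k g x.
Proof.
move=> oD sf sg.
have step k x : D x ->
    (forall y, D y -> cderiven k (c *: f + g) y =
       (c *: (cderiven k f : R -> R[i]^o) + cderiven k g) y) ->
    cderivable (cderiven k (c *: f + g)) x /\
    cderiven k.+1 (c *: f + g) x = c * cderiven k.+1 f x + cderiven k.+1 g x.
  move=> Dx e.
  have [d v] := cderive_lin c (sf k x Dx) (sg k x Dx).
  have nD : \forall y \near x, (c *: (cderiven k f : R -> R[i]^o)
      + cderiven k g) y = cderiven k (c *: f + g) y.
    by apply: filterS (open_nbhs_nbhs (conj oD Dx)) => y Dy; rewrite e.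
  have [d' v'] := cderive_near nD.
  by split; [exact: d'|rewrite /cderiven !iterS -v'].
have val k : forall x, D x ->
    cderiven k (c *: f + g) x = c * cderiven k f x + cderiven k g x.
  elim: k => [//|k IH] x Dx.
  by apply: (step k x Dx _).2 => y /IH.
move=> k x Dx; split; last exact: val.
by apply: (step k x Dx _).1 => y /val.
Qed.

Let schwartz_lin c f g :
  schwartz f -> schwartz g -> schwartz (c *: f + g).
Proof.
move=> [sf bf] [sg bg].
have H := cderiven_lin c openT sf sg.
split=> [k x _|j k]; first exact: (H k x I).1.
have [M fM] := bf j k; have [N gN] := bg j k.
exists (Normc.normc c * M + N) => x.
rewrite /schwartz_weight (H k x I).2.
apply: (@le_trans _ _ (Normc.normc c * schwartz_weight j k f x
  + schwartz_weight j k g x)); last first.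
  apply: lerD => //; apply: ler_wpM2l => //.
  by case: (c) => a b; exact: sqrtr_ge0.
rewrite /schwartz_weight mulrCA -mulrDr ler_wpM2l ?exprn_ge0//.
by rewrite -Normc.normcM -lecR rmorphD; exact: lec_normD.
Qed.

Let schwartz0 : schwartz (0 : R -> R[i]^o).
Proof.
have z k : cderiven k (0 : R -> R[i]^o) = 0.
  elim: k => // k; rewrite /cderiven iterS => ->.
  by apply/funext => x; rewrite /cderive1 !derive1_cst.
split=> [k x _|j k]; rewrite ?z; first by split; exact: derivable_cst.
by exists 0 => x; rewrite /schwartz_weight z Normc.normc0 mulr0.
Qed.

Lemma schwartz_pos_submod_closed : submod_closed (@schwartz_pos R).
Proof.
split=> [|c f g /asboolP[f0 sf Sf] /asboolP[g0 sg Sg]]; apply/asboolP; split.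
- by [].
- have [s _] := schwartz0.
  by move=> k x _; exact: s.
- exact: schwartz0.
- by move=> x x0; rewrite !fctE f0// g0// scaler0 addr0.
- by move=> k x Dx; apply: (cderiven_lin c _ sf sg k Dx).1; exact: interval_open.
- exact: (schwartz_lin c Sf Sg).
Qed.

HB.instance Definition _ := GRing.isSubmodClosed.Build R[i] (R -> R[i]^o)
  (@schwartz_pos R) schwartz_pos_submod_closed.

End SchwartzPosModule.

Record schwartzPos (R : realType) := SchwartzPos {
  schwartzPos_fun :> R -> R[i]^o ;
  schwartzPosP : schwartzPos_fun \in @schwartz_pos R }.

HB.instance Definition _ (R : realType) := [isSub for @schwartzPos_fun R].
HB.instance Definition _ (R : realType) :=
  [Choice of schwartzPos R by <:].
HB.instance Definition _ (R : realType) :=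
  [SubChoice_isSubLmodule of schwartzPos R by <:].

Section AffineWeyl.
Variable R : realType.

Notation S := (schwartzPos R).
Notation leb := (@lebesgue_measure R).

Definition antilinear (T : S -> R[i]^o) : Prop :=
  forall (c : R[i]) (phi chi : S),
    T (c *: phi + chi) = conjc c * T phi + T chi.

(* continuity for the Frechet topology carried over from the line by exp *)
Definition bounded_functional (T : S -> R[i]^o) : Prop :=
  exists (C : R) (N : nat), forall phi : S,
    Normc.normc (T phi) <=
      C * \sum_(j < N.+1) \sum_(k < N.+1)
            schwartz_seminorm j k (fun t => phi (expR t)).

Definition tempered (T : S -> R[i]^o) : Prop :=
  antilinear T /\ bounded_functional T.

Definition fun_pairing (g : R -> R[i]) : S -> R[i]^o := fun phi =>
  cintegral leb `]0, +oo[ (fun r => g r * conjc (phi r) * (r^-1)%:C).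

Definition lambda (u : R) : R :=
  if u == 0 then 1 else u * expR u / (expR u - 1).

Definition wigner (phi psi : S) (p : R * R) : R[i] :=
  cintegral leb setT (fun u =>
    phi (p.2 * lambda u) * conjc (psi (p.2 * lambda (- u)))
      * cis (- (2 * pi * p.1 * u))).

(* The half-plane is R * R with positive second component; its right Haar
   measure is dx da / a. *)
Definition aff_integrand (f W : R * R -> R[i]) (p : R * R) : R[i] :=
  f p * conjc (W p) * (p.2^-1)%:C.

Definition aff_pairing (f W : R * R -> R[i]) : R[i] :=
  cintegral (leb \x leb)%E (setT `*` `]0, +oo[) (aff_integrand f W).

Definition aff_pairing_converges (f W : R * R -> R[i]) : Prop :=
  cintegrable (leb \x leb)%E (setT `*` `]0, +oo[) (aff_integrand f W).

Definition compactly_supported (phi : S) : Prop :=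
  exists a b : R, 0 < a /\ forall r, phi r != 0 -> a <= r <= b.

(* Partially defined maps from Schwartz functions to tempered functionals,
   given by their graphs. *)
Definition poperator := S -> (S -> R[i]^o) -> Prop.

(* [weyl f psi T] means that A_f psi is defined and equal to T.  The function
   f may grow exponentially in log a (as the coordinate a does), so that the
   pairing of f with the Wigner distribution of phi and psi need not converge
   for all phi.  A_f psi is the tempered functional that is given by the
   pairing on every phi for which it converges absolutely; these phi must
   include the compactly supported ones, which are dense, so there is at most
   one such T. *)
Definition weyl (f : R * R -> R[i]) : poperator := fun psi T =>
  [/\ tempered T,
      forall phi, compactly_supported phi ->
        aff_pairing_converges f (wigner phi psi)
    & forall phi, aff_pairing_converges f (wigner phi psi) ->
        T phi = aff_pairing f (wigner phi psi)].

Definition coord_x (p : R * R) : R[i] := p.1%:C.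
Definition coord_a (p : R * R) : R[i] := p.2%:C.

(* A o B is defined at psi when B psi is (the functional of) a Schwartz
   function at which A is defined. *)
Definition op_comp (A B : poperator) : poperator := fun psi T =>
  exists g : S, B psi (fun_pairing g) /\ A g T.

Definition op_commutator (A B : poperator) : poperator := fun psi T =>
  exists T1 T2, [/\ op_comp A B psi T1, op_comp B A psi T2 & T = T1 - T2].

Definition op_scale (c : R[i]) (A : poperator) : poperator := fun psi T =>
  exists2 U, A psi U & T = c *: U.

(* [r ^+ n * psi] is again in the Schwartz space *)
Definition pow_mul_schwartz (n : nat) (psi : S) : Prop :=
  exists g : S, forall r, g r = (r ^+ n)%:C * psi r.

(* invariant under multiplication by r and under r d/dr *)
Definition aff_dom : set S :=
  [set psi | forall n, pow_mul_schwartz n psi].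

Definition aff : set 'M[R]_2 := [set M | row 1 M = 0].

Definition aff_bracket (M N : 'M[R]_2) : 'M[R]_2 := M *m N - N *m M.

Definition affX : 'M[R]_2 := delta_mx 0 0.
Definition affY : 'M[R]_2 := delta_mx 0 1.

Definition faithful_aff_rep (V : set S) (rho : 'M[R]_2 -> S -> S) : Prop :=
  [/\ forall M psi, aff M -> V psi -> V (rho M psi),
      forall M (c : R[i]) psi chi, aff M -> V psi -> V chi ->
        rho M (c *: psi + chi) = c *: rho M psi + rho M chi,
      forall (k : R) M N psi, aff M -> aff N -> V psi ->
        rho (k *: M + N) psi = k%:C *: rho M psi + rho N psi,
      forall M N psi, aff M -> aff N -> V psi ->
        rho (aff_bracket M N) psi = rho M (rho N psi) - rho N (rho M psi)
    & forall M N, aff M -> aff N ->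
        (forall psi, V psi -> rho M psi = rho N psi) -> M = N].

End AffineWeyl.

(* Main.v *)
Require Import Defs.
From HB Require Import structures.
From mathcomp Require Import all_boot all_order all_algebra.
From mathcomp Require Import all_classical all_reals all_analysis.
From mathcomp Require Import measurable_realfun ring lra.
Import Order.TTheory GRing.Theory Num.Theory.
Import numFieldNormedType.Exports.
Set Implicit Arguments.
Unset Strict Implicit.
Unset Printing Implicit Defensive.
Local Open Scope classical_set_scope.
Local Open Scope ring_scope.

(** The two quantizations are computed explicitly:

      A_x psi = (2 pi i)^-1 r psi'   and   A_a psi = r psi.

    Given this, the commutator is (2 pi i)^-1 [r d/dr, r] = (2 pi i)^-1 r, and
    X |-> r d/dr, Y |-> r represents the Lie algebra.

    Computation of the pairings.  Put a = exp s, Phi = phi o exp and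
    Psi = psi o exp.  Since lambda u = exp (ell (- u)) with
    ell u = - ln (int_0^1 exp (t u) dt), and ell (- u) = u + ell u, one has

      conj W (x, exp s) = int h_s(u) exp (2 pi i x u) du,
      h_s(u) = conj (Phi p) Psi q,  p = s + u + ell u,  q = s + ell u.

    As p - q = u and s lies between p and q, rapid decay of Phi and Psi gives
    joint decay of h_s(u) in s and u; the derivatives of ell are polynomials in
    bounded functions (lemma bounded_smooth_emean), so the u-derivatives of h_s
    decay in the same way (decaying_mixed).  Integrating by parts in u turns
    this into decay of W in x, hence into absolute convergence of the pairings
    (coord_x_converges, coord_a_converges; the factor a = exp s is harmless as
    soon as it can be absorbed in Phi and in Psi).  Fourier inversion at the
    origin, proved by Abel summation (fcos_inversion, Rintegral_fsin), then
    evaluates the integral in x: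

      int conj W dx = h_s(0),    int x conj W dx = - (2 pi i)^-1 h_s'(0).

    Here h_s(0) = conj (Phi s) Psi s, and as p and q have slopes 1/2 and - 1/2
    at u = 0 (emean1_0), h_s'(0) = (conj Phi' Psi - conj Phi Psi') / 2.  The
    remaining integration over ds = da / a gives r psi for the coordinate a,
    and after one integration by parts (2 pi i)^-1 r psi' for the coordinate x
    (coord_a_pairing, coord_x_pairing).

    Identification of the domains.  A_x psi is a Schwartz function for every
    psi.  If A_a psi is given by a Schwartz function g, then testing against
    smooth compactly supported bumps forces g = r psi (weyl_a_fun_pairing), so
    the commutator is defined only if r psi is Schwartz.  Conversely, if r psi
    is Schwartz, the pairing determines A_a psi on all phi for which r phi is
    Schwartz, and these are dense: phi / (1 + e r) tends to phi in the Schwartz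
    topology when e tends to 0 (tempered_unique).

    The representation is faithful because if c r d/dr + d r annihilates the
    common domain, so does its commutator c r with r; evaluating at a bump
    yields c = 0 and then d = 0. *)

(** * Integrals of real functions *)
Section RealIntegration.
Context {d} {T : measurableType d} {R : realType}.
Variable mu : {measure set T -> \bar R}.
Implicit Types (D : set T) (f g : T -> R).

Lemma le_Rintegrable D f g : measurable D -> measurable_fun D f ->
  (forall x, D x -> `|f x| <= g x) -> mu.-integrable D (EFin \o g) ->
  mu.-integrable D (EFin \o f).
Proof.
move=> mD mf fg ig; apply: (le_integrable _ _ _ ig) => //.
  exact/measurable_EFinP.
move=> x Dx /=; rewrite lee_fin; apply: le_trans (fg x Dx) _.
exact: ler_norm.
Qed.

Lemma RintegrableZl D f k : measurable D -> mu.-integrable D (EFin \o f) ->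
  mu.-integrable D (EFin \o (fun x => k * f x)).
Proof. by move=> mD /(integrableZl mD k). Qed.

Lemma RintegrableD D f g : measurable D -> mu.-integrable D (EFin \o f) ->
  mu.-integrable D (EFin \o g) ->
  mu.-integrable D (EFin \o (fun x => f x + g x)).
Proof. by move=> mD i1 i2; have := integrableD mD i1 i2. Qed.

Lemma RintegrableB D f g : measurable D -> mu.-integrable D (EFin \o f) ->
  mu.-integrable D (EFin \o g) ->
  mu.-integrable D (EFin \o (fun x => f x - g x)).
Proof. by move=> mD i1 i2; have := integrableB mD i1 i2. Qed.

Lemma normr_Rintegral_le D f g : measurable D -> measurable_fun D f ->
  (forall x, D x -> `|f x| <= g x) -> mu.-integrable D (EFin \o g) ->
  `|\int[mu]_(x in D) f x| <= \int[mu]_(x in D) g x.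
Proof.
move=> mD mf fg ig; have fi := le_Rintegrable mD mf fg ig.
apply: le_trans (le_normr_Rintegral mD fi) _.
by apply: le_Rintegral => //; exact: integrable_norm.
Qed.

Lemma Rdominated_cvg D (f_ : nat -> T -> R) f g : measurable D ->
  (forall n, measurable_fun D (f_ n)) ->
  (forall x, D x -> f_ n x @[n --> \oo] --> f x) ->
  mu.-integrable D (EFin \o g) ->
  (forall n x, D x -> `|f_ n x| <= g x) ->
  \int[mu]_(x in D) f_ n x @[n --> \oo] --> \int[mu]_(x in D) f x.
Proof.
move=> mD mf cf ig fg.
have mlim : measurable_fun D (EFin \o f).
  apply: (emeasurable_fun_cvg (fun n => EFin \o f_ n)) => [n|x Dx].
    exact/measurable_EFinP.
  by apply: cvg_EFin; [exact: nearW|exact: cf].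
have [||fi _ c] := @dominated_convergence _ _ _ mu D mD
  (fun n => EFin \o f_ n) (EFin \o f) (EFin \o g)
  (fun n => (measurable_EFinP _ _).2 (mf n)) mlim _ ig.
- apply: aeW => x Dx; apply: cvg_EFin; [exact: nearW|exact: cf].
- by apply: aeW => x n Dx; exact: fg.
apply: fine_cvg; rewrite fineK//; exact: integrable_fin_num.
Qed.

Lemma Rintegral_exhaustion_cvg D (Dn : nat -> set T) f :
  measurable D -> (forall n, measurable (Dn n)) -> nondecreasing_seq Dn ->
  D = \bigcup_n Dn n -> mu.-integrable D (EFin \o f) ->
  \int[mu]_(x in Dn n) f x @[n --> \oo] --> \int[mu]_(x in D) f x.
Proof.
move=> mD mDn ndD DE fi.
have -> : (fun n => \int[mu]_(x in Dn n) f x) =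
          (fun n => \int[mu]_(x in D) ((f \_ (Dn n)) x)).
  apply/funext => n; rewrite -Rintegral_mkcondr; congr Rintegral.
  by apply/esym/setIidPr; rewrite DE; exact: bigcup_sup.
have mf : measurable_fun D f.
  by apply/measurable_EFinP; exact: (measurable_int mu).
apply: (@Rdominated_cvg _ _ _ (fun x => `|f x|)) => //.
- move=> n; apply/measurable_restrict => //.
  by apply: measurable_funS mf => // x [].
- move=> x; rewrite DE => -[n _ Dnx].
  apply: cvg_near_cst; exists n => //= k /= nk.
  rewrite patchE mem_set//.
  by move: (ndD _ _ nk); rewrite subsetEset; apply.
- exact: integrable_norm.
- by move=> n x Dx; rewrite patchE; case: ifP => // _; rewrite normr0.
Qed.

Lemma integrable_exhaustion D (Dn : nat -> set T) f (K : R) :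
  measurable D -> (forall n, measurable (Dn n)) -> nondecreasing_seq Dn ->
  D = \bigcup_n Dn n -> measurable_fun D f -> (forall x, D x -> 0 <= f x) ->
  (forall n, (\int[mu]_(x in Dn n) (f x)%:E <= K%:E)%E) ->
  mu.-integrable D (EFin \o f).
Proof.
move=> mD mDn ndD DE mf f0 fK; apply/integrableP; split.
  exact/measurable_EFinP.
have sub n : Dn n `<=` D by rewrite DE; exact: bigcup_sup.
have c := @ge0_nondecreasing_set_cvg_integral _ _ _ Dn (EFin \o f) mu ndD mDn
  (fun n => (measurable_EFinP _ _).2 (measurable_funS mD (sub n) mf))
  (fun n x Dx => f0 x (sub n x Dx)).
apply: (@le_lt_trans _ _ K%:E); last exact: ltry.
rewrite (eq_integral (EFin \o f)); last first.
  by move=> x /[!inE] Dx /=; rewrite ger0_norm// f0.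
rewrite DE; rewrite -(cvg_lim _ c)//; apply: lime_le.
  by apply/cvg_ex; eexists; exact: c.
exact: nearW.
Qed.

End RealIntegration.

(** * Integrals of derivatives over the line and over the half-line with measure da / a *)
Section LineAndHalfLine.
Context {R : realType}.
Local Notation leb := (@lebesgue_measure R).
Implicit Types (F f : R -> R).

Lemma is_derive_continuous F f : (forall x, is_derive x (1 : R) F (f x)) ->
  continuous F.
Proof.
move=> dF x; apply/differentiable_continuous; rewrite -derivable1_diffP.
exact: ex_derive.
Qed.

Lemma Rintegral_FTC2 F f (a b : R) : a < b ->
  (forall x, a <= x <= b -> is_derive x (1 : R) F (f x)) ->
  (forall x, a <= x <= b -> {for x, continuous f}) ->
  (\int[leb]_(x in `[a, b]) (f x)%:E = (F b - F a)%:E)%E.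
Proof.
move=> ab dF cf.
have cF x : a <= x <= b -> {for x, continuous F}.
  move=> /dF dx; apply/differentiable_continuous; rewrite -derivable1_diffP.
  exact: ex_derive.
rewrite (@continuous_FTC2 _ f F)//.
- by apply: continuous_in_subspaceT => x; rewrite inE /= in_itv /=; exact: cf.
- split.
  + move=> x; rewrite in_itv /= => /andP[/ltW ax /ltW xb].
    by apply: ex_derive; apply: dF; rewrite ax.
  + by apply: cvg_at_right_filter; apply: cF; rewrite lexx ltW.
  + by apply: cvg_at_left_filter; apply: cF; rewrite lexx ltW.
- move=> x; rewrite in_itv /= => /andP[/ltW ax /ltW xb].
  have dx : is_derive x (1 : R) F (f x) by apply: dF; rewrite ax.
  by rewrite derive1E derive_val.
Qed.

(* The offset 1 keeps the segments non-degenerate, also for n = 0; the second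
   sequence is the image of the first one under exp. *)
Let line_n (n : nat) : set R := `[- n%:R - 1, n%:R + 1].
Let half_n (n : nat) : set R := `[expR (- n%:R - 1), expR (n%:R + 1)].

Let line_nd : nondecreasing_seq line_n.
Proof.
move=> m n mn; rewrite subsetEset => x; rewrite /line_n /= !in_itv /=.
have : (m%:R <= n%:R :> R) by rewrite ler_nat.
by move=> h /andP[h1 h2]; apply/andP; split; lra.
Qed.

Let half_nd : nondecreasing_seq half_n.
Proof.
move=> m n mn; rewrite subsetEset => x; rewrite /half_n /= !in_itv /=.
have h : (m%:R <= n%:R :> R) by rewrite ler_nat.
move=> /andP[h1 h2]; apply/andP; split.
  by apply: le_trans h1; rewrite ler_expR; lra.
by apply: le_trans h2 _; rewrite ler_expR; lra.
Qed.

Let line_cover : setT = \bigcup_n line_n n.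
Proof.
apply/seteqP; split => // x _.
exists (Num.truncn `|x|).+1 => //.
rewrite /line_n /= in_itv /=; have := truncnS_gt `|x|.
by move=> /ltW; rewrite ler_norml => /andP[? ?]; apply/andP; split; lra.
Qed.

Let half_cover : (`]0, +oo[%classic : set R) = \bigcup_n half_n n.
Proof.
apply/seteqP; split => [x|x [n _]]; rewrite /half_n /= !in_itv /=; last first.
  by move=> /andP[h _]; rewrite andbT; apply: lt_le_trans h; exact: expR_gt0.
rewrite andbT => x0; have : [set: R] (ln x) by [].
rewrite line_cover => -[n _]; rewrite /line_n /= in_itv /= => /andP[h1 h2].
exists n => //=; rewrite in_itv /=.
by rewrite -{1 2}(@lnK _ x) ?posrE// !ler_expR h1.
Qed.

Let half_pos n x : half_n n x -> 0 < x.
Proof.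
rewrite /half_n /= in_itv /= => /andP[h _]; apply: lt_le_trans h.
exact: expR_gt0.
Qed.

Lemma is_derive_comp_ln F f x : 0 < x ->
  is_derive (ln x) (1 : R) F (f (ln x)) ->
  is_derive x (1 : R) (F \o @ln R) (f (ln x) * x^-1).
Proof.
move=> x0 dF.
by have := is_derive1_comp dF (is_derive1_ln x0).
Qed.

Lemma continuous_comp_ln_div f x : continuous f -> 0 < x ->
  {for x, continuous (fun a => f (ln a) * a^-1)}.
Proof.
move=> cf x0; apply: cvgM; last by apply: cvgV => //; rewrite gt_eqF.
apply: continuous_comp; [exact: continuous_ln|exact: cf].
Qed.

Let int_line F f n : (forall x, is_derive x (1 : R) F (f x)) -> continuous f ->
  (\int[leb]_(x in line_n n) (f x)%:E =
     (F (n%:R + 1) - F (- n%:R - 1))%:E)%E.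
Proof.
move=> dF cf; apply: Rintegral_FTC2 => //; last by move=> x _; exact: cf.
by have := ler0n R n; lra.
Qed.

Let int_half F f n : (forall x, is_derive x (1 : R) F (f x)) -> continuous f ->
  (\int[leb]_(x in half_n n) (f (ln x) * x^-1)%:E =
     (F (n%:R + 1) - F (- n%:R - 1))%:E)%E.
Proof.
move=> dF cf; rewrite -{1}(@expRK R (n%:R + 1)) -{1}(@expRK R (- n%:R - 1)).
apply: (@Rintegral_FTC2 (F \o @ln R)).
- by rewrite ltr_expR; have := ler0n R n; lra.
- move=> x h; have x0 : 0 < x by apply: (@half_pos n); rewrite /half_n /= in_itv.
  exact: is_derive_comp_ln.
- move=> x h; have x0 : 0 < x by apply: (@half_pos n); rewrite /half_n /= in_itv.
  exact: continuous_comp_ln_div.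
Qed.

Lemma measurable_comp_ln_div f : continuous f ->
  measurable_fun (`]0, +oo[%classic : set R) (fun a => f (ln a) * a^-1).
Proof.
move=> cf; apply: open_continuous_measurable_fun; first exact: interval_open.
move=> x; rewrite inE /= in_itv /= andbT => x0.
exact: continuous_comp_ln_div.
Qed.

(** The common majorant of the analysis below: it is integrable on the line,
    and on the half-line for da / a after composition with ln. *)
Definition lor (x : R) : R := (1 + x ^+ 2)^-1.

Lemma lor_gt0 x : 0 < lor x.
Proof. by rewrite invr_gt0 ltr_pwDl// sqr_ge0. Qed.

Lemma lor_ge0 x : 0 <= lor x. Proof. exact/ltW/lor_gt0. Qed.

Lemma lor_le1 x : lor x <= 1.
Proof. by rewrite invf_le1 ?ltr_pwDl ?sqr_ge0// lerDl sqr_ge0. Qed.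

Lemma continuous_lor : continuous lor.
Proof. exact: continuous_oneDsqrV. Qed.

Lemma is_derive_atan x : is_derive x (1 : R) (@atan R) (lor x).
Proof.
by apply: DeriveDef; [exact: derivable_atan|rewrite -derive1E derive1_atan].
Qed.

Let atan_bound n : (atan (n%:R + 1) - atan (- n%:R - 1) <= pi :> R).
Proof.
have := atan_ltpi2 (n%:R + 1 : R); have := atan_gtNpi2 (- n%:R - 1 : R); lra.
Qed.

Lemma integrable_lor : leb.-integrable setT (EFin \o lor).
Proof.
have := @integrable_exhaustion _ _ _ leb setT line_n lor pi.
apply => //.
- by move=> n; exact: measurable_itv.
- exact: continuous_measurable_fun continuous_lor.
- by move=> x _; exact: lor_ge0.
- move=> n; rewrite (int_line _ is_derive_atan continuous_lor) lee_fin.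
  exact: atan_bound.
Qed.

Lemma integrable_lor_ln :
  leb.-integrable `]0, +oo[%classic (EFin \o (fun a => lor (ln a) * a^-1)).
Proof.
have := (@integrable_exhaustion _ _ _ leb `]0, +oo[%classic half_n
  (fun a => lor (ln a) * a^-1) pi).
apply => //.
- by move=> n; exact: measurable_itv.
- exact: measurable_comp_ln_div continuous_lor.
- move=> x /=; rewrite in_itv /= andbT => x0.
  by rewrite mulr_ge0 ?lor_ge0// invr_ge0 ltW.
- move=> n; rewrite (int_half _ is_derive_atan continuous_lor) lee_fin.
  exact: atan_bound.
Qed.

Lemma cvg_natrD1 : (fun n => n%:R + 1 : R) @ \oo --> +oo%R.
Proof. exact: cvg_comp (@cvgr_idn R) (@cvg_addrr R 1). Qed.

Lemma cvg_Nnatr1 : (fun n => - n%:R - 1 : R) @ \oo --> -oo%R.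
Proof.
apply/cvgNry; rewrite (_ : - _ = (fun n => n%:R + 1 : R)); first exact: cvg_natrD1.
by apply/funext => n; rewrite !fctE /= opprD !opprK.
Qed.

Lemma Rintegral_segments_cvg f : leb.-integrable setT (EFin \o f) ->
  \int[leb]_(x in `[- n%:R - 1, n%:R + 1]) f x @[n --> \oo]
    --> \int[leb]_x f x.
Proof.
by move=> fi; exact: (@Rintegral_exhaustion_cvg _ _ _ leb _ line_n f measurableT
  (fun n => measurable_itv _) line_nd line_cover fi).
Qed.

(** Used with both limits 0, this is integration by parts on the line. *)
Lemma Rintegral_derive F f (l1 l2 : R) :
  (forall x, is_derive x (1 : R) F (f x)) -> continuous f ->
  leb.-integrable setT (EFin \o f) ->
  F x @[x --> -oo] --> l1 -> F x @[x --> +oo] --> l2 ->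
  \int[leb]_x f x = l2 - l1.
Proof.
move=> dF cf fi c1 c2.
have c := Rintegral_segments_cvg fi.
apply: (cvg_unique _ c) => //.
rewrite (_ : (fun n => _) = (fun n => F (n%:R + 1) - F (- n%:R - 1))).
  apply: cvgB; first exact: (cvg_comp _ _ cvg_natrD1 c2).
  exact: (cvg_comp _ _ cvg_Nnatr1 c1).
by apply/funext => n; rewrite /Rintegral (int_line n dF cf).
Qed.

Lemma Rintegral_derive_ln F f (l1 l2 : R) :
  (forall x, is_derive x (1 : R) F (f x)) -> continuous f ->
  leb.-integrable `]0, +oo[%classic (EFin \o (fun a => f (ln a) * a^-1)) ->
  F x @[x --> -oo] --> l1 -> F x @[x --> +oo] --> l2 ->
  \int[leb]_(a in `]0, +oo[) (f (ln a) * a^-1) = l2 - l1.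
Proof.
move=> dF cf fi c1 c2.
have c := @Rintegral_exhaustion_cvg _ _ _ leb _ half_n _ (measurable_itv _)
  (fun n => measurable_itv _) half_nd half_cover fi.
apply: (cvg_unique _ c) => //.
rewrite (_ : (fun n => _) = (fun n => F (n%:R + 1) - F (- n%:R - 1))).
  apply: cvgB; first exact: (cvg_comp _ _ cvg_natrD1 c2).
  exact: (cvg_comp _ _ cvg_Nnatr1 c1).
by apply/funext => n; rewrite /Rintegral (int_half n dF cf).
Qed.

End LineAndHalfLine.

(** * Fubini for functions dominated by a product *)
Section ProductIntegrals.
Context {d1 d2 : measure_display} {T1 : measurableType d1}
  {T2 : measurableType d2} {R : realType}.
Implicit Types f : T1 * T2 -> R.

Lemma measurable_Rintegral_param (m2 : {sigma_finite_measure set T2 -> \bar R})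
    f : measurable_fun setT f ->
  measurable_fun setT (fun x => \int[m2]_y f (x, y)).
Proof.
move=> mf; apply: measurableT_comp; first exact: fine_measurable.
under eq_fun do rewrite integralE.
have meas (g : T1 * T2 -> \bar R) : measurable_fun setT g ->
    (forall z, 0 <= g z)%E -> measurable_fun setT (fun x => \int[m2]_y g (x, y))%E.
  by move=> mg g0; exact: measurable_fun_fubini_tonelli_F.
apply: emeasurable_funB.
- rewrite [X in measurable_fun _ X](_ : _ =
    (fun x => \int[m2]_y ((EFin \o f)^\+ (x, y)))%E); last first.
    by apply/funext => x; apply: eq_integral => y _; rewrite !funeposE.
  apply: meas; last by move=> z; exact: funepos_ge0.
  by apply: measurable_funepos; exact/measurable_EFinP.
- rewrite [X in measurable_fun _ X](_ : _ =
    (fun x => \int[m2]_y ((EFin \o f)^\- (x, y)))%E); last first.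
    by apply/funext => x; apply: eq_integral => y _; rewrite !funenegE.
  apply: meas; last by move=> z; exact: funeneg_ge0.
  by apply: measurable_funeneg; exact/measurable_EFinP.
Qed.

Variables (m1 : {sigma_finite_measure set T1 -> \bar R})
          (m2 : {sigma_finite_measure set T2 -> \bar R}).

Lemma integrable_prod_dominated f (a : T1 -> R) (b : T2 -> R) :
  measurable_fun setT f -> (forall x y, `|f (x, y)| <= a x * b y) ->
  m1.-integrable setT (EFin \o a) -> m2.-integrable setT (EFin \o b) ->
  (forall x, 0 <= a x) -> (forall y, 0 <= b y) ->
  (m1 \x m2)%E.-integrable setT (EFin \o f).
Proof.
move=> mf fab ia ib a0 b0.
apply/integrable12ltyP; first exact/measurable_EFinP.
pose K := \int[m2]_y b y.
have KE : (\int[m2]_y (b y)%:E = K%:E)%E.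
  by rewrite /K /Rintegral fineK//; exact: integrable_fin_num.
have mb : measurable_fun setT b.
  by apply/measurable_EFinP; exact: (measurable_int m2).
have ma : measurable_fun setT a.
  by apply/measurable_EFinP; exact: (measurable_int m1).
apply: (@le_lt_trans _ _ (\int[m1]_x (a x * K)%:E)%E).
  apply: ge0_le_integral => //.
  - by move=> x _; apply: integral_ge0 => y _; exact: abse_ge0.
  - have := @measurable_fun_fubini_tonelli_F _ _ _ _ _ m2
      (fun z => `|(EFin \o f) z|%E); apply => //.
    by apply: measurableT_comp => //; exact/measurable_EFinP.
  - apply/measurable_EFinP; exact: measurable_funM.
  - move=> x _; rewrite EFinM -KE -ge0_integralZl//.
    + apply: ge0_le_integral => //.
      * apply: measurableT_comp => //; apply/measurable_EFinP.
        exact: measurableT_comp.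
      * by apply/measurable_EFinP; exact: measurable_funM.
      * by move=> y _ /=; rewrite lee_fin fab.
    + exact/measurable_EFinP.
    + by move=> y _; rewrite lee_fin.
    + by rewrite lee_fin.
have : m1.-integrable setT (EFin \o (fun x => K * a x)).
  exact: RintegrableZl.
move=> /(integrable_fin_num measurableT).
under eq_integral do rewrite /= mulrC.
by rewrite ltey_eq => ->.
Qed.

Lemma Rfubini12 f : (m1 \x m2)%E.-integrable setT (EFin \o f) ->
  (forall x, m2.-integrable setT (EFin \o (fun y => f (x, y)))) ->
  \int[(m1 \x m2)%E]_z f z = \int[m1]_x \int[m2]_y f (x, y).
Proof.
move=> fi fx; rewrite /Rintegral -integral12_prod_meas1//.
congr fine; apply: eq_integral => x _; rewrite /fubini_F fineK//.
exact: integrable_fin_num (fx x).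
Qed.

Lemma Rfubini21 f : (m1 \x m2)%E.-integrable setT (EFin \o f) ->
  (forall y, m1.-integrable setT (EFin \o (fun x => f (x, y)))) ->
  \int[(m1 \x m2)%E]_z f z = \int[m2]_y \int[m1]_x f (x, y).
Proof.
move=> fi fx; rewrite /Rintegral -integral21_prod_meas1//.
congr fine; apply: eq_integral => x _; rewrite /fubini_G fineK//.
exact: integrable_fin_num (fx x).
Qed.

Lemma Rfubini_dominated f (a : T1 -> R) (b : T2 -> R) :
  measurable_fun setT f -> (forall x y, `|f (x, y)| <= a x * b y) ->
  m1.-integrable setT (EFin \o a) -> m2.-integrable setT (EFin \o b) ->
  (forall x, 0 <= a x) -> (forall y, 0 <= b y) ->
  \int[m1]_x \int[m2]_y f (x, y) = \int[m2]_y \int[m1]_x f (x, y).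
Proof.
move=> mf fab ia ib a0 b0.
have fi := integrable_prod_dominated mf fab ia ib a0 b0.
rewrite -Rfubini12//; first rewrite -Rfubini21//.
- move=> y; apply: (@le_Rintegrable _ _ _ _ _ _ (fun x => b y * a x)) => //.
  + exact: measurableT_comp.
  + by move=> x _; rewrite mulrC.
  + exact: RintegrableZl.
- move=> x; apply: (@le_Rintegrable _ _ _ _ _ _ (fun y => a x * b y)) => //.
  + exact: measurableT_comp.
  + exact: RintegrableZl.
Qed.

End ProductIntegrals.

(** * Cosine and sine transforms *)
Section FourierTransforms.
Context {R : realType}.
Local Notation leb := (@lebesgue_measure R).
Implicit Types (h : R -> R) (x u : R).

Definition fcos h x : R := \int[leb]_u (h u * cos (2 * pi * x * u)).
Definition fsin h x : R := \int[leb]_u (h u * sin (2 * pi * x * u)).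

Definition dominated (M : R) h := forall u, `|h u| <= M * lor u.

Lemma continuous_cos_mul (w : R) : continuous (fun u => cos (w * u)).
Proof.
move=> u; apply: (@continuous_comp _ _ _ ( *%R w) (@cos R)).
  by apply: cvgM; [exact: cvg_cst|exact: cvg_id].
exact: continuous_cos.
Qed.

Lemma continuous_sin_mul (w : R) : continuous (fun u => sin (w * u)).
Proof.
move=> u; apply: (@continuous_comp _ _ _ ( *%R w) (@sin R)).
  by apply: cvgM; [exact: cvg_cst|exact: cvg_id].
exact: continuous_sin.
Qed.

Lemma is_derive_mul (w u : R) : is_derive u (1 : R) ( *%R w) w.
Proof.
have := is_deriveZ w (is_derive_id u (1 : R)).
by rewrite [X in is_derive _ _ _ X]mulr1.
Qed.

Lemma is_derive_cos_mul (w u : R) :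
  is_derive u (1 : R) (fun u => cos (w * u)) (- w * sin (w * u)).
Proof.
have := is_derive1_comp (is_derive_cos (w * u)) (is_derive_mul w u).
by rewrite mulNr -mulrN mulrC.
Qed.

Lemma is_derive_sin_mul (w u : R) :
  is_derive u (1 : R) (fun u => sin (w * u)) (w * cos (w * u)).
Proof.
have := is_derive1_comp (is_derive_sin (w * u)) (is_derive_mul w u).
by rewrite mulrC.
Qed.

Lemma dominated_ge0 M h : dominated M h -> 0 <= M.
Proof.
move=> /(_ 0) hM; have := le_trans (normr_ge0 _) hM.
by rewrite pmulr_lge0// lor_gt0.
Qed.

Lemma dominatedMl M h (g : R -> R) : (forall u, `|g u| <= 1) ->
  dominated M h -> dominated M (fun u => h u * g u).
Proof.
move=> g1 hM u; rewrite normrM; apply: le_trans (hM u).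
by rewrite ler_piMr.
Qed.

Lemma dominated_integrable M h : continuous h -> dominated M h ->
  leb.-integrable setT (EFin \o h).
Proof.
move=> ch hM; apply: (@le_Rintegrable _ _ _ leb _ _ (fun u => M * lor u)) => //.
- exact: continuous_measurable_fun.
- by apply: RintegrableZl => //; exact: integrable_lor.
Qed.

Lemma normr_cos_le1 (t : R) : `|cos t| <= 1.
Proof. by rewrite ler_norml cos_geN1 cos_le1. Qed.

Lemma normr_sin_le1 (t : R) : `|sin t| <= 1.
Proof. by rewrite ler_norml sin_geN1 sin_le1. Qed.

Lemma continuous_cos_integrand h x : continuous h ->
  continuous (fun u => h u * cos (2 * pi * x * u)).
Proof. by move=> ch u; apply: cvgM; [exact: ch|exact: continuous_cos_mul]. Qed.

Lemma continuous_sin_integrand h x : continuous h ->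
  continuous (fun u => h u * sin (2 * pi * x * u)).
Proof. by move=> ch u; apply: cvgM; [exact: ch|exact: continuous_sin_mul]. Qed.

Lemma integrable_cos_integrand M h x : continuous h -> dominated M h ->
  leb.-integrable setT (EFin \o (fun u => h u * cos (2 * pi * x * u))).
Proof.
move=> ch hM; apply: (@dominated_integrable M).
- exact: continuous_cos_integrand.
- by apply: dominatedMl hM => u; exact: normr_cos_le1.
Qed.

Lemma integrable_sin_integrand M h x : continuous h -> dominated M h ->
  leb.-integrable setT (EFin \o (fun u => h u * sin (2 * pi * x * u))).
Proof.
move=> ch hM; apply: (@dominated_integrable M).
- exact: continuous_sin_integrand.
- by apply: dominatedMl hM => u; exact: normr_sin_le1.
Qed.

Definition lor_mass : R := \int[leb]_u lor u.

Lemma lor_mass_ge0 : 0 <= lor_mass.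
Proof. by apply: Rintegral_ge0 => x _; exact: lor_ge0. Qed.

Lemma normr_fcos_le M h x : continuous h -> dominated M h ->
  `|fcos h x| <= M * lor_mass.
Proof.
move=> ch hM; rewrite /lor_mass -RintegralZl//; last exact: integrable_lor.
apply: normr_Rintegral_le => //.
- by have := continuous_measurable_fun (@continuous_cos_integrand h x ch).
- by move=> u _; exact: dominatedMl (fun u => normr_cos_le1 _) hM u.
- by apply: RintegrableZl => //; exact: integrable_lor.
Qed.

Lemma normr_fsin_le M h x : continuous h -> dominated M h ->
  `|fsin h x| <= M * lor_mass.
Proof.
move=> ch hM; rewrite /lor_mass -RintegralZl//; last exact: integrable_lor.
apply: normr_Rintegral_le => //.
- by have := continuous_measurable_fun (@continuous_sin_integrand h x ch).
- by move=> u _; exact: dominatedMl (fun u => normr_sin_le1 _) hM u.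
- by apply: RintegrableZl => //; exact: integrable_lor.
Qed.

Lemma cvgy_lor : lor x @[x --> (+oo : set_system R)] --> (0 : R).
Proof.
apply/cvgrPdist_le => e e0.
near=> x; rewrite sub0r normrN ger0_norm ?lor_ge0// /lor.
rewrite -[e]invrK lef_pV2 ?posrE ?invr_gt0//; last first.
  by rewrite ltr_pwDl// sqr_ge0.
have x1 : 1 <= x by near: x; apply: nbhs_pinfty_ge; rewrite num_real.
have xe : e^-1 <= x by near: x; apply: nbhs_pinfty_ge; rewrite num_real.
nra.
Unshelve. all: by end_near. Qed.

Lemma cvgNy_lor : lor x @[x --> (-oo : set_system R)] --> (0 : R).
Proof.
apply/cvgNy_compNP; rewrite (_ : _ \o _ = lor); first exact: cvgy_lor.
by apply/funext => x /=; rewrite /lor sqrrN.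
Qed.

Lemma dominated_cvg0 M h (F : set_system R) : Filter F ->
  dominated M h -> lor x @[x --> F] --> (0 : R) -> h x @[x --> F] --> (0 : R).
Proof.
move=> FF hM c; apply: norm_cvg0.
apply: (@squeeze_cvgr _ _ _ _ (cst 0) (fun x => M * lor x)).
- by apply: nearW => x; rewrite normr_ge0 /= hM.
- exact: cvg_cst.
- by rewrite -[X in _ --> X](mulr0 M); apply: cvgM; [exact: cvg_cst|exact: c].
Qed.

Lemma Rintegral_derive_dominated M N (F f : R -> R) :
  (forall x, is_derive x (1 : R) F (f x)) -> continuous f ->
  dominated M F -> dominated N f -> \int[leb]_x f x = 0.
Proof.
move=> dF cf dM dN; rewrite (@Rintegral_derive _ F f 0 0)//.
- by rewrite subr0.
- exact: dominated_integrable cf dN.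
- exact: dominated_cvg0 dM cvgNy_lor.
- exact: dominated_cvg0 dM cvgy_lor.
Qed.

Section Derivative.
Variables (M N : R) (h h' : R -> R).
Hypotheses (dh : forall u, is_derive u (1 : R) h (h' u)) (ch' : continuous h').
Hypotheses (hM : dominated M h) (h'N : dominated N h').

Let ch : continuous h. Proof. exact: is_derive_continuous dh. Qed.

(** Integration by parts: differentiation of [h] becomes multiplication of the
    transform by the frequency, so that smoothness of [h] is decay of the
    transform. *)
Lemma fcos_derive x : fcos h' x = 2 * pi * x * fsin h x.
Proof.
apply/eqP; rewrite -subr_eq0; apply/eqP.
rewrite /fcos /fsin -RintegralZl//; last exact: integrable_sin_integrand ch hM.
rewrite -RintegralB//; last 2 first.
- exact: integrable_cos_integrand ch' h'N.
- by apply: RintegrableZl => //; exact: integrable_sin_integrand ch hM.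
apply: (@Rintegral_derive_dominated M (N + `|2 * pi * x| * M)
  (fun u => h u * cos (2 * pi * x * u))).
- move=> u; have := is_deriveM (dh u) (is_derive_cos_mul (2 * pi * x) u).
  by move/is_derive_eq; apply; rewrite /GRing.scale /=; ring.
- move=> u; apply: cvgB; first by apply: cvgM; [exact: ch'|exact: continuous_cos_mul].
  apply: cvgM; first exact: cvg_cst.
  by apply: cvgM; [exact: ch|exact: continuous_sin_mul].
- by apply: dominatedMl hM => u; exact: normr_cos_le1.
- move=> u; apply: le_trans (ler_normB _ _) _; rewrite [leRHS]mulrDl; apply: lerD.
    exact: dominatedMl (fun u => normr_cos_le1 _) h'N u.
  rewrite [leLHS]normrM -[leRHS]mulrA ler_wpM2l//.
  exact: dominatedMl (fun u => normr_sin_le1 _) hM u.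
Qed.

Lemma fsin_derive x : fsin h' x = - (2 * pi * x * fcos h x).
Proof.
apply/eqP; rewrite -subr_eq0 opprK; apply/eqP.
rewrite /fcos /fsin -RintegralZl//; last exact: integrable_cos_integrand ch hM.
rewrite -RintegralD//; last 2 first.
- exact: integrable_sin_integrand ch' h'N.
- by apply: RintegrableZl => //; exact: integrable_cos_integrand ch hM.
apply: (@Rintegral_derive_dominated M (N + `|2 * pi * x| * M)
  (fun u => h u * sin (2 * pi * x * u))).
- move=> u; have := is_deriveM (dh u) (is_derive_sin_mul (2 * pi * x) u).
  by move/is_derive_eq; apply; rewrite /GRing.scale /=; ring.
- move=> u; apply: cvgD; first by apply: cvgM; [exact: ch'|exact: continuous_sin_mul].
  apply: cvgM; first exact: cvg_cst.
  by apply: cvgM; [exact: ch|exact: continuous_cos_mul].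
- by apply: dominatedMl hM => u; exact: normr_sin_le1.
- move=> u; apply: le_trans (ler_normD _ _) _; rewrite [leRHS]mulrDl; apply: lerD.
    exact: dominatedMl (fun u => normr_sin_le1 _) h'N u.
  rewrite [leLHS]normrM -[leRHS]mulrA ler_wpM2l//.
  exact: dominatedMl (fun u => normr_cos_le1 _) hM u.
Qed.

End Derivative.

End FourierTransforms.

(** * The Fourier transform of exp (- e |x|) *)
Section AbelKernel.
Context {R : realType}.
Local Notation leb := (@lebesgue_measure R).
Implicit Types (f : R -> R).

(** The integrand exp (- e |x|) has different elementary primitives on either
    side of the origin; [Fp] and [Fm] need not agree at 0. *)
Lemma Rintegral_two_sided (f fp fm Fp Fm : R -> R) (lp lm : R) :
  continuous f -> leb.-integrable setT (EFin \o f) ->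
  (forall x, 0 <= x -> f x = fp x) -> (forall x, x <= 0 -> f x = fm x) ->
  continuous fp -> continuous fm ->
  (forall x, is_derive x (1 : R) Fp (fp x)) ->
  (forall x, is_derive x (1 : R) Fm (fm x)) ->
  Fp x @[x --> +oo] --> lp -> Fm x @[x --> -oo] --> lm ->
  \int[leb]_x f x = lp - Fp 0 + (Fm 0 - lm).
Proof.
move=> cf fi fp_ fm_ cfp cfm dp dm cp cm.
have c := Rintegral_segments_cvg fi.
apply: (cvg_unique _ c) => //.
rewrite (_ : (fun n => _) =
    (fun n => (Fp (n%:R + 1) - Fp 0) + (Fm 0 - Fm (- n%:R - 1)))).
  apply: cvgD; apply: cvgB; try exact: cvg_cst.
    exact: (cvg_comp _ _ cvg_natrD1 cp).
  exact: (cvg_comp _ _ cvg_Nnatr1 cm).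
apply/funext => n; have n0 := ler0n R n.
set N : R := n%:R + 1; set M : R := - n%:R - 1.
have N0 : 0 < N by rewrite /N; lra.
have M0 : M < 0 by rewrite /M; lra.
have sub (i : interval R) : leb.-integrable [set` i] (EFin \o f).
  by apply: (integrableS measurableT) => //; exact: measurable_itv.
have split : \int[leb]_(x in `[M, N]) f x =
    \int[leb]_(x in `[M, 0]) f x + \int[leb]_(x in `[0, N]) f x.
  rewrite -[X in _ = _ + X]Rintegral_itv_obnd_cbnd; last exact: sub.
  rewrite -(@Rintegral_itvB _ f (BLeft M) (BRight N) 0).
  - by rewrite addrCA subrr addr0.
  - exact: sub.
  - by rewrite bnd_simp ltW.
  - by rewrite bnd_simp ltW.
rewrite split [LHS]addrC; congr (_ + _).
- rewrite (@eq_Rintegral _ _ _ leb _ fp); last first.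
    by move=> x; rewrite inE /= in_itv /= => /andP[x0 _]; exact: fp_.
  by rewrite /Rintegral (@Rintegral_FTC2 _ Fp fp)// => x _;
    (exact: cfp || exact: dp).
- rewrite (@eq_Rintegral _ _ _ leb _ fm); last first.
    by move=> x; rewrite inE /= in_itv /= => /andP[_ x0]; exact: fm_.
  by rewrite /Rintegral (@Rintegral_FTC2 _ Fm fm)// => x _;
    (exact: cfm || exact: dm).
Qed.

Definition damp (e x : R) : R := expR (- (e * `|x|)).

Lemma damp_ge0 e x : 0 <= damp e x. Proof. exact: expR_ge0. Qed.

Lemma damp_le1 e x : 0 <= e -> damp e x <= 1.
Proof. by move=> e0; rewrite -expR0 ler_expR oppr_le0 mulr_ge0. Qed.

(** By (1 + t / 2)^2 <= exp t; the quadratic growth makes [damp] dominated by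
    [lor]. *)
Lemma expR_ge_sqr (t : R) : 0 <= t -> 1 + t ^+ 2 / 4 <= expR t.
Proof.
move=> t0; have -> : t = t / 2 + t / 2 by field.
rewrite expRD; have := expR_ge1Dx (t / 2).
have := expR_ge0 (t / 2); nra.
Qed.

Lemma damp_dominated e : 0 < e -> dominated (1 + 4 / e ^+ 2) (damp e).
Proof.
move=> e0 x; rewrite ger0_norm ?damp_ge0//.
rewrite /lor ler_pdivlMr; last by rewrite ltr_pwDl// sqr_ge0.
rewrite /damp expRN mulrC ler_pdivrMr ?expR_gt0//.
have t0 : 0 <= e * `|x| by rewrite mulr_ge0// ltW.
apply: le_trans (_ : (1 + 4 / e ^+ 2) * (1 + (e * `|x|) ^+ 2 / 4) <= _).
  rewrite exprMn real_normK ?num_real//.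
  rewrite [leRHS](_ : _ = 1 + x ^+ 2 + (4 / e ^+ 2 + e ^+ 2 * x ^+ 2 / 4)).
    by rewrite lerDl -exprMn addr_ge0// divr_ge0 ?sqr_ge0.
  by field; rewrite gt_eqF.
rewrite ler_wpM2l ?expR_ge_sqr//.
by rewrite addr_ge0// divr_ge0// sqr_ge0.
Qed.

Lemma continuous_damp e : continuous (damp e).
Proof.
move=> x; apply: (@continuous_comp _ _ _ (fun x => - (e * `|x|)) (@expR R)).
  by apply: cvgN; apply: cvgM; [exact: cvg_cst|exact: norm_continuous].
exact: continuous_expR.
Qed.

Lemma is_derive_damp_pos e x :
  is_derive x (1 : R) (fun x => expR (- (e * x))) (- e * expR (- (e * x))).
Proof.
have dm : is_derive x (1 : R) (fun x => - (e * x)) (- e).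
  by apply: is_deriveN; exact: is_derive_mul.
have := @is_derive1_comp _ (@expR R) (fun x => - (e * x)) _ _ _
  (is_derive_expR (- (e * x))) dm.
by rewrite mulrC.
Qed.

Lemma cvg_expRNM (e : R) : 0 < e -> expR (- (e * x)) @[x --> +oo] --> (0 : R).
Proof.
move=> e0; have D := damp_dominated e0.
have c : damp e x @[x --> +oo] --> (0 : R) by exact: dominated_cvg0 D cvgy_lor.
apply: cvg_trans c; apply: near_eq_cvg; near=> x.
rewrite /damp ger0_norm//.
Unshelve. all: by end_near. Qed.

Section Kernel.
Variables (e w : R).
Hypothesis e0 : 0 < e.

Let q : R := e ^+ 2 + w ^+ 2.
Let q0 : q != 0.
Proof. by rewrite gt_eqF// ltr_pwDl ?sqr_ge0// exprn_gt0. Qed.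

(* Real and imaginary parts of the primitive
   - exp (- (e - i w) x) / (e - i w) of exp (- e x) exp (i w x). *)
Let Fc (x : R) : R :=
  expR (- (e * x)) * ((w * sin (w * x) - e * cos (w * x)) / q).
Let Fs (x : R) : R :=
  expR (- (e * x)) * (- (e * sin (w * x) + w * cos (w * x)) / q).

Let dFc x : is_derive x (1 : R) Fc (expR (- (e * x)) * cos (w * x)).
Proof.
have d1 := is_deriveZ q^-1 (is_deriveB
  (is_deriveZ w (is_derive_sin_mul w x)) (is_deriveZ e (is_derive_cos_mul w x))).
have := is_deriveM (is_derive_damp_pos e x) d1.
rewrite (_ : _ * _ = Fc); last first.
  by apply/funext => y; rewrite /Fc !fctE /GRing.scale /= [_ / q]mulrC.
move/is_derive_eq; apply; rewrite !fctE /GRing.scale /=.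
rewrite /GRing.scale /=; have := q0; rewrite /q => q0'; by field.
Qed.

Let dFs x : is_derive x (1 : R) Fs (expR (- (e * x)) * sin (w * x)).
Proof.
have d1 := is_deriveZ (- q^-1) (is_deriveD
  (is_deriveZ e (is_derive_sin_mul w x)) (is_deriveZ w (is_derive_cos_mul w x))).
have := is_deriveM (is_derive_damp_pos e x) d1.
rewrite (_ : _ * _ = Fs); last first.
  by apply/funext => y; rewrite /Fs !fctE /GRing.scale /= /GRing.scale /=; ring.
move/is_derive_eq; apply; rewrite !fctE /GRing.scale /=.
rewrite /GRing.scale /=; have := q0; rewrite /q => q0'; by field.
Qed.

Let is_derive_reflect (F f : R -> R) (x : R) :
  (forall x, is_derive x (1 : R) F (f x)) ->
  is_derive x (1 : R) (fun x => F (- x)) (- f (- x)).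
Proof.
move=> dF.
have := @is_derive1_comp _ F -%R _ _ _ (dF (- x)) (is_deriveN (is_derive_id x (1 : R))).
by rewrite mulrN mulr1.
Qed.

Let cvg_expR_bounded (g : R -> R) (M : R) : (forall x, `|g x| <= M) ->
  expR (- (e * x)) * g x @[x --> +oo] --> (0 : R).
Proof.
move=> gM; apply: norm_cvg0.
apply: (@squeeze_cvgr _ _ _ _ (cst 0) (fun x => expR (- (e * x)) * M)).
- apply: nearW => x; rewrite normr_ge0 /= normrM ger0_norm ?expR_ge0//.
  by rewrite ler_wpM2l ?expR_ge0.
- exact: cvg_cst.
- rewrite -[X in _ --> X](mul0r M); apply: cvgM; last exact: cvg_cst.
  exact: cvg_expRNM.
Qed.

Let bound a b (s t : R) : `|s| <= 1 -> `|t| <= 1 ->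
  `|(a * s + b * t) / q| <= (`|a| + `|b|) / `|q|.
Proof.
move=> s1 t1; rewrite normrM normfV ler_wpM2r ?invr_ge0//.
apply: le_trans (ler_normD _ _) _; rewrite !normrM.
by apply: lerD; rewrite ler_piMr.
Qed.

Let cFc : Fc x @[x --> +oo] --> (0 : R).
Proof.
apply: (@cvg_expR_bounded _ ((`|w| + `|- e|) / `|q|)) => x.
by rewrite -mulNr; apply: bound; [exact: normr_sin_le1|exact: normr_cos_le1].
Qed.

Let cFs : Fs x @[x --> +oo] --> (0 : R).
Proof.
apply: (@cvg_expR_bounded _ ((`|- e| + `|- w|) / `|q|)) => x.
rewrite opprD -!mulNr.
by apply: bound; [exact: normr_sin_le1|exact: normr_cos_le1].
Qed.

Let cvg_reflect (F : R -> R) (l : R) :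
  F x @[x --> +oo] --> l -> (fun x => F (- x)) x @[x --> -oo] --> l.
Proof.
move=> c; apply/cvgNy_compNP; rewrite (_ : _ \o _ = F)//.
by apply/funext => x /=; rewrite opprK.
Qed.

Lemma Rintegral_damp_cos :
  \int[leb]_x (damp e x * cos (w * x)) = 2 * e / (e ^+ 2 + w ^+ 2).
Proof.
transitivity (0 - Fc 0 + (- Fc (- 0) - - 0)); last first.
  rewrite /Fc oppr0 !mulr0 oppr0 expR0 sin0 cos0.
  by have := q0; rewrite /q => q0'; field.
apply: (@Rintegral_two_sided _ (fun x => expR (- (e * x)) * cos (w * x))
  (fun x => expR (- (e * - x)) * cos (w * - x)) Fc (fun x => - Fc (- x))).
- move=> x; apply: cvgM; [exact: continuous_damp|exact: continuous_cos_mul].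
- apply: (@dominated_integrable _ (1 + 4 / e ^+ 2)).
    by move=> x; apply: cvgM; [exact: continuous_damp|exact: continuous_cos_mul].
  apply: dominatedMl; last exact: damp_dominated.
  by move=> x; exact: normr_cos_le1.
- by move=> x x0; rewrite /damp ger0_norm.
- by move=> x x0; rewrite /damp ler0_norm// [w * - x]mulrN cosN.
- exact: is_derive_continuous (fun x => is_deriveM (is_derive_damp_pos e x) (is_derive_cos_mul w x)).
- exact: is_derive_continuous (fun x => is_derive_reflect x (fun x => is_deriveM (is_derive_damp_pos e x) (is_derive_cos_mul w x))).
- exact: dFc.
- move=> x; have := is_deriveN (is_derive_reflect x dFc).
  by rewrite opprK.
- exact: cFc.
- by apply: cvgN; exact: cvg_reflect cFc.
Qed.

Lemma Rintegral_damp_sin : \int[leb]_x (damp e x * sin (w * x)) = 0.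
Proof.
transitivity (0 - Fs 0 + (Fs (- 0) - 0)); last first.
  by rewrite oppr0 addr0 sub0r addNr.
apply: (@Rintegral_two_sided _ (fun x => expR (- (e * x)) * sin (w * x))
  (fun x => - (expR (- (e * - x)) * sin (w * - x))) Fs (fun x => Fs (- x))).
- move=> x; apply: cvgM; [exact: continuous_damp|exact: continuous_sin_mul].
- apply: (@dominated_integrable _ (1 + 4 / e ^+ 2)).
    by move=> x; apply: cvgM; [exact: continuous_damp|exact: continuous_sin_mul].
  apply: dominatedMl; last exact: damp_dominated.
  by move=> x; exact: normr_sin_le1.
- by move=> x x0; rewrite /damp ger0_norm.
- by move=> x x0; rewrite /damp ler0_norm// [w * - x]mulrN sinN; ring.
- exact: is_derive_continuous (fun x => is_deriveM (is_derive_damp_pos e x) (is_derive_sin_mul w x)).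
- exact: is_derive_continuous (fun x => is_deriveN (is_derive_reflect x (fun x => is_deriveM (is_derive_damp_pos e x) (is_derive_sin_mul w x)))).
- exact: dFs.
- by move=> x; exact: is_derive_reflect dFs.
- exact: cFs.
- exact: cvg_reflect cFs.
Qed.

End Kernel.

End AbelKernel.

(** * Fourier inversion at the origin *)
Section FourierInversion.
Context {R : realType}.
Local Notation leb := (@lebesgue_measure R).
Implicit Types (e u x : R) (h : R -> R).

(** The Fourier transform of x |-> exp (- e |x|): an approximate identity as e
    tends to 0. *)
Definition poisson e u : R := 2 * e / (e ^+ 2 + (2 * pi * u) ^+ 2).

Lemma poisson_den_gt0 e u : 0 < e -> 0 < e ^+ 2 + (2 * pi * u) ^+ 2.
Proof. by move=> e0; rewrite ltr_pwDl ?sqr_ge0// exprn_gt0. Qed.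

Lemma poisson_ge0 e u : 0 < e -> 0 <= poisson e u.
Proof.
by move=> e0; rewrite divr_ge0 ?mulr_ge0 ?(ltW e0)// ltW// poisson_den_gt0.
Qed.

Lemma continuous_poisson e : 0 < e -> continuous (poisson e).
Proof.
move=> e0 u; apply: cvgM; first exact: cvg_cst.
apply: cvgV; first by rewrite gt_eqF// poisson_den_gt0.
apply: cvgD; first exact: cvg_cst.
apply: (@continuous_comp _ _ _ ( *%R (2 * pi)) (fun x => x ^+ 2)).
  by apply: cvgM; [exact: cvg_cst|exact: cvg_id].
exact: exprn_continuous.
Qed.

Let pi2 : (2 : R) <= pi := pi_ge2 R.

Let pi_neq0 : (pi : R) != 0. Proof. by rewrite gt_eqF// pi_gt0. Qed.

Lemma poisson_le e u : 0 < e -> poisson e u * `|u| <= 1.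
Proof.
move=> e0; rewrite /poisson mulrAC ler_pdivrMr ?poisson_den_gt0// mul1r.
rewrite !exprMn -[u ^+ 2]real_normK ?num_real//.
have := normr_ge0 u; move: (`|u|) => v v0.
have : 4 <= 2 ^+ 2 * pi ^+ 2 :> R by have := pi2; nra.
have : 0 <= (e - v) ^+ 2 by exact: sqr_ge0.
move: (2 ^+ 2 * pi ^+ 2) => k; nra.
Qed.

Lemma poisson_le_sqr e u : 0 < e -> e <= 1 -> poisson e u * u ^+ 2 <= 1.
Proof.
move=> e0 e1; rewrite /poisson mulrAC ler_pdivrMr ?poisson_den_gt0// mul1r.
rewrite !exprMn.
have := sqr_ge0 u; move: (u ^+ 2) => v v0.
have : 4 <= 2 ^+ 2 * pi ^+ 2 :> R by have := pi2; nra.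
have : 0 <= e ^+ 2 by exact: sqr_ge0.
move: (2 ^+ 2 * pi ^+ 2) => k; nra.
Qed.

Lemma poisson_dominated e : 0 < e -> dominated (2 / e + 2 * e) (poisson e).
Proof.
move=> e0 u; rewrite ger0_norm ?poisson_ge0// /lor.
rewrite ler_pdivlMr; last by rewrite ltr_pwDl// sqr_ge0.
rewrite /poisson mulrAC ler_pdivrMr ?poisson_den_gt0//.
rewrite !exprMn.
have := sqr_ge0 u; move: (u ^+ 2) => v v0.
have : 4 <= 2 ^+ 2 * pi ^+ 2 :> R by have := pi2; nra.
move: (2 ^+ 2 * pi ^+ 2) => k k4.
rewrite (_ : (2 / e + 2 * e) * _ = 2 * e + 2 * e * (k * v)
    + (2 * e ^+ 3 + 2 * (k * v) / e)); last by field; rewrite gt_eqF.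
have h1 : 0 <= 2 * e ^+ 3 + 2 * (k * v) / e.
  by rewrite addr_ge0 ?divr_ge0 ?mulr_ge0 ?exprn_ge0 ?(ltW e0)//; lra.
have h2 : e * v <= e * (k * v).
  by rewrite ler_wpM2l ?(ltW e0)//; nra.
nra.
Qed.

Lemma Rintegral_poisson e : 0 < e -> \int[leb]_u poisson e u = 1.
Proof.
move=> e0; pose w := 2 * pi / e.
have w0 : 0 < w by rewrite divr_gt0// mulr_gt0// pi_gt0.
pose F u : R := pi^-1 * atan (w * u).
have cF : F u @[u --> +oo] --> (2^-1 : R).
  have -> : (2^-1 : R) = pi^-1 * (pi / 2) by rewrite mulKf// pi_neq0.
  apply: cvgM; first exact: cvg_cst.
  have c1 : w * u @[u --> +oo%R] --> +oo%R by apply: gt0_cvgMry => //; exact: cvg_id.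
  exact: (cvg_comp _ _ c1 (@cvgy_atan R)).
transitivity (2^-1 - - 2^-1 : R); last by field.
apply: (@Rintegral_derive _ F).
- move=> u.
  have := @is_derive1_comp _ (@atan R) ( *%R w) _ _ _
    (is_derive_atan (w * u)) (is_derive_mul w u).
  move=> /(is_deriveZ pi^-1)/is_derive_eq; apply.
  rewrite /GRing.scale /= /lor /poisson /w; have := poisson_den_gt0 u e0.
  have := pi_neq0; move: (@pi R) => p p0 /lt0r_neq0 d0.
  field; rewrite p0 d0 lt0r_neq0//=.
- exact: continuous_poisson.
- apply: dominated_integrable (poisson_dominated e0); exact: continuous_poisson.
- apply/cvgNy_compNP; rewrite (_ : _ \o _ = - F); first exact: cvgN.
  by apply/funext => x /=; rewrite /F mulrN atanN mulrN.
- exact: cF.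
Qed.

Let eps (n : nat) : R := n.+1%:R^-1.

Let eps_gt0 n : 0 < eps n. Proof. by rewrite invr_gt0 ltr0n. Qed.

Let eps_le1 n : eps n <= 1.
Proof. by rewrite invf_le1 ?ltr0n// ler1n. Qed.

Let cvg_eps : eps n @[n --> \oo] --> (0 : R).
Proof. exact: cvg_harmonic. Qed.

(** An absolutely convergent integral is the limit of its Abel means. *)
Lemma Abel_cvg (g : R -> R) : leb.-integrable setT (EFin \o g) ->
  \int[leb]_x (g x * damp (eps n) x) @[n --> \oo] --> \int[leb]_x g x.
Proof.
move=> ig.
have mg : measurable_fun setT g.
  by apply/measurable_EFinP; exact: (measurable_int leb ig).
apply: (@Rdominated_cvg _ _ _ leb _ _ _ (fun x => `|g x|)) => //.
- move=> n; apply: measurable_funM => //.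
  by have := continuous_measurable_fun (@continuous_damp R (eps n)).
- move=> x _; rewrite -[X in _ --> X]mulr1.
  apply: cvgM; first exact: cvg_cst.
  rewrite -expR0; apply: continuous_cvg; first exact: continuous_expR.
  rewrite -oppr0; apply: cvgN; rewrite -(mul0r `|x|).
  by apply: cvgM; [exact: cvg_eps|exact: cvg_cst].
- exact: integrable_norm.
- move=> n x _; rewrite normrM ler_piMr//.
  by rewrite ger0_norm ?damp_ge0// damp_le1// ltW.
Qed.

(** As the kernel has mass 1, it suffices that the integrals of
    (h u - h 0) * poisson e u tend to 0.  The kernel does so pointwise off the
    origin; near the origin the Lipschitz bound on [h] compensates for its
    growth, which yields a majorant uniform in e. *)
Lemma Poisson_cvg M N h h' : (forall u, is_derive u (1 : R) h (h' u)) ->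
  dominated M h -> dominated N h' ->
  \int[leb]_u (h u * poisson (eps n) u) @[n --> \oo] --> h 0.
Proof.
move=> dh hM hN.
have ch := is_derive_continuous dh.
have M0 := dominated_ge0 hM; have N0 := dominated_ge0 hN.
have lip u : `|h u - h 0| <= N * `|u|.
  have bnd c : `|h' c| <= N.
    by apply: le_trans (hN c) _; rewrite ler_piMr ?lor_le1.
  have mvt a b : a <= b -> `|h b - h a| <= N * `|b - a|.
    move=> ab; have [|c _ ->] := @MVT_segment _ h h' a b ab (fun x _ => dh x).
      exact: continuous_subspaceT.
    by rewrite normrM ler_wpM2r.
  have [u0|u0] := leP 0 u; first by have := mvt 0 u u0; rewrite subr0.
  by have := mvt u 0 (ltW u0); rewrite sub0r normrN distrC.
have bnd2 u : `|h u - h 0| <= 2 * M.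
  have hb v : `|h v| <= M by apply: le_trans (hM v) _; rewrite ler_piMr ?lor_le1.
  by apply: le_trans (ler_normB _ _) _; have := hb u; have := hb 0; lra.
(* In (1 + u^2) |h u - h 0| poisson e u, the term 1 is paid for by the
   Lipschitz bound and [poisson_le], the term u^2 by the bound 2 M and
   [poisson_le_sqr]. *)
have key n u : `|(h u - h 0) * poisson (eps n) u| <= (N + 2 * M) * lor u.
  rewrite normrM [X in _ * X]ger0_norm ?poisson_ge0//.
  rewrite /lor ler_pdivlMr; last by rewrite ltr_pwDl// sqr_ge0.
  rewrite mulrDr mulr1; apply: lerD.
    apply: le_trans (_ : N * `|u| * poisson (eps n) u <= _).
      by rewrite ler_wpM2r ?poisson_ge0.
    by rewrite -mulrA ler_piMr// mulrC poisson_le.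
  rewrite -mulrA; apply: le_trans (_ : 2 * M * (poisson (eps n) u * u ^+ 2) <= _).
    by rewrite ler_wpM2r//; apply: mulr_ge0; [exact: poisson_ge0|exact: sqr_ge0].
  by rewrite ler_piMr ?(mulr_ge0 _ M0)// poisson_le_sqr.
have c0 : \int[leb]_u ((h u - h 0) * poisson (eps n) u) @[n --> \oo] --> (0 : R).
  have z : \int[leb]_u (cst (0 : R) u) = 0.
    by rewrite (@Rintegral_cst _ _ _ leb)//= mul0r.
  rewrite -[X in _ --> X]z.
  apply: (@Rdominated_cvg _ _ _ leb _ _ _ (fun u => (N + 2 * M) * lor u)) => //.
  - move=> n; have c : continuous (fun u => (h u - h 0) * poisson (eps n) u).
      move=> u; apply: cvgM; last exact: continuous_poisson.
      by apply: cvgB; [exact: ch|exact: cvg_cst].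
    by have := continuous_measurable_fun c.
  - move=> u _; have [->|u0] := eqVneq u 0.
      rewrite (_ : (fun n => _) = cst 0); first exact: cvg_cst.
      by apply/funext => n; rewrite subrr mul0r.
    rewrite -[X in _ --> X](mulr0 (h u - h 0)).
    apply: cvgM; first exact: cvg_cst.
    rewrite -[X in _ --> X](mul0r (0 ^+ 2 + (2 * pi * u) ^+ 2)^-1).
    apply: cvgM.
      rewrite -[X in _ --> X](mulr0 2).
      by apply: cvgM; [exact: cvg_cst|exact: cvg_eps].
    apply: cvgV.
      rewrite expr0n add0r expf_neq0// !mulf_neq0// gt_eqF// pi_gt0.
    apply: cvgD; last exact: cvg_cst.
    exact: (cvgM cvg_eps cvg_eps).
  - by apply: RintegrableZl => //; exact: integrable_lor.
have -> : (fun n => \int[leb]_u (h u * poisson (eps n) u)) =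
    (fun n => \int[leb]_u ((h u - h 0) * poisson (eps n) u) + h 0).
  apply/funext => n.
  have ip : leb.-integrable setT (EFin \o poisson (eps n)).
    by apply: dominated_integrable (poisson_dominated (eps_gt0 n)); exact: continuous_poisson.
  rewrite -[X in _ = _ + X]mulr1 -(Rintegral_poisson (eps_gt0 n)).
  rewrite -RintegralZl// -RintegralD//.
  - by apply: eq_Rintegral => u _; rewrite -mulrDl subrK.
  - apply: (@dominated_integrable _ (N + 2 * M)) => [|u]; last exact: key.
    move=> u; apply: cvgM; last exact: continuous_poisson.
    by apply: cvgB; [exact: ch|exact: cvg_cst].
  - exact: RintegrableZl.
by rewrite -[X in _ --> X]add0r; apply: cvgD; [exact: c0|exact: cvg_cst].
Qed.

(** The damping makes the double integral absolutely convergent, so that it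
    can be moved from the transform of [h] to the transform of [damp]. *)
Let fubini_damp (M e : R) h (trig : R -> R) : 0 < e ->
  continuous h -> dominated M h -> continuous trig -> (forall t, `|trig t| <= 1) ->
  \int[leb]_x ((\int[leb]_u (h u * trig (2 * pi * x * u))) * damp e x) =
  \int[leb]_u (h u * \int[leb]_x (damp e x * trig (2 * pi * u * x))).
Proof.
move=> e0 ch hM ct t1; have M0 := dominated_ge0 hM.
have ctw w : continuous (fun u => trig (w * u)).
  move=> u; apply: (@continuous_comp _ _ _ ( *%R w) trig).
    by apply: cvgM; [exact: cvg_cst|exact: cvg_id].
  exact: ct.
have ih w : leb.-integrable setT (EFin \o (fun u => h u * trig (w * u))).
  apply: (@dominated_integrable _ M); last exact: dominatedMl.
  by move=> u; apply: cvgM; [exact: ch|exact: ctw].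
have id w : leb.-integrable setT (EFin \o (fun u => damp e u * trig (w * u))).
  apply: (@dominated_integrable _ (1 + 4 / e ^+ 2)).
    by move=> u; apply: cvgM; [exact: continuous_damp|exact: ctw].
  by apply: dominatedMl => //; exact: damp_dominated.
pose f (z : R * R) := h z.2 * trig (2 * pi * z.1 * z.2) * damp e z.1.
transitivity (\int[leb]_x \int[leb]_u f (x, u)).
  by apply: eq_Rintegral => x _; rewrite /f /= RintegralZr.
transitivity (\int[leb]_u \int[leb]_x f (x, u)); last first.
  apply: eq_Rintegral => u _; rewrite -RintegralZl//.
  apply: eq_Rintegral => x _; rewrite /f /= -mulrA [_ * damp e x]mulrC.
  by rewrite (_ : 2 * pi * u * x = 2 * pi * x * u)//; ring.
apply: (@Rfubini_dominated _ _ _ _ _ leb leb f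
  (fun x => (1 + 4 / e ^+ 2) * lor x) (fun u => M * lor u)) => //.
- have mh := continuous_measurable_fun ch.
  have mt := continuous_measurable_fun ct.
  have md := continuous_measurable_fun (@continuous_damp R e).
  apply: measurable_funM; last exact: (measurableT_comp md measurable_fst).
  apply: measurable_funM; first exact: (measurableT_comp mh measurable_snd).
  apply: (measurableT_comp mt); apply: measurable_funM; last exact: measurable_snd.
  by apply: measurable_funM => //; exact: measurable_fst.
- move=> x u; rewrite /f /= mulrC normrM.
  apply: ler_pM => //; first exact: damp_dominated.
  exact: dominatedMl (fun u => t1 (2 * pi * x * u)) hM u.
- by apply: RintegrableZl => //; exact: integrable_lor.
- by apply: RintegrableZl => //; exact: integrable_lor.
- by move=> x; rewrite mulr_ge0 ?lor_ge0// addr_ge0// divr_ge0// sqr_ge0.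
- by move=> u; rewrite mulr_ge0 ?lor_ge0.
Qed.

Lemma fcos_inversion M N h h' : (forall u, is_derive u (1 : R) h (h' u)) ->
  dominated M h -> dominated N h' -> leb.-integrable setT (EFin \o fcos h) ->
  \int[leb]_x fcos h x = h 0.
Proof.
move=> dh hM hN ic; have ch := is_derive_continuous dh.
apply: (cvg_unique _ (Abel_cvg ic)) => //.
rewrite (_ : (fun n => _) = (fun n => \int[leb]_u (h u * poisson (eps n) u))).
  exact: Poisson_cvg dh hM hN.
apply/funext => n; rewrite (fubini_damp (eps_gt0 n) ch hM) //.
- by apply: eq_Rintegral => u _; rewrite Rintegral_damp_cos.
- exact: continuous_cos.
- exact: normr_cos_le1.
Qed.

(** The damping factor is even, so its sine transform vanishes. *)
Lemma Rintegral_fsin M h : continuous h -> dominated M h ->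
  leb.-integrable setT (EFin \o fsin h) -> \int[leb]_x fsin h x = 0.
Proof.
move=> ch hM ic; apply: (cvg_unique _ (Abel_cvg ic)) => //.
rewrite (_ : (fun n => _) = cst 0); first exact: cvg_cst.
apply/funext => n; rewrite (fubini_damp (eps_gt0 n) ch hM) //.
- rewrite (@eq_Rintegral _ _ _ leb _ (cst 0)) ?Rintegral_cst ?mul0r//.
  by move=> u _; rewrite Rintegral_damp_sin// mulr0.
- exact: continuous_sin.
- exact: normr_sin_le1.
Qed.

End FourierInversion.

(** * The function lambda in logarithmic coordinates *)
Section Lambda.
Context {R : realType}.
Local Notation leb := (@lebesgue_measure R).
Implicit Types (k n : nat) (u s x : R).

(** 1 / lambda (- u) = (exp u - 1) / u is the moment of order 0.  Its integral
    form has no singularity at u = 0, and differentiation in u merely raises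
    the order. *)
Definition emoment k u : R := \int[leb]_(t in `[0, 1]) (t ^+ k * expR (t * u)).

Let cont_integrand k u : continuous (fun t : R => t ^+ k * expR (t * u)).
Proof.
move=> t; apply: cvgM; first exact: exprn_continuous.
apply: (@continuous_comp _ _ _ (fun t : R => t * u) (@expR R)).
  by apply: cvgM; [exact: cvg_id|exact: cvg_cst].
exact: continuous_expR.
Qed.

Let int_integrand k u :
  leb.-integrable `[0, 1] (EFin \o (fun t : R => t ^+ k * expR (t * u))).
Proof.
apply: continuous_compact_integrable; first exact: segment_compact.
by apply: continuous_subspaceT => t; exact: cont_integrand.
Qed.

Lemma is_derive_emoment k u :
  is_derive u (1 : R) (emoment k) (emoment k.+1 u).
Proof.
pose f (v t : R) : R := t ^+ k * expR (t * v).
have df v t : is_derive v (1 : R) (f ^~ t) (t ^+ k.+1 * expR (t * v)).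
  have := @is_derive1_comp _ (@expR R) ( *%R t) _ _ _
    (is_derive_expR (t * v)) (is_derive_mul t v).
  move=> /(is_deriveZ (t ^+ k))/is_derive_eq; apply.
  by rewrite /GRing.scale /= exprS; ring.
have d1 v t : partial1of2 f v t = t ^+ k.+1 * expR (t * v).
  by rewrite partial1of2E; have := df v t => d; rewrite derive_val.
pose B := `[0, 1]%classic : set (measurableTypeR R).
have mB : measurable B by exact: measurable_itv.
have Iu : `]u - 1, u + 1[%classic u.
  by rewrite /= in_itv /=; apply/andP; split; lra.
have If v : `]u - 1, u + 1[%classic v -> leb.-integrable B (EFin \o f v).
  by move=> _; exact: int_integrand.
have dfI v t : `]u - 1, u + 1[%classic v -> B t -> derivable (f ^~ t) v 1.
  by move=> _ _; have := df v t => d; exact: ex_derive.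
(* On |v - u| < 1 and 0 <= t <= 1 the derivative in v is at most
   exp (|u| + 1). *)
pose G (t : R) : R := expR (`|u| + 1).
have G0 t : 0 <= G t by exact: expR_ge0.
have IG : leb.-integrable B (EFin \o G).
  apply: continuous_compact_integrable; first exact: segment_compact.
  by apply: continuous_subspaceT => t; exact: cvg_cst.
have Gub v t : `]u - 1, u + 1[%classic v -> B t -> `|partial1of2 f v t| <= G t.
  rewrite d1 /B /= !in_itv /= => /andP[v1 v2] /andP[t0 t1].
  rewrite normrM ger0_norm ?exprn_ge0// ger0_norm ?expR_ge0//.
  rewrite -[G t]mul1r; apply: ler_pM; rewrite ?exprn_ge0 ?expR_ge0 ?exprn_ile1//.
  rewrite ler_expR.
  have vu : `|v| <= `|u| + 1.
    by rewrite -[v](subrK u) addrC; apply: le_trans (ler_normD _ _) _;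
      rewrite lerD2l ler_norml; apply/andP; split; lra.
  apply: le_trans (ler_norm _) _; rewrite normrM [`|t|]ger0_norm//.
  by apply: le_trans vu; rewrite ler_piMl.
apply: DeriveDef.
  exact: (derivable_under_integral mB Iu If dfI G0 IG Gub).
have := differentiation_under_integral mB Iu If dfI G0 IG Gub.
rewrite derive1E => ->; apply: eq_Rintegral => t _; exact: d1.
Qed.

Lemma emoment_ge0 k u : 0 <= emoment k u.
Proof.
apply: Rintegral_ge0 => t /=; rewrite in_itv /= => /andP[t0 _].
by rewrite mulr_ge0 ?exprn_ge0 ?expR_ge0.
Qed.

Lemma emoment_le k u : emoment k u <= emoment 0 u.
Proof.
apply: le_Rintegral => //; try exact: int_integrand.
move=> t /=; rewrite in_itv /= => /andP[t0 t1].
by rewrite ler_wpM2r ?expR_ge0// expr0 exprn_ile1.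
Qed.

Lemma emoment0E u : emoment 0 u = if u == 0 then 1 else (expR u - 1) / u.
Proof.
rewrite /emoment; have [->|u0] := eqVneq u 0.
  rewrite (@eq_Rintegral _ _ _ leb _ (cst 1)) ?Rintegral_cst//.
    by rewrite /= lebesgue_measure_itv /= lte_fin ltr01 /= oppr0 addr0 mulr1.
  by move=> t _; rewrite mulr0 expR0 mulr1.
have d t : is_derive t (1 : R) (fun t => expR (u * t) / u)
    (t ^+ 0 * expR (t * u)).
  have := @is_derive1_comp _ (@expR R) ( *%R u) _ _ _
    (is_derive_expR (u * t)) (is_derive_mul u t).
  move=> /(is_deriveZ u^-1).
  rewrite [X in is_derive _ _ X _](_ : _ = (fun t => expR (u * t) / u)); last first.
    by apply/funext => v; rewrite !fctE mulrC.
  by move=> /is_derive_eq; apply; rewrite /GRing.scale /= mulrC mulfK// mul1r mulrC.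
rewrite /Rintegral (Rintegral_FTC2 ltr01 (fun t _ => d t)
  (fun t _ => @cont_integrand 0 u t)).
by rewrite /= mulr1 mulr0 expR0 mulrBl.
Qed.

Lemma emoment0_gt0 u : 0 < emoment 0 u.
Proof.
rewrite emoment0E; have [//|u0] := eqVneq u 0.
have [h|h] := ltP 0 u.
  by rewrite divr_gt0// subr_gt0 expR_gt1.
have {}h : u < 0 by rewrite lt_neqAle u0.
by rewrite -mulrNN mulr_gt0// ?oppr_gt0 ?invr_lt0// subr_lt0 expR_lt1.
Qed.

Lemma emoment0_ge1 u : 0 <= u -> 1 <= emoment 0 u.
Proof.
rewrite emoment0E le0r; have [//|u0 /= h] := eqVneq u 0.
by rewrite ler_pdivlMr// mul1r lerBrDl expR_ge1Dx.
Qed.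

Lemma emoment0_le1 u : u <= 0 -> emoment 0 u <= 1.
Proof.
rewrite emoment0E le_eqVlt; have [//|u0 /= h] := eqVneq u 0.
by rewrite ler_ndivrMr// mul1r lerBrDl expR_ge1Dx.
Qed.

Lemma emoment0N u : emoment 0 u = expR u * emoment 0 (- u).
Proof.
rewrite !emoment0E oppr_eq0; have [->|u0] := eqVneq u 0.
  by rewrite expR0 mulr1.
rewrite expRN; field; rewrite u0 ?oppr_eq0 ?u0 /=; exact: lt0r_neq0 (expR_gt0 u).
Qed.

(** ell u = ln (lambda (- u)): dilation by lambda becomes translation. *)
Definition ell u : R := - ln (emoment 0 u).

Lemma lambdaE u : lambda u = expR (ell (- u)).
Proof.
rewrite /ell expRN lnK ?posrE ?emoment0_gt0// /lambda emoment0E oppr_eq0.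
have [_|u0] := eqVneq u 0; first by rewrite invr1.
have e0 : expR u - 1 != 0.
  by rewrite subr_eq0 -expR0; apply: contra u0 => /eqP/expR_inj ->.
have e1 : expR u != 0 by exact: lt0r_neq0 (expR_gt0 u).
rewrite expRN -[expR u - 1]opprK opprB.
have e2 : 1 - expR u != 0 by rewrite -opprB oppr_eq0.
by field; rewrite u0 e1 mulN1r e2.
Qed.

(** This is lambda u = exp u * lambda (- u): the two arguments of the Wigner
    integrand differ by u in logarithmic coordinates. *)
Lemma ellN u : ell (- u) = u + ell u.
Proof.
rewrite /ell [emoment 0 u]emoment0N lnM ?posrE ?expR_gt0 ?emoment0_gt0// expRK.
by rewrite opprD addrA subrr add0r.
Qed.

Lemma ell_le0 u : 0 <= u -> ell u <= 0.
Proof. by move=> u0; rewrite oppr_le0 ln_ge0// emoment0_ge1. Qed.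

Lemma ell_ge0 u : u <= 0 -> 0 <= ell u.
Proof.
by move=> u0; rewrite oppr_ge0 ln_le0// emoment0_le1.
Qed.

(** The moments of t for the probability measure on [0, 1] whose density is
    proportional to exp (t u). *)
Definition emean k u : R := emoment k u / emoment 0 u.

Lemma is_derive_ell u : is_derive u (1 : R) ell (- emean 1 u).
Proof.
have := is_derive1_comp (is_derive1_ln (emoment0_gt0 u)) (is_derive_emoment 0 u).
by move=> /is_deriveN/is_derive_eq; apply; rewrite /emean mulrC.
Qed.

Lemma is_derive_emean k u :
  is_derive u (1 : R) (emean k) (emean k.+1 u - emean k u * emean 1 u).
Proof.
have e0 := lt0r_neq0 (emoment0_gt0 u).
have := is_deriveM (is_derive_emoment k u) (is_deriveV e0 (is_derive_emoment 0 u)).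
move=> /is_derive_eq; apply; rewrite /GRing.scale /= /emean.
by field.
Qed.


End Lambda.

(** * Classes of functions with controlled derivatives *)
Section SymbolClasses.
Context {R : realType}.
Implicit Types (n : nat) (c f g : R -> R) (h : R -> R -> R).

Fixpoint bounded_smooth n c : Prop :=
  (exists M : R, forall u, `|c u| <= M) /\
  match n with
  | 0 => continuous c
  | n'.+1 => exists2 c', forall u, is_derive u (1 : R) c (c' u) &
                          bounded_smooth n' c'
  end.

Lemma bounded_smoothS n c : bounded_smooth n.+1 c -> bounded_smooth n c.
Proof.
elim: n c => [|n IH] c [b [c' dc bc]].
  by split=> //; exact: is_derive_continuous dc.
by split=> //; exists c' => //; exact: IH.
Qed.

Let bound_add c f : (exists M : R, forall u, `|c u| <= M) ->
  (exists M : R, forall u, `|f u| <= M) -> exists M : R, forall u, `|c u + f u| <= M.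
Proof.
move=> [M cM] [N fN]; exists (M + N) => u.
by apply: le_trans (ler_normD _ _) _; exact: lerD.
Qed.

Lemma bounded_smoothD n c f : bounded_smooth n c -> bounded_smooth n f ->
  bounded_smooth n (fun u => c u + f u).
Proof.
elim: n c f => [|n IH] c f [bc rc] [bf rf].
  split; first exact: bound_add.
  by move=> u; apply: cvgD; [exact: rc|exact: rf].
case: rc => c' dc bc'; case: rf => f' df bf'; split; first exact: bound_add.
exists (fun u => c' u + f' u); last exact: IH.
by move=> u; exact: is_deriveD.
Qed.

Lemma bounded_smoothM n c f : bounded_smooth n c -> bounded_smooth n f ->
  bounded_smooth n (fun u => c u * f u).
Proof.
have b (u1 u2 : R -> R) : (exists M : R, forall u, `|u1 u| <= M :> R) ->
    (exists M : R, forall u, `|u2 u| <= M :> R) ->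
    exists M : R, forall u : R, `|u1 u * u2 u| <= M.
  by move=> [M cM] [N fN]; exists (M * N) => u; rewrite normrM ler_pM.
elim: n c f => [|n IH] c f Bc Bf; have [bc rc] := Bc; have [bf rf] := Bf.
  split; first exact: b.
  by move=> u; apply: cvgM; [exact: rc|exact: rf].
case: rc => c' dc bc'; case: rf => f' df bf'; split; first exact: b.
exists (fun u => c' u * f u + c u * f' u).
  move=> u; have := is_deriveM (dc u) (df u).
  by move=> /is_derive_eq; apply; rewrite /GRing.scale /= addrC [_ * c' u]mulrC.
by apply: bounded_smoothD; apply: IH => //; exact: bounded_smoothS.
Qed.

Lemma bounded_smooth_cst n (k : R) : bounded_smooth n (fun=> k).
Proof.
elim: n k => [|n IH] k; (split; first by exists `|k|).
  by move=> u; exact: cvg_cst.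
by exists (fun=> 0) => // u; exact: is_derive_cst.
Qed.

Lemma bounded_smoothN n c : bounded_smooth n c ->
  bounded_smooth n (fun u => - c u).
Proof.
move=> /(bounded_smoothM (bounded_smooth_cst n (-1))).
by under eq_fun do rewrite mulN1r.
Qed.

(** The functions [emean k] take their values in [0, 1] and their derivatives
    are polynomials in them; hence all derivatives are bounded. *)
Lemma bounded_smooth_emean n k : bounded_smooth n (@emean R k).
Proof.
have b j : exists M : R, forall u : R, `|emean j u| <= M.
  exists 1 => u; rewrite /emean ger0_norm ?divr_ge0 ?emoment_ge0//.
  by rewrite ler_pdivrMr ?emoment0_gt0// mul1r emoment_le.
elim: n k => [|n IH] k; (split; first exact: b).
  exact: is_derive_continuous (@is_derive_emean R k).
exists (fun u => emean k.+1 u - emean k u * emean 1 u).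
  exact: is_derive_emean.
by apply: bounded_smoothD => //; apply: bounded_smoothN; exact: bounded_smoothM.
Qed.

(** The decay needed from Phi and Psi.  The square of [lor] is what makes a
    product at the two arguments p and q bounded by lor s * lor u.  Both the
    plain and the weighted bound appear because a weight theta s is absorbed
    by only one of the two factors. *)
Fixpoint rapid (theta : R -> R) n f : Prop :=
  (exists M : R, forall p, `|f p| <= M * lor p ^+ 2 /\
                       theta p * `|f p| <= M * lor p ^+ 2) /\
  match n with
  | 0 => continuous f
  | n'.+1 => exists2 f', forall p, is_derive p (1 : R) f (f' p) &
                          rapid theta n' f'
  end.

Lemma rapidS theta n f : rapid theta n.+1 f -> rapid theta n f.
Proof.
elim: n f => [|n IH] c [b [c' dc bc]].
  by split=> //; exact: is_derive_continuous dc.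
by split=> //; exists c' => //; exact: IH.
Qed.

(** The u-derivatives of the family [h] up to order [n] are bounded by a
    multiple of lor s * lor u. *)
Fixpoint decaying n h : Prop :=
  (exists M : R, forall s, dominated (M * lor s) (h s)) /\
  match n with
  | 0 => forall s, continuous (h s)
  | n'.+1 => exists2 h', forall s u, is_derive u (1 : R) (h s) (h' s u) &
                          decaying n' h'
  end.

Lemma decaying_continuous n h s : decaying n h -> continuous (h s).
Proof. by case: n => [|n] [_ //] [c' dc _]; exact: is_derive_continuous (dc s). Qed.

Lemma decayingS n h : decaying n.+1 h -> decaying n h.
Proof.
elim: n h => [|n IH] h [b [h' dh Dh]]; split=> //.
  by move=> s; exact: is_derive_continuous (dh s).
by exists h' => //; exact: IH.
Qed.

Let dominatedD M N f g : dominated M f -> dominated N g ->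
  dominated (M + N) (fun u => f u + g u).
Proof.
move=> fM gN u; apply: le_trans (ler_normD _ _) _.
by rewrite mulrDl; exact: lerD.
Qed.

Lemma decayingD n h (g : R -> R -> R) : decaying n h -> decaying n g ->
  decaying n (fun s u => h s u + g s u).
Proof.
have b (f1 f2 : R -> R -> R) : (exists M : R, forall s, dominated (M * lor s) (f1 s)) ->
    (exists M : R, forall s, dominated (M * lor s) (f2 s)) ->
    exists M : R, forall s : R, dominated (M * lor s) (fun u => f1 s u + f2 s u).
  by move=> [M cM] [N fN]; exists (M + N) => s; rewrite mulrDl; exact: dominatedD.
elim: n h g => [|n IH] h g [bh rh] [bg rg]; (split; first exact: b).
  by move=> s u; apply: cvgD; [exact: rh|exact: rg].
case: rh => h' dh bh'; case: rg => g' dg bg'.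
by exists (fun s u => h' s u + g' s u) => [s u|]; [exact: is_deriveD|exact: IH].
Qed.

Lemma decayingMl n c h : bounded_smooth n c -> decaying n h ->
  decaying n (fun s u => c u * h s u).
Proof.
have b (f1 : R -> R) (f2 : R -> R -> R) : (exists M : R, forall u, `|f1 u| <= M) ->
    (exists M : R, forall s, dominated (M * lor s) (f2 s)) ->
    exists M : R, forall s : R, dominated (M * lor s) (fun u => f1 u * f2 s u).
  by move=> [M cM] [N fN]; exists (M * N) => s u; rewrite normrM;
    rewrite -[M * N * _]mulrA -[leRHS]mulrA ler_pM//; exact: fN.
elim: n c h => [|n IH] c h Bc Dh; have [bc rc] := Bc; have [bh rh] := Dh;
  (split; first exact: b).
  by move=> s u; apply: cvgM; [exact: rc|exact: rh].
case: rc => c' dc bc'; case: rh => h' dh Dh'.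
exists (fun s u => c' u * h s u + c u * h' s u).
  move=> s u; have := is_deriveM (dc u) (dh s u).
  by move=> /is_derive_eq; apply; rewrite /GRing.scale /= addrC [_ * c' u]mulrC.
apply: decayingD; apply: IH => //; [exact: decayingS|exact: bounded_smoothS].
Qed.

Lemma decayingN n h : decaying n h -> decaying n (fun s u => - h s u).
Proof.
move=> /(decayingMl (bounded_smooth_cst n (-1))).
by under eq_fun do under eq_fun do rewrite mulN1r.
Qed.

End SymbolClasses.

(** * Products of functions at two shifted arguments *)
Section MixedProducts.
Context {R : realType}.
Local Notation leb := (@lebesgue_measure R).
Implicit Types (A B : R -> R) (s u x : R) (h : R -> R -> R) (n : nat).

(** With a = exp s, the arguments are ln (a * lambda u) and
    ln (a * lambda (- u)). *)
Definition mixed A B s u : R := A (s + (u + ell u)) * B (s + ell u).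

Lemma mixed0 A B s : mixed A B s 0 = A s * B s.
Proof.
have e0 : ell 0 = 0 :> R.
  apply/eqP; rewrite eq_le ell_le0//=; exact: ell_ge0.
by rewrite /mixed e0 !addr0.
Qed.

Let is_derive_shift (F f g g' : R -> R) s u :
  (forall x, is_derive x (1 : R) F (f x)) -> is_derive u (1 : R) g (g' u) ->
  is_derive u (1 : R) (fun u => F (s + g u)) (g' u * f (s + g u)).
Proof.
move=> dF dg; have d1 : is_derive u (1 : R) (fun u => s + g u) (g' u).
  have := is_deriveD (is_derive_cst s u (1 : R)) dg.
  by rewrite add0r.
have := @is_derive1_comp _ F (fun u => s + g u) _ _ _ (dF (s + g u)) d1.
by rewrite mulrC.
Qed.

Lemma is_derive_mixed A A' B B' s u :
  (forall p, is_derive p (1 : R) A (A' p)) ->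
  (forall p, is_derive p (1 : R) B (B' p)) ->
  is_derive u (1 : R) (mixed A B s)
    ((1 - emean 1 u) * mixed A' B s u + - emean 1 u * mixed A B' s u).
Proof.
move=> dA dB.
have d1 : is_derive u (1 : R) (fun u => u + ell u) (1 - emean 1 u).
  exact: is_deriveD (is_derive_id u (1 : R)) (is_derive_ell u).
have := is_deriveM (@is_derive_shift A A' _ (fun u => 1 - emean 1 u) s u dA d1)
  (@is_derive_shift B B' _ (fun u => - emean 1 u) s u dB (is_derive_ell u)).
move=> /is_derive_eq; apply; rewrite /GRing.scale /= /mixed; ring.
Qed.

(** By [ellN], ell (- u) = u + ell u; at u = 0 the two sides have slopes
    emean 1 0 and 1 - emean 1 0. *)
Lemma emean1_0 : emean 1 0 = 2^-1 :> R.
Proof.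
have dN : is_derive (0 : R) (1 : R) (fun u => ell (- u)) (emean 1 (0 : R)).
  have := @is_derive1_comp _ (@ell R) -%R 0 _ _ (is_derive_ell (- 0))
     (is_deriveN (is_derive_id (0 : R) (1 : R))).
  by rewrite oppr0 mulrN mulr1 opprK.
have dP : is_derive (0 : R) (1 : R) (fun u => ell (- u)) (1 - emean 1 (0 : R)).
  rewrite (_ : (fun u => _) = (fun u => u + ell u)); last first.
    by apply/funext => u; rewrite ellN.
  exact: is_deriveD (is_derive_id (0 : R) (1 : R)) (is_derive_ell 0).
have : emean 1 (0 : R) = 1 - emean 1 (0 : R).
  by rewrite -[LHS](@derive_val _ _ _ _ _ _ _ dN) (@derive_val _ _ _ _ _ _ _ dP).
by move=> h; lra.
Qed.

(** The arguments p and q satisfy p - q = u, and s lies between them; hence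
    s^2 <= p^2 + q^2 and u^2 <= 2 (p^2 + q^2). *)
Let lor_mixed s u :
  lor (s + (u + ell u)) ^+ 2 * lor (s + ell u) ^+ 2 <= 2 * (lor s * lor u).
Proof.
set p := s + (u + ell u); set q := s + ell u.
have sq : s ^+ 2 <= p ^+ 2 + q ^+ 2.
  have [u0|u0] := leP 0 u.
    have h1 := ell_le0 u0.
    have : 0 <= ell (- u) by apply: ell_ge0; rewrite oppr_le0.
    rewrite ellN => h2.
    have hp : s <= p by rewrite /p; lra.
    have hq : q <= s by rewrite /q; lra.
    by have [s0|s0] := leP 0 s; nra.
  have h1 := ell_ge0 (ltW u0).
  have : ell (- u) <= 0 by apply: ell_le0; rewrite oppr_ge0 ltW.
  rewrite ellN => h2.
  have hp : p <= s by rewrite /p; lra.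
  have hq : s <= q by rewrite /q; lra.
  by have [s0|s0] := leP 0 s; nra.
have uq : u ^+ 2 <= 2 * (p ^+ 2 + q ^+ 2).
  have -> : u = p - q by rewrite /p /q; ring.
  have : 0 <= (p + q) ^+ 2 by exact: sqr_ge0.
  by nra.
have inv (a b c d : R) : 0 < a -> 0 < b -> 0 < c -> 0 < d ->
    c * d <= 2 * (a * b) ^+ 2 -> a^-1 ^+ 2 * b^-1 ^+ 2 <= 2 * (c^-1 * d^-1).
  move=> a0 b0 c0 d0 h.
  rewrite -invfM ler_pdivlMr ?mulr_gt0// -exprMn -invfM exprVn.
  by rewrite mulrC ler_pdivrMr// exprn_gt0// mulr_gt0.
apply: inv; rewrite ?ltr_pwDl ?sqr_ge0//.
have p0 := sqr_ge0 p; have q0 := sqr_ge0 q; have s0 := sqr_ge0 s.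
have u0 := sqr_ge0 u.
move: (p ^+ 2) (q ^+ 2) (s ^+ 2) (u ^+ 2) p0 q0 s0 u0 sq uq => a b c d a0 b0 c0 d0.
move=> ca da.
have h1 : 1 + c <= (1 + a) * (1 + b) by nra.
have h2 : 1 + d <= 2 * ((1 + a) * (1 + b)) by nra.
have : (1 + c) * (1 + d) <= (1 + a) * (1 + b) * (2 * ((1 + a) * (1 + b))).
  by apply: ler_pM => //; lra.
by move=> h; apply: le_trans h _; rewrite expr2; lra.
Qed.

Section Weighted.
Variable theta : R -> R.
Hypotheses (theta0 : forall s, 0 <= theta s)
  (theta_nd : {homo theta : x y / x <= y}).

(** The larger one of the two arguments is at least s. *)
Let theta_mixed s u : theta s <= theta (s + (u + ell u)) + theta (s + ell u).
Proof.
have [u0|u0] := leP 0 u.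
  have : 0 <= ell (- u) by apply: ell_ge0; rewrite oppr_le0.
  rewrite ellN => h2; apply: le_trans (_ : theta (s + (u + ell u)) <= _).
    by apply: theta_nd; lra.
  by rewrite lerDl.
have h1 := ell_ge0 (ltW u0).
apply: le_trans (_ : theta (s + ell u) <= _); first by apply: theta_nd; lra.
by rewrite lerDr.
Qed.

(** The weight is charged to the factor with the larger argument, and
    differentiation in u only produces bounded coefficients and derivatives of
    the factors. *)
Lemma decaying_mixed n A B : rapid theta n A -> rapid theta n B ->
  decaying n (fun s u => theta s * mixed A B s u).
Proof.
have b A1 B1 :
    (exists M : R, forall p, `|A1 p| <= M * lor p ^+ 2 /\
                       theta p * `|A1 p| <= M * lor p ^+ 2) ->
    (exists M : R, forall p, `|B1 p| <= M * lor p ^+ 2 /\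
                       theta p * `|B1 p| <= M * lor p ^+ 2) ->
    exists M : R, forall s, dominated (M * lor s)
      (fun u => theta s * mixed A1 B1 s u).
  move=> [M AM] [N BN]; exists (4 * (M * N)) => s u.
  rewrite /mixed normrM ger0_norm// normrM.
  have [a1 a2] := AM (s + (u + ell u)); have [b1 b2] := BN (s + ell u).
  apply: le_trans (_ : 2 * (M * N) * (lor (s + (u + ell u)) ^+ 2 *
     lor (s + ell u) ^+ 2) <= _); last first.
    have MN0 : 0 <= M * N.
      have l0 v : 0 < lor v ^+ 2 :> R by rewrite exprn_gt0// lor_gt0.
      have := le_trans (normr_ge0 _) a1; rewrite (pmulr_lge0 _ (l0 _)) => M0.
      have := le_trans (normr_ge0 _) b1; rewrite (pmulr_lge0 _ (l0 _)) => N0.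
      exact: mulr_ge0.
    apply: le_trans (_ : 2 * (M * N) * (2 * (lor s * lor u)) <= _).
      by rewrite ler_wpM2l ?lor_mixed// mulr_ge0.
    by rewrite le_eqVlt; apply/orP; left; apply/eqP; ring.
  apply: le_trans (_ : (theta (s + (u + ell u)) + theta (s + ell u)) *
     (`|A1 (s + (u + ell u))| * `|B1 (s + ell u)|) <= _).
    by rewrite ler_wpM2r ?mulr_ge0.
  rewrite mulrDl.
  rewrite (_ : 2 * (M * N) * _ =
    M * lor (s + (u + ell u)) ^+ 2 * (N * lor (s + ell u) ^+ 2) +
    M * lor (s + (u + ell u)) ^+ 2 * (N * lor (s + ell u) ^+ 2)); last by ring.
  apply: lerD.
    by rewrite [leLHS]mulrA ler_pM// mulr_ge0.
  by rewrite [leLHS]mulrCA ler_pM// mulr_ge0.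
elim: n A B => [|n IH] A B rA rB; have [bA A1] := rA; have [bB B1] := rB;
  (split; first exact: b).
  move=> s u; apply: cvgM; first exact: cvg_cst.
  have cell := is_derive_continuous (@is_derive_ell R).
  apply: cvgM.
    apply: (@continuous_comp _ _ _ (fun u => s + (u + ell u)) A); last exact: A1.
    apply: cvgD; first exact: cvg_cst.
    by apply: cvgD; [exact: cvg_id|exact: cell].
  apply: (@continuous_comp _ _ _ (fun u => s + ell u) B); last exact: B1.
  by apply: cvgD; [exact: cvg_cst|exact: cell].
case: A1 => A' dA rA'; case: B1 => B' dB rB'.
exists (fun s u => (1 - emean 1 u) * (theta s * mixed A' B s u)
                 + - emean 1 u * (theta s * mixed A B' s u)).
  move=> s u; have := is_deriveZ (theta s) (is_derive_mixed s u dA dB).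
  by move=> /is_derive_eq; apply; rewrite /GRing.scale /=; ring.
apply: decayingD; apply: decayingMl.
- apply: bounded_smoothD; first exact: bounded_smooth_cst.
  by apply: bounded_smoothN; exact: bounded_smooth_emean.
- by apply: IH => //; exact: rapidS.
- by apply: bounded_smoothN; exact: bounded_smooth_emean.
- by apply: IH => //; exact: rapidS.
Qed.

End Weighted.

(** Two integrations by parts bound (2 pi x)^2 times the transform, so that
    two derivatives in u give integrable decay in x. *)
Lemma decaying_transform_bound h : decaying 2 h -> exists C : R, 0 <= C /\
  forall s x, `|fcos (h s) x| <= C * (lor s * lor x) /\
              `|fsin (h s) x| <= C * (lor s * lor x).
Proof.
move=> Dh; have [[M hM] [h1 d1 D1]] := Dh; have [[M1 hM1] [h2 d2 [[M2 hM2] c2]]] := D1.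
have K0 := @lor_mass_ge0 R; set K := @lor_mass R in K0 *.
have c s : continuous (h s) by exact: decaying_continuous Dh.
have c1 s : continuous (h1 s) by exact: is_derive_continuous (d2 s).
have pos (N : R) (g : R -> R -> R) : (forall s, dominated (N * lor s) (g s)) -> 0 <= N.
  by move=> gN; have := dominated_ge0 (gN 0); rewrite (pmulr_lge0 _ (lor_gt0 0)).
have M0 := pos _ _ hM; have M20 := pos _ _ hM2.
exists ((M + M2) * K); split; first by rewrite mulr_ge0// addr_ge0.
have pi1 : (1 : R) <= (2 * pi) ^+ 2 by have := pi_ge2 R; nra.
have key s x (T T2 : R) : `|T| <= M * lor s * K -> `|T2| <= M2 * lor s * K ->
    `|T2| = (2 * pi * x) ^+ 2 * `|T| -> `|T| <= (M + M2) * K * (lor s * lor x).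
  move=> hT hT2 E; rewrite mulrA [lor x]/lor ler_pdivlMr ?ltr_pwDl ?sqr_ge0//.
  rewrite mulrDr mulr1 (_ : _ * lor s = M * lor s * K + M2 * lor s * K); last by ring.
  apply: lerD => //; apply: le_trans hT2; rewrite E mulrC ler_wpM2r//.
  by rewrite exprMn ler_peMl ?sqr_ge0.
move=> s x; split.
- apply: (key _ _ _ (fcos (h2 s) x)).
  + exact: normr_fcos_le.
  + exact: normr_fcos_le.
  + rewrite (fcos_derive (d2 s) (c2 s) (hM1 s) (hM2 s)).
    rewrite (fsin_derive (d1 s) (c1 s) (hM s) (hM1 s)).
    by rewrite mulrN normrN mulrA normrM -expr2 ger0_norm ?sqr_ge0.
- apply: (key _ _ _ (fsin (h2 s) x)).
  + exact: normr_fsin_le.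
  + exact: normr_fsin_le.
  + rewrite (fsin_derive (d2 s) (c2 s) (hM1 s) (hM2 s)).
    rewrite (fcos_derive (d1 s) (c1 s) (hM s) (hM1 s)).
    by rewrite normrN mulrA normrM -expr2 ger0_norm ?sqr_ge0.
Qed.

End MixedProducts.
Local Open Scope complex_scope.

(** * Complex-valued functions of a real variable *)
Section ComplexParts.
Context {R : realType}.
Implicit Types (z w : R[i]) (a : R).
Local Notation Re := (@complex.Re R).
Local Notation Im := (@complex.Im R).
Local Notation normc := (@Normc.normc R).

Lemma Re_add z w : Re (z + w) = Re z + Re w. Proof. by case: z; case: w. Qed.
Lemma Im_add z w : Im (z + w) = Im z + Im w. Proof. by case: z; case: w. Qed.
Lemma Re_opp z : Re (- z) = - Re z. Proof. by case: z. Qed.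
Lemma Im_opp z : Im (- z) = - Im z. Proof. by case: z. Qed.
Lemma Re_mul z w : Re (z * w) = Re z * Re w - Im z * Im w.
Proof. by case: z; case: w. Qed.
Lemma Im_mul z w : Im (z * w) = Re z * Im w + Im z * Re w.
Proof. by case: z; case: w. Qed.
Lemma Re_conjc z : Re (conjc z) = Re z. Proof. by case: z. Qed.
Lemma Im_conjc z : Im (conjc z) = - Im z. Proof. by case: z. Qed.
Definition complex_partsE :=
  (Re_add, Im_add, Re_opp, Im_opp, Re_mul, Im_mul, Re_conjc, Im_conjc).

Lemma complex_ext z w : Re z = Re w -> Im z = Im w -> z = w.
Proof. by case: z => a b; case: w => c d /= -> ->. Qed.

Lemma normc_ge0 z : 0 <= normc z.
Proof. by case: z => a b; exact: sqrtr_ge0. Qed.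

Lemma normr_Re_le z : `|Re z| <= normc z.
Proof.
by case: z => a b /=; rewrite -sqrtr_sqr ler_wsqrtr// lerDl sqr_ge0.
Qed.

Lemma normr_Im_le z : `|Im z| <= normc z.
Proof.
by case: z => a b /=; rewrite -sqrtr_sqr ler_wsqrtr// lerDr sqr_ge0.
Qed.

Lemma normc_le z : normc z <= `|Re z| + `|Im z|.
Proof.
case: z => a b /=; rewrite -[leRHS]ger0_norm ?addr_ge0// -sqrtr_sqr ler_wsqrtr//.
rewrite sqrrD !real_normK ?num_real//.
by have := mulr_ge0 (normr_ge0 a) (normr_ge0 b); lra.
Qed.

Lemma normc_add z w : normc (z + w) <= normc z + normc w.
Proof. by rewrite -lecR rmorphD; exact: lec_normD. Qed.

End ComplexParts.

Section ComplexDerivative.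
Context {R : realType}.
Local Notation Re := (@complex.Re R).
Local Notation Im := (@complex.Im R).
Local Notation normc := (@Normc.normc R).
Implicit Types (f g : R -> R[i]) (x : R) (d c : R[i]).

Definition is_cderive f x d : Prop :=
  is_derive x (1 : R) (fun t => Re (f t)) (Re d) /\
  is_derive x (1 : R) (fun t => Im (f t)) (Im d).

Lemma is_cderive_val f x d : is_cderive f x d -> cderive1 f x = d.
Proof.
by move=> [dr di]; apply: complex_ext; rewrite /= derive1E derive_val.
Qed.

Lemma is_cderive_derivable f x d : is_cderive f x d -> cderivable f x.
Proof. by move=> [dr di]; split; exact: ex_derive. Qed.

Lemma cderivable_is_cderive f x : cderivable f x -> is_cderive f x (cderive1 f x).
Proof.
move=> [dr di]; split.
- by have := derivableP dr; rewrite -derive1E.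
- by have := derivableP di; rewrite -derive1E.
Qed.

Lemma is_cderive_eq f x d c : d = c -> is_cderive f x d -> is_cderive f x c.
Proof. by move=> ->. Qed.

Lemma is_cderive_near f g x d : (\near x, f x = g x) ->
  is_cderive f x d -> is_cderive g x d.
Proof.
move=> fg [dr di]; split.
- have e : \forall t \near x, Re (f t) = Re (g t) by apply: filterS fg => t ->.
  apply: DeriveDef; first by apply: near_eq_derivable e _; exact: ex_derive.
  by rewrite -(near_eq_derive _ e) derive_val.
- have e : \forall t \near x, Im (f t) = Im (g t) by apply: filterS fg => t ->.
  apply: DeriveDef; first by apply: near_eq_derivable e _; exact: ex_derive.
  by rewrite -(near_eq_derive _ e) derive_val.
Qed.

Lemma is_cderive_lin f g x df dg c : is_cderive f x df -> is_cderive g x dg ->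
  is_cderive (fun t => c * f t + g t) x (c * df + dg).
Proof.
move=> [fr fi] [gr gi]; split.
- have -> : (fun t => Re (c * f t + g t)) =
      (Re c *: (fun t => Re (f t)) - Im c *: (fun t => Im (f t))
       + (fun t => Re (g t))).
    by apply/funext => t; rewrite !complex_partsE.
  have := is_deriveD (is_deriveB (is_deriveZ (Re c) fr) (is_deriveZ (Im c) fi)) gr.
  by move=> /is_derive_eq; apply; rewrite !complex_partsE.
- have -> : (fun t => Im (c * f t + g t)) =
      (Re c *: (fun t => Im (f t)) + Im c *: (fun t => Re (f t))
       + (fun t => Im (g t))).
    by apply/funext => t; rewrite !complex_partsE.
  have := is_deriveD (is_deriveD (is_deriveZ (Re c) fi) (is_deriveZ (Im c) fr)) gi.
  by move=> /is_derive_eq; apply; rewrite !complex_partsE.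
Qed.

Lemma is_cderive_scale f (a : R -> R) x df da : is_derive x (1 : R) a da ->
  is_cderive f x df ->
  is_cderive (fun t => (a t)%:C * f t) x ((a x)%:C * df + da%:C * f x).
Proof.
move=> dA [fr fi]; split.
- have -> : (fun t => Re ((a t)%:C * f t)) = a * (fun t => Re (f t)).
    by apply/funext => t; rewrite !complex_partsE /= mul0r subr0.
  have := is_deriveM dA fr.
  move=> /is_derive_eq; apply; rewrite !complex_partsE /= !mul0r !subr0.
  by rewrite /GRing.scale /= [_ * da]mulrC.
- have -> : (fun t => Im ((a t)%:C * f t)) = a * (fun t => Im (f t)).
    by apply/funext => t; rewrite !complex_partsE /= mul0r addr0.
  have := is_deriveM dA fi.
  move=> /is_derive_eq; apply; rewrite !complex_partsE /= !mul0r !addr0.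
  by rewrite /GRing.scale /= [_ * da]mulrC.
Qed.

Lemma is_cderive_comp f (g : R -> R) x d dg : is_derive x (1 : R) g dg ->
  is_cderive f (g x) d -> is_cderive (fun t => f (g t)) x (d * dg%:C).
Proof.
move=> dG [fr fi]; split.
- have := @is_derive1_comp _ (fun t => Re (f t)) g _ _ _ fr dG.
  by move=> /is_derive_eq; apply; rewrite !complex_partsE /= mulr0 subr0.
- have := @is_derive1_comp _ (fun t => Im (f t)) g _ _ _ fi dG.
  by move=> /is_derive_eq; apply; rewrite !complex_partsE /= mulr0 add0r.
Qed.

Lemma cderivenSr k f : cderiven k (cderive1 f) = cderiven k.+1 f.
Proof. by rewrite /cderiven iterSr. Qed.

Lemma csmooth_is_cderive D f k x : csmooth_on D f -> D x ->
  is_cderive (cderiven k f) x (cderiven k.+1 f x).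
Proof. by move=> sf Dx; have := cderivable_is_cderive (sf k x Dx). Qed.

Lemma csmooth_cderive1 D f : csmooth_on D f -> csmooth_on D (cderive1 f).
Proof. by move=> sf k x Dx; rewrite cderivenSr; exact: (sf k.+1 x Dx). Qed.

(** Smoothness is a statement on all iterated derivatives, for which no closed
    formula is available; it is enough to exhibit a class of functions that
    contains the function and is stable under differentiation. *)
Lemma csmooth_class D (P : (R -> R[i]) -> Prop) :
  (forall f, P f -> (forall x, D x -> cderivable f x) /\ P (cderive1 f)) ->
  forall f, P f -> csmooth_on D f.
Proof.
move=> Pd f Pf k.
suff /Pd[] : P (cderiven k f) by [].
elim: k => [//|k IH]; rewrite /cderiven iterS; exact: (Pd _ IH).2.
Qed.

(** The same principle for Schwartz functions: only the decay of the members
    of the class has to be checked, not that of their derivatives. *)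
Lemma schwartz_class (P : (R -> R[i]) -> Prop) :
  (forall f, P f -> exists2 f', (forall x, is_cderive f x (f' x)) & P f') ->
  (forall f j, P f -> exists M : R, forall x, `|x| ^+ j * normc (f x) <= M) ->
  forall f, P f -> schwartz f.
Proof.
move=> Pd Pb f Pf.
have Pk k : P (cderiven k f).
  elim: k => [//|k IH]; rewrite /cderiven iterS.
  have [f' df' Pf'] := Pd _ IH.
  suff -> : cderive1 (iter k (@cderive1 R) f) = f' by [].
  by apply/funext => x; exact: is_cderive_val (df' x).
split=> [k x _|j k]; last exact: Pb.
by have [f' df' _] := Pd _ (Pk k); exact: is_cderive_derivable (df' x).
Qed.

Lemma schwartz_is_cderive f x : schwartz f -> is_cderive f x (cderive1 f x).
Proof. by move=> [sf _]; exact: (csmooth_is_cderive 0 sf I). Qed.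

Lemma schwartz_cderive1 f : schwartz f -> schwartz (cderive1 f).
Proof.
move=> [sf bf]; split; first exact: csmooth_cderive1.
move=> j k; have [M fM] := bf j k.+1; exists M => x.
by rewrite /schwartz_weight cderivenSr; exact: fM.
Qed.

Lemma schwartz_bound f j : schwartz f ->
  exists M : R, forall x, `|x| ^+ j * normc (f x) <= M.
Proof. by move=> [_ /(_ j 0)]. Qed.

Let csmooth_lin c f g : csmooth_on setT f -> csmooth_on setT g ->
  csmooth_on setT (fun t => c * f t + g t).
Proof.
move=> Sf Sg; pose P h := exists f g : R -> R[i],
  [/\ csmooth_on setT f, csmooth_on setT g & h = (fun t => c * f t + g t)].
apply: (@csmooth_class _ P); last by exists f, g.
move=> _ [f1 [g1 [Sf1 Sg1 ->]]].
have d x : is_cderive (fun t => c * f1 t + g1 t) x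
    (c * cderive1 f1 x + cderive1 g1 x).
  apply: is_cderive_lin; first exact: (csmooth_is_cderive 0 Sf1 I).
  exact: (csmooth_is_cderive 0 Sg1 I).
split; first by move=> x _; exact: is_cderive_derivable (d x).
exists (cderive1 f1), (cderive1 g1); split; try exact: csmooth_cderive1.
by apply/funext => x; exact: is_cderive_val.
Qed.

(** The functions x^-n * G (ln x) form a class stable under differentiation. *)
Lemma csmooth_comp_ln (G : R -> R[i]) f : csmooth_on setT G ->
  (forall x, 0 < x -> f x = G (ln x)) -> csmooth_on `]0, +oo[ f.
Proof.
move=> SG fG; pose P h := exists n G, csmooth_on setT G /\
  forall x : R, 0 < x -> h x = (x^-1 ^+ n)%:C * G (ln x).
apply: (@csmooth_class _ P); last first.
  by exists 0%N, G; split=> // x /fG ->; rewrite expr0 mul1r.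
move=> h [n [G1 [SG1 hG1]]].
pose G2 := fun t => - n%:R * G1 t + cderive1 G1 t.
have d x : 0 < x -> is_cderive h x ((x^-1 ^+ n.+1)%:C * G2 (ln x)).
  move=> x0; have dl := is_derive1_ln x0.
  apply: (@is_cderive_near (fun t => (t^-1 ^+ n)%:C * G1 (ln t))).
    near=> t; rewrite hG1//; near: t; exact: lt_nbhsr.
  have dV : is_derive x (1 : R) (fun t : R => t^-1 ^+ n) (- n%:R * x^-1 ^+ n.+1).
    have dv : is_derive x (1 : R) (fun t : R => t^-1) (- x ^- 2).
      have := is_deriveV (lt0r_neq0 x0) (is_derive_id x (1 : R)).
      by move=> /is_derive_eq; apply; rewrite /GRing.scale /= mulr1.
    rewrite (_ : (fun t => _) = (fun t : R => t^-1) ^+ n); last first.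
      by apply/funext => t; rewrite exprfctE.
    have := is_deriveX n dv.
    move=> /is_derive_eq; apply; rewrite /GRing.scale /=.
    case: n {hG1 G2} => [|n]; first by rewrite !mulr0n !mul0r oppr0 mul0r.
    rewrite -exprVn /= !exprS; ring.
  have dG := csmooth_is_cderive 0 SG1 (I : setT (ln x)).
  apply: is_cderive_eq (is_cderive_scale dV (is_cderive_comp dl dG)).
  rewrite /G2 /cderiven /= exprS !rmorphM rmorphN rmorph_nat; ring.
split=> [x|].
  by rewrite /= in_itv /= andbT => /d; exact: is_cderive_derivable.
exists n.+1, G2; split; last by move=> x x0; exact: is_cderive_val (d x x0).
exact: csmooth_lin SG1 (csmooth_cderive1 SG1).
Unshelve. all: by end_near. Qed.

End ComplexDerivative.

(** * Schwartz functions on the half-line in logarithmic coordinates *)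
Section SchwartzPos.
Context {R : realType}.
Local Notation S := (schwartzPos R).
Local Notation normc := (@Normc.normc R).
Implicit Types (phi psi : S) (f : R -> R[i]).

(** Every property of a Schwartz function on the half-line is read off from
    this function on the line; [from_log] is the inverse operation. *)
Definition logf psi : R -> R[i] := fun t => psi (expR t).

Lemma schwartz_logf psi : schwartz (logf psi).
Proof. by have /asboolP[] := schwartzPosP psi. Qed.

Lemma schwartzPos_le0 psi x : x <= 0 -> psi x = 0.
Proof. by have /asboolP[f0 _ _] := schwartzPosP psi; exact: f0. Qed.

Lemma schwartzPos_ext phi psi : logf phi =1 logf psi -> phi = psi.
Proof.
move=> e; apply: val_inj => /=; apply/funext => x.
have [x0|x0] := leP x 0; first by rewrite !schwartzPos_le0.
by have := e (ln x); rewrite /logf lnK// posrE.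
Qed.

Lemma from_log_subproof f : schwartz f ->
  (fun x => if 0 < x then f (ln x) else 0 : R[i]) \in @schwartz_pos R.
Proof.
move=> Sf; apply/asboolP; split.
- by move=> x x0; rewrite ltNge x0.
- by apply: (@csmooth_comp_ln _ f); [case: Sf|move=> x ->].
- rewrite (_ : (fun t => _) = f)//.
  by apply/funext => t; rewrite expR_gt0 expRK.
Qed.

Definition from_log f (Sf : schwartz f) : S := SchwartzPos (from_log_subproof Sf).

Lemma logf_from_log f (Sf : schwartz f) : logf (from_log Sf) = f.
Proof. by apply/funext => t; rewrite /logf /= expR_gt0 expRK. Qed.

Lemma logfD phi psi t : logf (phi + psi) t = logf phi t + logf psi t.
Proof. by []. Qed.
Lemma logfZ (c : R[i]) psi t : logf (c *: psi) t = c * logf psi t.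
Proof. by []. Qed.
Lemma logfB phi psi t : logf (phi - psi) t = logf phi t - logf psi t.
Proof. by []. Qed.

(** The operator r d/dr, which is the derivative in logarithmic coordinates. *)
Definition euler psi : S := from_log (schwartz_cderive1 (schwartz_logf psi)).

Lemma logf_euler psi : logf (euler psi) = cderive1 (logf psi).
Proof. exact: logf_from_log. Qed.

Lemma is_cderive_logf psi t : is_cderive (logf psi) t (logf (euler psi) t).
Proof.
by rewrite logf_euler; apply: schwartz_is_cderive; exact: schwartz_logf.
Qed.

Lemma euler_lin (c : R[i]) phi psi :
  euler (c *: phi + psi) = c *: euler phi + euler psi.
Proof.
apply: schwartzPos_ext => t; rewrite logfD logfZ logf_euler.
apply: is_cderive_val.
exact: is_cderive_lin (is_cderive_logf phi t) (is_cderive_logf psi t).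
Qed.

(** Multiplication by r is a relation, since r * psi need not be a Schwartz
    function in logarithmic coordinates. *)
Definition is_mulr psi g : Prop := forall t, logf g t = (expR t)%:C * logf psi t.

Lemma pow_mul_schwartzP n psi : pow_mul_schwartz n psi <->
  exists g : S, forall t, logf g t = (expR t ^+ n)%:C * logf psi t.
Proof.
split=> -[g gE]; exists g => x; first exact: gE.
have [x0|x0] := leP x 0; first by rewrite !schwartzPos_le0// mulr0.
by have := gE (ln x); rewrite /logf lnK// posrE.
Qed.

Lemma pow_mul_schwartz1P psi : pow_mul_schwartz 1 psi <-> exists g, is_mulr psi g.
Proof.
rewrite pow_mul_schwartzP.
by split=> -[g gE]; exists g => t; rewrite gE expr1.
Qed.

(** The relation r (r d/dr) = (r d/dr) r - r, including the fact that
    r d/dr preserves the domain of multiplication by r. *)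
Lemma is_mulr_euler psi g : is_mulr psi g -> is_mulr (euler psi) (euler g - g).
Proof.
move=> gE t; have d := is_cderive_scale (is_derive_expR t) (is_cderive_logf psi t).
rewrite logfB logf_euler (_ : logf g = (fun t => (expR t)%:C * logf psi t)).
  by rewrite (is_cderive_val d) addrK.
exact/funext.
Qed.

End SchwartzPos.

(** * Weighted decay of Schwartz functions *)
Section RapidSchwartz.
Context {R : realType}.
Local Notation S := (schwartzPos R).
Local Notation Re := (@complex.Re R).
Local Notation Im := (@complex.Im R).
Local Notation normc := (@Normc.normc R).
Implicit Types (phi psi g : S) (s : R).

Definition log_re psi s : R := Re (logf psi s).
Definition log_im psi s : R := Im (logf psi s).

Lemma is_derive_log_re psi s : is_derive s (1 : R) (log_re psi) (log_re (euler psi) s).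
Proof. exact: (is_cderive_logf psi s).1. Qed.

Lemma is_derive_log_im psi s : is_derive s (1 : R) (log_im psi) (log_im (euler psi) s).
Proof. exact: (is_cderive_logf psi s).2. Qed.

Lemma logf_bound psi : exists M : R, forall s, normc (logf psi s) <= M * lor s ^+ 2.
Proof.
(* (1 + s^2)^2 = 1 + 2 s^2 + s^4 *)
have [M0 h0] := schwartz_bound 0 (schwartz_logf psi).
have [M2 h2] := schwartz_bound 2 (schwartz_logf psi).
have [M4 h4] := schwartz_bound 4 (schwartz_logf psi).
exists (M0 + 2 * M2 + M4) => s; rewrite /lor exprVn ler_pdivlMr; last first.
  by rewrite exprn_gt0// ltr_pwDl// sqr_ge0.
have := h0 s; have := h2 s; have := h4 s.
rewrite expr0 mul1r real_normK ?num_real// -[4%N]/(2 * 2)%N exprM real_normK ?num_real//.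
by move: (normc _) (s ^+ 2) => a b; nra.
Qed.

(** In logarithmic coordinates all derivatives are iterates of [euler], so a
    weighted bound valid on a class of functions stable under [euler] extends
    to all derivatives. *)
Lemma rapid_class (theta : R -> R) (Q : S -> Prop) :
  (forall psi, Q psi -> Q (euler psi)) ->
  (forall psi, Q psi -> exists M : R, forall s,
      theta s * normc (logf psi s) <= M * lor s ^+ 2) ->
  (forall s, 0 <= theta s) ->
  forall n psi, Q psi -> rapid theta n (log_re psi) /\ rapid theta n (log_im psi).
Proof.
move=> Qe Qb t0.
have b psi (P : R[i] -> R) : (forall z, `|P z| <= normc z) -> Q psi ->
    exists M : R, forall p, `|P (logf psi p)| <= M * lor p ^+ 2 /\
      theta p * `|P (logf psi p)| <= M * lor p ^+ 2.
  move=> Pn /Qb[N hN]; have [M hM] := logf_bound psi.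
  exists (Num.max M N) => p.
  have l0 : 0 <= lor p ^+ 2 :> R by rewrite exprn_ge0// lor_ge0.
  split; first apply: le_trans (Pn _) _; first apply: le_trans (hM p) _.
    by rewrite ler_wpM2r// le_max lexx.
  apply: le_trans (_ : theta p * normc (logf psi p) <= _).
    by rewrite ler_wpM2l.
  by apply: le_trans (hN p) _; rewrite ler_wpM2r// le_max lexx orbT.
elim=> [|n IH] psi Qpsi; split; split; try exact: b (@normr_Re_le R) Qpsi;
  try exact: b (@normr_Im_le R) Qpsi.
- exact: is_derive_continuous (is_derive_log_re psi).
- exact: is_derive_continuous (is_derive_log_im psi).
- exists (log_re (euler psi)); first exact: is_derive_log_re.
  exact: (IH _ (Qe _ Qpsi)).1.
- exists (log_im (euler psi)); first exact: is_derive_log_im.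
  exact: (IH _ (Qe _ Qpsi)).2.
Qed.

Lemma rapid_schwartz n psi :
  rapid (fun=> 1) n (log_re psi) /\ rapid (fun=> 1) n (log_im psi).
Proof.
apply: (@rapid_class _ (fun=> True)) => // {}psi _.
by have [M hM] := logf_bound psi; exists M => s; rewrite mul1r.
Qed.

Lemma rapid_mulr n psi : (exists g, is_mulr psi g) ->
  rapid expR n (log_re psi) /\ rapid expR n (log_im psi).
Proof.
apply: (@rapid_class _ (fun psi => exists g, is_mulr psi g)); last exact: expR_ge0.
- by move=> {}psi [g /is_mulr_euler h]; exists (euler g - g).
- move=> {}psi [g gE]; have [M hM] := logf_bound g; exists M => s.
  apply: le_trans (hM s); rewrite gE Normc.normcM ler_wpM2r ?normc_ge0//.
  by apply: le_trans (normr_Re_le _); rewrite ler_norm.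
Qed.

Lemma rapid_compactly_supported n psi : compactly_supported psi ->
  rapid expR n (log_re psi) /\ rapid expR n (log_im psi).
Proof.
move=> [a [b [_ ab]]].
(* Only the upper end of the support matters for the weight exp s.  It is
   used in the form s <= b, which follows from s <= exp s <= b and is
   preserved by differentiation. *)
apply: (@rapid_class _ (fun psi => forall s, b < s -> logf psi s = 0));
  last 2 first.
- exact: expR_ge0.
- move=> s bs; apply/eqP; apply: contraTT bs => /ab/andP[_ sb].
  rewrite -leNgt; apply: le_trans sb; apply: le_trans (expR_ge1Dx _).
  by rewrite lerDr.
- move=> {ab}psi h s bs; rewrite logf_euler; apply: is_cderive_val.
  apply: (@is_cderive_near _ (fun=> 0)); last first.
    by split; exact: is_derive_cst.
  near=> t; rewrite h//; near: t; exact: lt_nbhsr.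
- move=> {ab}psi h; have [M hM] := logf_bound psi; exists (expR b * M) => s.
  have M0 : 0 <= M * lor s ^+ 2 by exact: le_trans (normc_ge0 _) (hM s).
  have [sb|/h ->] := leP s b; last by rewrite Normc.normc0 mulr0 -mulrA mulr_ge0 ?expR_ge0.
  by rewrite -mulrA ler_pM ?expR_ge0 ?normc_ge0 ?ler_expR.
Unshelve. all: by end_near. Qed.

End RapidSchwartz.

(** * Integrals over the half-plane *)
Section StripIntegrals.
Context {R : realType}.
Local Notation leb := (@lebesgue_measure R).
Local Notation strip := (setT `*` `]0, +oo[ : set (measurableTypeR R * measurableTypeR R)).
Implicit Types F : R * R -> R.

Lemma measurable_strip : measurable strip.
Proof. by apply: measurableX => //; exact: measurable_itv. Qed.

Lemma integrable_strip_dominated F (C : R) : 0 <= C -> measurable_fun strip F ->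
  (forall x a, 0 < a -> `|F (x, a)| <= C * lor x * (lor (ln a) * a^-1)) ->
  (leb \x leb)%E.-integrable strip (EFin \o F).
Proof.
move=> C0 mF Fb.
pose pos := (`]0, +oo[%classic : set (measurableTypeR R)).
have mpos : measurable pos by exact: measurable_itv.
pose b := (fun a : R => lor (ln a) * a^-1) \_ pos.
have b0 a : 0 <= b a.
  rewrite /b patchE; case: ifPn => //; rewrite inE /pos /= in_itv /= andbT => a0.
  by rewrite mulr_ge0 ?lor_ge0// invr_ge0 ltW.
have ib : leb.-integrable setT (EFin \o b).
  have := (@integrable_restrict _ _ _ leb pos mpos setT measurableT
    (EFin \o (fun a : R => lor (ln a) * a^-1))).1.
  rewrite restrict_EFin; apply; rewrite setTI; exact: integrable_lor_ln.
suff : (leb \x leb)%E.-integrable setT ((EFin \o F) \_ strip).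
  move=> h; have := (@integrable_restrict _ _ _ (leb \x leb)%E strip measurable_strip setT
    measurableT (EFin \o F)).2 h.
  by rewrite setTI.
rewrite restrict_EFin.
apply: (@integrable_prod_dominated _ _ _ _ _ leb leb _ (fun x => C * lor x) b) => //.
- by apply/(measurable_restrictT F measurable_strip).
- move=> x a; rewrite /b !patchE /=.
  have -> : ((x, a) \in strip) = (a \in pos).
    by apply/idP/idP; rewrite !inE //= => -[].
  case: ifPn; last by rewrite normr0 mulr0.
  by rewrite inE /pos /= in_itv /= andbT => /Fb.
- by apply: RintegrableZl => //; exact: integrable_lor.
- by move=> x; rewrite mulr_ge0 ?lor_ge0.
Qed.

Lemma Rintegral_strip F : (leb \x leb)%E.-integrable strip (EFin \o F) ->
  (forall a, 0 < a -> leb.-integrable setT (EFin \o (fun x => F (x, a)))) ->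
  \int[(leb \x leb)%E]_(z in strip) F z =
  \int[leb]_(a in `]0, +oo[) \int[leb]_x F (x, a).
Proof.
move=> iF iFa.
pose pos := (`]0, +oo[%classic : set (measurableTypeR R)).
rewrite Rintegral_mkcond [RHS]Rintegral_mkcond.
have inE' x a : ((x, a) \in strip) = (a \in pos).
  by apply/idP/idP; rewrite !inE //= => -[].
rewrite Rfubini21.
- apply: eq_Rintegral => a _; rewrite [RHS]patchE -[a \in _]/(a \in pos).
  case: ifPn => apos.
    by apply: eq_Rintegral => x _; rewrite patchE inE' apos.
  rewrite (@eq_Rintegral _ _ _ leb _ (cst 0)) ?(@Rintegral_cst _ _ _ leb) ?mul0r//.
  by move=> x _; rewrite patchE inE' (negbTE apos).
- have := (@integrable_restrict _ _ _ (leb \x leb)%E strip measurable_strip setT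
    measurableT (EFin \o F)).1.
  by rewrite restrict_EFin setTI; apply.
- move=> a; have [apos|apos] := boolP (a \in pos).
    have a0 : 0 < a by move: apos; rewrite inE /pos /= in_itv /= andbT.
    rewrite (_ : (fun x => _) = (fun x => F (x, a))); first exact: iFa.
    by apply/funext => x; rewrite patchE inE' apos.
  rewrite (_ : (fun x => _) = cst 0); first exact: integrable0.
  by apply/funext => x; rewrite patchE inE' (negbTE apos).
Qed.

End StripIntegrals.

(** * The Wigner distribution in logarithmic coordinates *)
Section WignerMeasurable.
Context {R : realType}.
Local Notation leb := (@lebesgue_measure R).
Local Notation S := (schwartzPos R).
Local Notation Re := (@complex.Re R).
Local Notation Im := (@complex.Im R).
Implicit Types (phi psi : S).

Lemma measurable_lambda : measurable_fun setT (@lambda R).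
Proof.
rewrite (_ : @lambda R = (fun u => expR (ell (- u)))); last first.
  by apply/funext => u; exact: lambdaE.
apply: continuous_measurable_fun => u.
apply: (@continuous_comp _ _ _ (fun u => ell (- u)) (@expR R)).
  apply: (@continuous_comp _ _ _ -%R (@ell R)); first exact: oppr_continuous.
  exact: is_derive_continuous (@is_derive_ell R) _.
exact: continuous_expR.
Qed.

Let measurable_half (f : R -> R) (g : R -> R) : continuous g ->
  (forall x, x <= 0 -> f x = 0) -> (forall x, 0 < x -> f x = g (ln x)) ->
  measurable_fun setT f.
Proof.
move=> cg f0 fg.
pose pos := (`]0, +oo[%classic : set R).
rewrite (_ : f = (fun x => g (ln x)) \_ pos); last first.
  apply/funext => x; rewrite patchE; case: ifPn => [|/negP];
    rewrite inE /pos /= in_itv /= andbT; first by move=> /fg.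
  by move=> /negP; rewrite -leNgt => /f0.
apply/(measurable_restrictT (fun x => g (ln x))); first exact: measurable_itv.
apply: open_continuous_measurable_fun; first exact: interval_open.
move=> x; rewrite inE /pos /= in_itv /= andbT => x0.
apply: continuous_comp; [exact: continuous_ln|exact: cg].
Qed.

Lemma measurable_schwartz_re phi : measurable_fun setT (fun x => Re (phi x)).
Proof.
apply: (@measurable_half _ (log_re phi)).
- exact: is_derive_continuous (is_derive_log_re phi).
- by move=> x x0; rewrite schwartzPos_le0.
- by move=> x x0; rewrite /log_re /logf lnK.
Qed.

Lemma measurable_schwartz_im phi : measurable_fun setT (fun x => Im (phi x)).
Proof.
apply: (@measurable_half _ (log_im phi)).
- exact: is_derive_continuous (is_derive_log_im phi).
- by move=> x x0; rewrite schwartzPos_le0.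
- by move=> x x0; rewrite /log_im /logf lnK.
Qed.

Section Joint.
Variables phi psi : S.
Local Notation T3 := ((R * R) * R)%type.

Let m1 : measurable_fun setT (fun z : T3 => z.1.2 * lambda z.2).
Proof.
apply: measurable_funM.
  exact: measurableT_comp measurable_snd measurable_fst.
exact: measurableT_comp measurable_lambda measurable_snd.
Qed.

Let m2 : measurable_fun setT (fun z : T3 => z.1.2 * lambda (- z.2)).
Proof.
apply: measurable_funM.
  exact: measurableT_comp measurable_snd measurable_fst.
apply: measurableT_comp; first exact: measurable_lambda.
exact: measurableT_comp (@oppr_measurable R setT) measurable_snd.
Qed.

Let m3 : measurable_fun setT (fun z : T3 => - (2 * pi * z.1.1 * z.2)).
Proof.
apply: measurableT_comp; first exact: oppr_measurable.
apply: measurable_funM; last exact: measurable_snd.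
apply: measurable_funM => //.
exact: measurableT_comp measurable_fst measurable_fst.
Qed.

Let m4 : measurable_fun setT (fun z : T3 => cos (- (2 * pi * z.1.1 * z.2))).
Proof.
by apply: measurableT_comp m3; exact: continuous_measurable_fun (@continuous_cos R).
Qed.

Let m5 : measurable_fun setT (fun z : T3 => sin (- (2 * pi * z.1.1 * z.2))).
Proof.
by apply: measurableT_comp m3; exact: continuous_measurable_fun (@continuous_sin R).
Qed.

Let m6 := measurableT_comp (measurable_schwartz_re phi) m1.
Let m7 := measurableT_comp (measurable_schwartz_im phi) m1.
Let m8 := measurableT_comp (measurable_schwartz_re psi) m2.
Let m9 := measurableT_comp (measurable_schwartz_im psi) m2.

Lemma measurable_wigner_re :
  measurable_fun setT (fun p : R * R => Re (wigner phi psi p)).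
Proof.
apply: (measurable_Rintegral_param leb (f := fun z : T3 => Re
  (phi (z.1.2 * lambda z.2) * conjc (psi (z.1.2 * lambda (- z.2)))
      * cis (- (2 * pi * z.1.1 * z.2))))).
rewrite (_ : (fun z => _) = (fun z : T3 =>
  (Re (phi (z.1.2 * lambda z.2)) * Re (psi (z.1.2 * lambda (- z.2))) +
   Im (phi (z.1.2 * lambda z.2)) * Im (psi (z.1.2 * lambda (- z.2)))) *
   cos (- (2 * pi * z.1.1 * z.2)) -
  (Im (phi (z.1.2 * lambda z.2)) * Re (psi (z.1.2 * lambda (- z.2))) -
   Re (phi (z.1.2 * lambda z.2)) * Im (psi (z.1.2 * lambda (- z.2)))) *
   sin (- (2 * pi * z.1.1 * z.2)))); last first.
  by apply/funext => z; rewrite !complex_partsE /=; ring.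
apply: measurable_funB; apply: measurable_funM.
- by apply: measurable_funD; apply: measurable_funM.
- exact: m4.
- by apply: measurable_funB; apply: measurable_funM.
- exact: m5.
Qed.

Lemma measurable_wigner_im :
  measurable_fun setT (fun p : R * R => Im (wigner phi psi p)).
Proof.
apply: (measurable_Rintegral_param leb (f := fun z : T3 => Im
  (phi (z.1.2 * lambda z.2) * conjc (psi (z.1.2 * lambda (- z.2)))
      * cis (- (2 * pi * z.1.1 * z.2))))).
rewrite (_ : (fun z => _) = (fun z : T3 =>
  (Re (phi (z.1.2 * lambda z.2)) * Re (psi (z.1.2 * lambda (- z.2))) +
   Im (phi (z.1.2 * lambda z.2)) * Im (psi (z.1.2 * lambda (- z.2)))) *
   sin (- (2 * pi * z.1.1 * z.2)) +
  (Im (phi (z.1.2 * lambda z.2)) * Re (psi (z.1.2 * lambda (- z.2))) -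
   Re (phi (z.1.2 * lambda z.2)) * Im (psi (z.1.2 * lambda (- z.2)))) *
   cos (- (2 * pi * z.1.1 * z.2)))); last first.
  by apply/funext => z; rewrite !complex_partsE /=; ring.
apply: measurable_funD; apply: measurable_funM.
- by apply: measurable_funD; apply: measurable_funM.
- exact: m5.
- by apply: measurable_funB; apply: measurable_funM.
- exact: m4.
Qed.

End Joint.
End WignerMeasurable.

Section WignerLog.
Context {R : realType}.
Local Notation leb := (@lebesgue_measure R).
Local Notation S := (schwartzPos R).
Local Notation Re := (@complex.Re R).
Local Notation Im := (@complex.Im R).
Implicit Types (phi psi : S) (s u x : R).

(** Real and imaginary parts of h_s(u) = conj (Phi p) * Psi q, whose Fourier
    integral is the conjugate of the Wigner distribution. *)
Definition cross_re phi psi s u : R :=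
  mixed (log_re phi) (log_re psi) s u + mixed (log_im phi) (log_im psi) s u.
Definition cross_im phi psi s u : R :=
  mixed (log_re phi) (log_im psi) s u + - mixed (log_im phi) (log_re psi) s u.

Lemma decaying_cross phi psi (theta : R -> R) n : (forall s, 0 <= theta s) ->
  {homo theta : x y / x <= y} ->
  (rapid theta n (log_re phi) /\ rapid theta n (log_im phi)) ->
  (rapid theta n (log_re psi) /\ rapid theta n (log_im psi)) ->
  decaying n (fun s u => theta s * cross_re phi psi s u) /\
  decaying n (fun s u => theta s * cross_im phi psi s u).
Proof.
move=> t0 tnd [A1 A2] [B1 B2].
split.
- have := decayingD (decaying_mixed t0 tnd A1 B1) (decaying_mixed t0 tnd A2 B2).
  by under eq_fun do under eq_fun do rewrite -mulrDr.
- have := decayingD (decaying_mixed t0 tnd A1 B2)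
    (decayingN (decaying_mixed t0 tnd A2 B1)).
  by under eq_fun do under eq_fun do rewrite -mulrN -mulrDr.
Qed.

Lemma decaying_cross1 phi psi n :
  decaying n (cross_re phi psi) /\ decaying n (cross_im phi psi).
Proof.
have := @decaying_cross phi psi (fun=> 1) n (fun=> ler01) (fun _ _ _ => lexx 1)
  (rapid_schwartz n phi) (rapid_schwartz n psi).
suff e (h : R -> R -> R) : (fun s u => 1 * h s u) = h by rewrite !e.
by apply/funext => s; apply/funext => u; rewrite mul1r.
Qed.

Lemma decaying_dominated n (h : R -> R -> R) s : decaying n h ->
  continuous (h s) /\ exists M : R, dominated M (h s).
Proof.
move=> D; split; first exact: decaying_continuous D.
by case: n D => [|n] [[M hM] _]; exists (M * lor s); exact: hM.
Qed.

Let wigner_parts phi psi x s u :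
  phi (expR s * lambda u) * conjc (psi (expR s * lambda (- u)))
      * cis (- (2 * pi * x * u)) =
  (cross_re phi psi s u * cos (2 * pi * x * u)
     - cross_im phi psi s u * sin (2 * pi * x * u)) +i*
  - (cross_re phi psi s u * sin (2 * pi * x * u)
     + cross_im phi psi s u * cos (2 * pi * x * u)).
Proof.
have -> : phi (expR s * lambda u) = logf phi (s + (u + ell u)).
  by rewrite lambdaE -expRD ellN.
have -> : psi (expR s * lambda (- u)) = logf psi (s + ell u).
  by rewrite lambdaE -expRD opprK.
rewrite /cis cosN sinN /cross_re /cross_im /mixed /log_re /log_im.
move: (logf phi _) (logf psi _) (cos _) (sin _) => z w c d.
by apply: complex_ext; rewrite !complex_partsE /=; ring.
Qed.

Lemma wigner_re_log phi psi x s : Re (wigner phi psi (x, expR s)) =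
  fcos (cross_re phi psi s) x - fsin (cross_im phi psi s) x.
Proof.
have [D1 D2] := decaying_cross1 phi psi 0.
have [c1 [M1 d1]] := decaying_dominated s D1.
have [c2 [M2 d2]] := decaying_dominated s D2.
rewrite /fcos /fsin -RintegralB//.
- by apply: eq_Rintegral => u _; rewrite /= wigner_parts.
- exact: integrable_cos_integrand c1 d1.
- exact: integrable_sin_integrand c2 d2.
Qed.

Lemma wigner_im_log phi psi x s : Im (wigner phi psi (x, expR s)) =
  - (fsin (cross_re phi psi s) x + fcos (cross_im phi psi s) x).
Proof.
have [D1 D2] := decaying_cross1 phi psi 0.
have [c1 [M1 d1]] := decaying_dominated s D1.
have [c2 [M2 d2]] := decaying_dominated s D2.
have i1 := integrable_sin_integrand x c1 d1.
have i2 := integrable_cos_integrand x c2 d2.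
rewrite /fcos /fsin -RintegralD// -mulN1r -RintegralZl//; last exact: RintegrableD.
by apply: eq_Rintegral => u _; rewrite /= wigner_parts mulN1r.
Qed.

End WignerLog.

(** * Pairings on the half-line *)
Section HalfLine.
Context {R : realType}.
Local Notation leb := (@lebesgue_measure R).
Local Notation S := (schwartzPos R).
Local Notation Re := (@complex.Re R).
Local Notation Im := (@complex.Im R).
Implicit Types (phi psi : S) (f g : R -> R) (s x : R).

(** Tame functions of s = ln a are integrable for da / a and stable under the
    operations that occur, products included because [lor] is at most 1. *)
Definition tame f : Prop := continuous f /\ exists M : R, dominated M f.

Lemma tameD f g : tame f -> tame g -> tame (fun s => f s + g s).
Proof.
move=> [cf [M fM]] [cg [N gN]]; split.
  by move=> s; apply: cvgD; [exact: cf|exact: cg].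
exists (M + N) => s; apply: le_trans (ler_normD _ _) _.
by rewrite mulrDl; exact: lerD.
Qed.

Lemma tameZ (c : R) f : tame f -> tame (fun s => c * f s).
Proof.
move=> [cf [M fM]]; split.
  by move=> s; apply: cvgM; [exact: cvg_cst|exact: cf].
by exists (`|c| * M) => s; rewrite normrM -mulrA ler_wpM2l.
Qed.

Lemma tameN f : tame f -> tame (fun s => - f s).
Proof. by move=> /(tameZ (-1)); under eq_fun do rewrite mulN1r. Qed.

Lemma tameB f g : tame f -> tame g -> tame (fun s => f s - g s).
Proof. by move=> tf /tameN; exact: tameD. Qed.

Lemma tameM f g : tame f -> tame g -> tame (fun s => f s * g s).
Proof.
move=> [cf [M fM]] [cg [N gN]]; split.
  by move=> s; apply: cvgM; [exact: cf|exact: cg].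
have N0 := dominated_ge0 gN.
exists (M * N) => s; rewrite normrM mulrAC; apply: ler_pM => //.
by apply: le_trans (gN s) _; rewrite ler_piMr// lor_le1.
Qed.

Let tame_log psi (P : R[i] -> R) : (forall z, `|P z| <= Normc.normc z) ->
  continuous (fun s => P (logf psi s)) -> tame (fun s => P (logf psi s)).
Proof.
move=> Pn cP; split=> //; have [M hM] := logf_bound psi; exists M => s.
have l0 := lor_ge0 s.
have M0 : 0 <= M.
  have := le_trans (normc_ge0 _) (hM s).
  by rewrite (pmulr_lge0 _ (exprn_gt0 2 (lor_gt0 s))).
apply: le_trans (Pn _) _; apply: le_trans (hM s) _.
by rewrite ler_wpM2l// expr2 ler_piMr// lor_le1.
Qed.

Lemma tame_log_re psi : tame (log_re psi).
Proof.
apply: (tame_log (@normr_Re_le R)).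
exact: is_derive_continuous (is_derive_log_re psi).
Qed.

Lemma tame_log_im psi : tame (log_im psi).
Proof.
apply: (tame_log (@normr_Im_le R)).
exact: is_derive_continuous (is_derive_log_im psi).
Qed.

Lemma tame_integrable f : tame f ->
  leb.-integrable `]0, +oo[ (EFin \o (fun a => f (ln a) * a^-1)).
Proof.
move=> [cf [M fM]].
apply: (@le_Rintegrable _ _ _ leb _ _ (fun a => M * (lor (ln a) * a^-1))).
- exact: measurable_itv.
- by have := measurable_comp_ln_div cf.
- move=> a /=; rewrite in_itv /= andbT => a0.
  have a1 : 0 <= a^-1 by rewrite invr_ge0 ltW.
  by rewrite normrM mulrA [`|a^-1|]ger0_norm// ler_wpM2r.
- by apply: RintegrableZl; [exact: measurable_itv|exact: integrable_lor_ln].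
Qed.

(** Two integrands that differ by a total derivative have the same
    integral. *)
Lemma Rintegral_ln_eq F f g : tame F -> tame f -> tame g ->
  (forall s, is_derive s (1 : R) F (f s - g s)) ->
  \int[leb]_(a in `]0, +oo[) (f (ln a) * a^-1) =
  \int[leb]_(a in `]0, +oo[) (g (ln a) * a^-1).
Proof.
move=> [_ [M FM]] tf tg dF; have tB := tameB tf tg.
apply/eqP; rewrite -subr_eq0 -RintegralB; last 3 first.
- exact: measurable_itv.
- exact: tame_integrable tf.
- exact: tame_integrable tg.
rewrite (@eq_Rintegral _ _ _ leb _ (fun a => (fun s => f s - g s) (ln a) * a^-1)); last first.
  by move=> a _; rewrite mulrBl.
apply/eqP; rewrite -[RHS](subrr 0); apply: (Rintegral_derive_ln dF) => //.
- by case: tB.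
- exact: tame_integrable tB.
- exact: dominated_cvg0 FM cvgNy_lor.
- exact: dominated_cvg0 FM cvgy_lor.
Qed.

Lemma half_eq (F G : R -> R) : (forall s, F (expR s) = G (expR s)) ->
  \int[leb]_(a in `]0, +oo[) F a = \int[leb]_(a in `]0, +oo[) G a.
Proof.
move=> FG; apply: eq_Rintegral => a; rewrite inE /= in_itv /= andbT => a0.
by rewrite -[a]lnK.
Qed.

(** Real and imaginary parts of conj (Phi s) * Psi s, the value of h_s at
    u = 0. *)
Definition pair_re phi psi s : R :=
  log_re psi s * log_re phi s + log_im psi s * log_im phi s.
Definition pair_im phi psi s : R :=
  log_im psi s * log_re phi s - log_re psi s * log_im phi s.

Lemma tame_pair_re phi psi : tame (pair_re phi psi).
Proof.
by apply: tameD; apply: tameM; (exact: tame_log_re || exact: tame_log_im).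
Qed.

Lemma tame_pair_im phi psi : tame (pair_im phi psi).
Proof.
by apply: tameB; apply: tameM; (exact: tame_log_re || exact: tame_log_im).
Qed.

Lemma fun_pairingE phi psi : fun_pairing psi phi =
  (\int[leb]_(a in `]0, +oo[) (pair_re phi psi (ln a) * a^-1)) +i*
  (\int[leb]_(a in `]0, +oo[) (pair_im phi psi (ln a) * a^-1)).
Proof.
rewrite /fun_pairing /cintegral; congr (_ +i* _).
- apply: half_eq => s; rewrite expRK /pair_re /log_re /log_im /logf.
  by rewrite !complex_partsE /=; ring.
- apply: half_eq => s; rewrite expRK /pair_im /log_re /log_im /logf.
  by rewrite !complex_partsE /=; ring.
Qed.

End HalfLine.

(** * Pairings with the Wigner distribution *)
Section Pairings.
Context {R : realType}.
Local Notation leb := (@lebesgue_measure R).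
Local Notation strip := (setT `*` `]0, +oo[ : set (measurableTypeR R * measurableTypeR R)).
Local Notation S := (schwartzPos R).
Local Notation Re := (@complex.Re R).
Local Notation Im := (@complex.Im R).
Implicit Types (phi psi : S) (s x : R).

Lemma decaying_inversion (h : R -> R -> R) s : decaying 2 h ->
  [/\ leb.-integrable setT (EFin \o fcos (h s)),
      leb.-integrable setT (EFin \o fsin (h s)),
      \int[leb]_x fcos (h s) x = h s 0 & \int[leb]_x fsin (h s) x = 0].
Proof.
move=> Dh; have [C [C0 hC]] := decaying_transform_bound Dh.
have [ch [M hM]] := decaying_dominated s Dh.
have [_ [h' dh Dh']] := Dh.
have [ch' [N hN]] := decaying_dominated s (Dh' : decaying 1 h').
have mh := continuous_measurable_fun ch.
have mw (trig : R -> R) : continuous trig -> measurable_fun setT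
    (fun z : R * R => h s z.2 * trig (2 * pi * z.1 * z.2)).
  move=> /continuous_measurable_fun mt; apply: measurable_funM.
    exact: (measurableT_comp mh measurable_snd).
  apply: (measurableT_comp mt); apply: measurable_funM; last exact: measurable_snd.
  by apply: measurable_funM => //; exact: measurable_fst.
have mc := measurable_Rintegral_param leb (mw _ (@continuous_cos R)).
have ms := measurable_Rintegral_param leb (mw _ (@continuous_sin R)).
have il : leb.-integrable setT (EFin \o (fun x => C * lor s * lor x)).
  by apply: RintegrableZl => //; exact: integrable_lor.
have ic : leb.-integrable setT (EFin \o fcos (h s)).
  apply: (@le_Rintegrable _ _ _ leb _ _ (fun x => C * lor s * lor x)) => //.
  by move=> x _; rewrite -mulrA; exact: (hC s x).1.
have is_ : leb.-integrable setT (EFin \o fsin (h s)).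
  apply: (@le_Rintegrable _ _ _ leb _ _ (fun x => C * lor s * lor x)) => //.
  by move=> x _; rewrite -mulrA; exact: (hC s x).2.
split=> //; first exact: fcos_inversion (dh s) hM hN ic.
exact: Rintegral_fsin ch hM is_.
Qed.

Lemma fcosZ (c M : R) (h : R -> R) x : continuous h -> dominated M h ->
  fcos (fun u => c * h u) x = c * fcos h x.
Proof.
move=> ch hM; rewrite /fcos -RintegralZl//; last exact: integrable_cos_integrand ch hM.
by apply: eq_Rintegral => u _; rewrite mulrA.
Qed.

Lemma fsinZ (c M : R) (h : R -> R) x : continuous h -> dominated M h ->
  fsin (fun u => c * h u) x = c * fsin h x.
Proof.
move=> ch hM; rewrite /fsin -RintegralZl//; last exact: integrable_sin_integrand ch hM.
by apply: eq_Rintegral => u _; rewrite mulrA.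
Qed.

Lemma measurable_invr_pos : measurable_fun (`]0, +oo[%classic : set R) (fun a => a^-1).
Proof.
apply: open_continuous_measurable_fun; first exact: interval_open.
move=> a; rewrite inE /= in_itv /= andbT => a0.
by apply: cvgV; [rewrite gt_eqF|exact: cvg_id].
Qed.

Let measurable_strip_integrand (g w : R * R -> R) : measurable_fun setT g ->
  measurable_fun setT w -> measurable_fun strip (fun p => g p * w p * p.2^-1).
Proof.
move=> mg mw; apply: measurable_funM.
  by apply: measurable_funM; exact: measurable_funTS.
apply: (measurable_comp (F := `]0, +oo[%classic : set R)).
- exact: measurable_itv.
- by move=> _ [[x a] [_ xa] <-].
- exact: measurable_invr_pos.
- exact: measurable_funTS measurable_snd.
Qed.

Let aff_integrandE (g : R * R -> R) (W : R * R -> R[i]) p :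
  aff_integrand (fun p => (g p)%:C) W p =
  (g p * Re (W p) * p.2^-1) +i* (- (g p * Im (W p) * p.2^-1)).
Proof. by apply: complex_ext; rewrite !complex_partsE /=; ring. Qed.

(** Absolute convergence is joint integrability in x and a, which bounds for
    each fixed a do not give; a bound that is a product in x and a does. *)
Lemma aff_pairing_converges_dominated (g : R * R -> R) phi psi (C : R) : 0 <= C -> measurable_fun setT g ->
  (forall x s, `|g (x, expR s) * Re (wigner phi psi (x, expR s))|
     <= C * (lor s * lor x)) ->
  (forall x s, `|g (x, expR s) * Im (wigner phi psi (x, expR s))|
     <= C * (lor s * lor x)) ->
  aff_pairing_converges (fun p => (g p)%:C) (wigner phi psi).
Proof.
move=> C0 mg bR bI.
have bnd (w : R * R -> R) : measurable_fun setT w ->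
    (forall x s, `|g (x, expR s) * w (x, expR s)| <= C * (lor s * lor x)) ->
    (leb \x leb)%E.-integrable strip (EFin \o (fun p : R * R => g p * w p * p.2^-1)).
  move=> mw b; apply: (integrable_strip_dominated C0).
    exact: measurable_strip_integrand.
  move=> x a a0; have a1 : 0 <= a^-1 by rewrite invr_ge0 ltW.
  rewrite normrM [`|_^-1|]ger0_norm// mulrA ler_wpM2r//=.
  by rewrite -[in leLHS](@lnK _ a)// mulrAC -mulrA.
split.
- have := bnd _ (measurable_wigner_re phi psi) bR.
  congr (is_true (_.-integrable _ _)); apply/funext => p.
  by rewrite aff_integrandE /=.
- have := RintegrableZl (- 1) measurable_strip (bnd _ (measurable_wigner_im phi psi) bI).
  congr (is_true (_.-integrable _ _)); apply/funext => p.
  by rewrite aff_integrandE /= mulN1r.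
Qed.

(** The sign of [ci] comes from the conjugation of the Wigner distribution in
    the pairing. *)
Lemma aff_pairing_fubini (g : R * R -> R) phi psi (cr ci : R -> R) :
  aff_pairing_converges (fun p => (g p)%:C) (wigner phi psi) ->
  (forall s, leb.-integrable setT
     (EFin \o (fun x => g (x, expR s) * Re (wigner phi psi (x, expR s))))) ->
  (forall s, leb.-integrable setT
     (EFin \o (fun x => g (x, expR s) * Im (wigner phi psi (x, expR s))))) ->
  (forall s, \int[leb]_x (g (x, expR s) * Re (wigner phi psi (x, expR s))) = cr s) ->
  (forall s, \int[leb]_x (g (x, expR s) * Im (wigner phi psi (x, expR s))) = - ci s) ->
  aff_pairing (fun p => (g p)%:C) (wigner phi psi) =
  (\int[leb]_(a in `]0, +oo[) (cr (ln a) * a^-1)) +i*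
  (\int[leb]_(a in `]0, +oo[) (ci (ln a) * a^-1)).
Proof.
move=> [i1 i2] iR iI eR eI; rewrite /aff_pairing /cintegral; congr (_ +i* _).
- rewrite Rintegral_strip//; last first.
    move=> a a0.
    have := RintegrableZl a^-1 measurableT (iR (ln a)).
    rewrite lnK//; congr (is_true (_.-integrable _ _)); apply/funext => x.
    apply: (congr1 EFin); rewrite aff_integrandE; exact: mulrC.
  apply: half_eq => s; rewrite expRK -eR -RintegralZr//.
  by apply: eq_Rintegral => x _; rewrite aff_integrandE.
- rewrite Rintegral_strip//; last first.
    move=> a a0.
    have := RintegrableZl (- a^-1) measurableT (iI (ln a)).
    rewrite lnK//; congr (is_true (_.-integrable _ _)); apply/funext => x.
    apply: (congr1 EFin); rewrite aff_integrandE [RHS]/=.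
    by rewrite mulNr mulrC.
  apply: half_eq => s; rewrite expRK -[ci s]opprK -eI mulNr -mulrN -RintegralZr//.
  by apply: eq_Rintegral => x _; rewrite aff_integrandE /= mulrN.
Qed.

(** The factor a = exp s is absorbed by the exponential weight on Phi and
    Psi. *)
Lemma coord_a_converges phi psi :
  rapid expR 2 (log_re phi) /\ rapid expR 2 (log_im phi) ->
  rapid expR 2 (log_re psi) /\ rapid expR 2 (log_im psi) ->
  aff_pairing_converges (@coord_a R) (wigner phi psi).
Proof.
move=> rphi rpsi.
have end_ : {homo (@expR R) : x y / x <= y} by move=> x y; rewrite ler_expR.
have [D1 D2] := decaying_cross (@expR_ge0 R) end_ rphi rpsi.
have [C1 [C10 h1]] := decaying_transform_bound D1.
have [C2 [C20 h2]] := decaying_transform_bound D2.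
have [E1 E2] := decaying_cross1 phi psi 0.
apply: (@aff_pairing_converges_dominated (fun p => p.2) _ _ (C1 + C2)); first exact: addr_ge0.
- exact: measurable_snd.
- move=> x s; have [c1 [M1 d1]] := decaying_dominated s E1.
  have [c2 [M2 d2]] := decaying_dominated s E2.
  rewrite wigner_re_log /= mulrBr -(fcosZ _ _ c1 d1) -(fsinZ _ _ c2 d2).
  apply: le_trans (ler_normB _ _) _; rewrite mulrDl.
  by apply: lerD; [exact: (h1 s x).1|exact: (h2 s x).2].
- move=> x s; have [c1 [M1 d1]] := decaying_dominated s E1.
  have [c2 [M2 d2]] := decaying_dominated s E2.
  rewrite wigner_im_log /= mulrN normrN mulrDr -(fcosZ _ _ c2 d2) -(fsinZ _ _ c1 d1).
  apply: le_trans (ler_normD _ _) _; rewrite mulrDl.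
  by apply: lerD; [exact: (h1 s x).2|exact: (h2 s x).1].
Qed.

(** Integrating in x first, Fourier inversion leaves exp s * h_s(0).  The
    convergence is a hypothesis, since [weyl] prescribes the functional at
    every phi for which the pairing converges. *)
Lemma coord_a_pairing phi psi :
  aff_pairing_converges (@coord_a R) (wigner phi psi) ->
  aff_pairing (@coord_a R) (wigner phi psi) =
  (\int[leb]_(a in `]0, +oo[) (expR (ln a) * pair_re phi psi (ln a) * a^-1)) +i*
  (\int[leb]_(a in `]0, +oo[) (expR (ln a) * pair_im phi psi (ln a) * a^-1)).
Proof.
move=> cv; have [D1 D2] := decaying_cross1 phi psi 2.
apply: (@aff_pairing_fubini (fun p => p.2) _ _ (fun s => expR s * pair_re phi psi s)
  (fun s => expR s * pair_im phi psi s)) => // s;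
  have [ic1 is1 jc1 js1] := decaying_inversion s D1;
  have [ic2 is2 jc2 js2] := decaying_inversion s D2.
- apply: RintegrableZl => //; under eq_fun do rewrite wigner_re_log.
  exact: RintegrableB.
- apply: RintegrableZl => //; under eq_fun do rewrite wigner_im_log -mulN1r.
  by apply: RintegrableZl => //; exact: RintegrableD.
- under eq_Rintegral do rewrite wigner_re_log.
  rewrite RintegralZl//; last exact: RintegrableB.
  rewrite RintegralB// jc1 js2 subr0 /cross_re !mixed0 /pair_re.
  by congr (_ * _); ring.
- under eq_Rintegral do rewrite wigner_im_log mulrN -mulNr /=.
  rewrite RintegralZl//; last exact: RintegrableD.
  rewrite RintegralD// js1 jc2 add0r mulNr /cross_im !mixed0 /pair_im.
  by congr (- (_ * _)); ring.
Qed.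

End Pairings.

(** * The quantization of the coordinate x *)
Section CoordinateX.
Context {R : realType}.
Local Notation leb := (@lebesgue_measure R).
Local Notation S := (schwartzPos R).
Local Notation Re := (@complex.Re R).
Local Notation Im := (@complex.Im R).
Implicit Types (phi psi : S) (s x : R).

Lemma is_derive_pair_re phi psi s : is_derive s (1 : R) (pair_re phi psi)
  (pair_re (euler phi) psi s + pair_re phi (euler psi) s).
Proof.
have := is_deriveD
  (is_deriveM (is_derive_log_re psi s) (is_derive_log_re phi s))
  (is_deriveM (is_derive_log_im psi s) (is_derive_log_im phi s)).
move=> /is_derive_eq; apply; rewrite /GRing.scale /= /pair_re; ring.
Qed.

Lemma is_derive_pair_im phi psi s : is_derive s (1 : R) (pair_im phi psi)
  (pair_im (euler phi) psi s + pair_im phi (euler psi) s).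
Proof.
have := is_deriveB
  (is_deriveM (is_derive_log_im psi s) (is_derive_log_re phi s))
  (is_deriveM (is_derive_log_re psi s) (is_derive_log_im phi s)).
move=> /is_derive_eq; apply; rewrite /GRing.scale /= /pair_im; ring.
Qed.

Lemma is_derive_cross_re0 phi psi s :
  is_derive (0 : R) (1 : R) (cross_re phi psi s)
    (2^-1 * (pair_re (euler phi) psi s - pair_re phi (euler psi) s)).
Proof.
have := is_deriveD
  (is_derive_mixed s 0 (is_derive_log_re phi) (is_derive_log_re psi))
  (is_derive_mixed s 0 (is_derive_log_im phi) (is_derive_log_im psi)).
by move=> /is_derive_eq; apply; rewrite !mixed0 emean1_0 /pair_re; field.
Qed.

Lemma is_derive_cross_im0 phi psi s :
  is_derive (0 : R) (1 : R) (cross_im phi psi s)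
    (2^-1 * (pair_im (euler phi) psi s - pair_im phi (euler psi) s)).
Proof.
have := is_deriveD
  (is_derive_mixed s 0 (is_derive_log_re phi) (is_derive_log_im psi))
  (is_deriveN (is_derive_mixed s 0 (is_derive_log_im phi) (is_derive_log_re psi))).
by move=> /is_derive_eq; apply; rewrite !mixed0 emean1_0 /pair_im; field.
Qed.

Let k : R := (2 * pi)^-1.

Let pi2 : (2 : R) * pi != 0.
Proof. by rewrite mulf_neq0// gt_eqF// pi_gt0. Qed.

(** Multiplication by x costs one derivative in u, hence the order 3. *)
Let mulx_fcos (h h' : R -> R -> R) s x : decaying 3 h ->
  (forall s u, is_derive u (1 : R) (h s) (h' s u)) -> decaying 2 h' ->
  x * fcos (h s) x = - (k * fsin (h' s) x) /\
  x * fsin (h s) x = k * fcos (h' s) x.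
Proof.
move=> Dh dh Dh'; have [_ [M hM]] := decaying_dominated s Dh.
have [ch' [N hN]] := decaying_dominated s Dh'.
rewrite (fsin_derive (dh s) ch' hM hN) (fcos_derive (dh s) ch' hM hN).
have e y : k * (2 * pi * x * y) = x * y.
  by rewrite -(mulrA (2 * pi) x y) mulrA /k (mulVf pi2) mul1r.
by rewrite mulrN opprK !e.
Qed.

Lemma coord_x_converges phi psi :
  aff_pairing_converges (@coord_x R) (wigner phi psi).
Proof.
have [D1 D2] := decaying_cross1 phi psi 3.
have [_ [h1 dh1 Dh1]] := D1; have [_ [h2 dh2 Dh2]] := D2.
have [C1 [C10 b1]] := decaying_transform_bound Dh1.
have [C2 [C20 b2]] := decaying_transform_bound Dh2.
have k0 : 0 <= k by rewrite invr_ge0 mulr_ge0// pi_ge0.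
apply: (@aff_pairing_converges_dominated _ (fun p => p.1) _ _ (k * (C1 + C2))).
- by rewrite mulr_ge0// addr_ge0.
- exact: measurable_fst.
- move=> x s.
  have [e1 _] := mulx_fcos s x D1 dh1 Dh1; have [_ e2] := mulx_fcos s x D2 dh2 Dh2.
  rewrite wigner_re_log /= mulrBr e1 e2 -opprD normrN -mulrDr normrM ger0_norm//.
  rewrite -mulrA ler_wpM2l// mulrDl; apply: le_trans (ler_normD _ _) _.
  by apply: lerD; [exact: (b1 s x).2|exact: (b2 s x).1].
- move=> x s.
  have [_ e1] := mulx_fcos s x D1 dh1 Dh1; have [e2 _] := mulx_fcos s x D2 dh2 Dh2.
  rewrite wigner_im_log /= mulrN normrN mulrDr e1 e2 -mulrBr normrM ger0_norm//.
  rewrite -mulrA ler_wpM2l// mulrDl; apply: le_trans (ler_normB _ _) _.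
  by apply: lerD; [exact: (b1 s x).1|exact: (b2 s x).2].
Qed.

Definition two_pi_i : R[i] := 2 * pi%:C * 'i%C.

Lemma two_pi_iE : two_pi_i = 0 +i* (2 * pi).
Proof.
by rewrite /two_pi_i; apply: complex_ext; rewrite !complex_partsE /=; ring.
Qed.

Lemma two_pi_i_neq0 : two_pi_i != 0.
Proof.
rewrite two_pi_iE; apply/eqP => /(congr1 Im) /= /eqP.
by rewrite (negbTE pi2).
Qed.

Lemma two_pi_iV : two_pi_i^-1 = 0 +i* - k.
Proof.
apply: (mulfI two_pi_i_neq0); rewrite mulfV ?two_pi_i_neq0// two_pi_iE.
have e : (2 * pi) * k = 1 by rewrite /k mulfV.
apply: complex_ext; rewrite !complex_partsE /=; last by ring.
by rewrite mul0r sub0r mulrN opprK e.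
Qed.

Let pair_re_scaled phi psi s :
  pair_re phi (two_pi_i^-1 *: euler psi) s = k * pair_im phi (euler psi) s.
Proof.
rewrite /pair_re /pair_im /log_re /log_im logfZ two_pi_iV.
by rewrite !complex_partsE /=; ring.
Qed.

Let pair_im_scaled phi psi s :
  pair_im phi (two_pi_i^-1 *: euler psi) s = - (k * pair_re phi (euler psi) s).
Proof.
rewrite /pair_re /pair_im /log_re /log_im logfZ two_pi_iV.
by rewrite !complex_partsE /=; ring.
Qed.

(** Fourier inversion applied to h_s' leaves - (2 pi i)^-1 h_s'(0), which is
    (4 pi i)^-1 (conj Phi Psi' - conj Phi' Psi).  This differs from
    (2 pi i)^-1 conj Phi Psi' by the total derivative
    (4 pi i)^-1 (conj Phi Psi)', whose integral vanishes. *)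
Lemma coord_x_pairing phi psi : aff_pairing (@coord_x R) (wigner phi psi) =
  fun_pairing (two_pi_i^-1 *: euler psi) phi.
Proof.
have [D1 D2] := decaying_cross1 phi psi 3.
have [_ [h1 dh1 Dh1]] := D1; have [_ [h2 dh2 Dh2]] := D2.
have v1 s : h1 s 0 = 2^-1 * (pair_re (euler phi) psi s - pair_re phi (euler psi) s).
  have d := is_derive_cross_re0 phi psi s; have d' := dh1 s 0.
  by rewrite -(@derive_val _ _ _ _ _ _ _ d) (@derive_val _ _ _ _ _ _ _ d').
have v2 s : h2 s 0 = 2^-1 * (pair_im (euler phi) psi s - pair_im phi (euler psi) s).
  have d := is_derive_cross_im0 phi psi s; have d' := dh2 s 0.
  by rewrite -(@derive_val _ _ _ _ _ _ _ d) (@derive_val _ _ _ _ _ _ _ d').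
(* Real and imaginary parts of - (2 pi i)^-1 h_s'(0). *)
pose cr s := - k * (2^-1 * (pair_im (euler phi) psi s - pair_im phi (euler psi) s)).
pose ci s := k * (2^-1 * (pair_re (euler phi) psi s - pair_re phi (euler psi) s)).
have eR s x : x * Re (wigner phi psi (x, expR s)) =
    - k * (fsin (h1 s) x + fcos (h2 s) x).
  have [e1 _] := mulx_fcos s x D1 dh1 Dh1; have [_ e2] := mulx_fcos s x D2 dh2 Dh2.
  by rewrite wigner_re_log mulrBr e1 e2; ring.
have eI s x : x * Im (wigner phi psi (x, expR s)) =
    - k * (fcos (h1 s) x - fsin (h2 s) x).
  have [_ e1] := mulx_fcos s x D1 dh1 Dh1; have [e2 _] := mulx_fcos s x D2 dh2 Dh2.
  by rewrite wigner_im_log mulrN mulrDr e1 e2; ring.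
rewrite (@aff_pairing_fubini _ (fun p => p.1) _ _ cr ci).
- rewrite fun_pairingE; congr (_ +i* _).
  + apply: (@Rintegral_ln_eq _ (fun s => - k * 2^-1 * pair_im phi psi s)).
    * exact: tameZ (tame_pair_im phi psi).
    * by apply: tameZ; apply: tameZ; apply: tameB; exact: tame_pair_im.
    * exact: tame_pair_re.
    * move=> s; have := is_deriveZ (- k * 2^-1) (is_derive_pair_im phi psi s).
      move=> /is_derive_eq; apply; rewrite /GRing.scale /= /cr pair_re_scaled.
      by field.
  + apply: (@Rintegral_ln_eq _ (fun s => k * 2^-1 * pair_re phi psi s)).
    * exact: tameZ (tame_pair_re phi psi).
    * by apply: tameZ; apply: tameZ; apply: tameB; exact: tame_pair_re.
    * exact: tame_pair_im.
    * move=> s; have := is_deriveZ (k * 2^-1) (is_derive_pair_re phi psi s).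
      move=> /is_derive_eq; apply; rewrite /GRing.scale /= /ci pair_im_scaled.
      by field.
- exact: coord_x_converges.
- move=> s; have [i1 i2 j1 j2] := decaying_inversion s Dh1.
  have [i3 i4 j3 j4] := decaying_inversion s Dh2.
  have := RintegrableZl (- k) measurableT (RintegrableD measurableT i2 i3).
  by under eq_fun do rewrite -eR.
- move=> s; have [i1 i2 j1 j2] := decaying_inversion s Dh1.
  have [i3 i4 j3 j4] := decaying_inversion s Dh2.
  have := RintegrableZl (- k) measurableT (RintegrableB measurableT i1 i4).
  by under eq_fun do rewrite -eI.
- move=> s; have [i1 i2 j1 j2] := decaying_inversion s Dh1.
  have [i3 i4 j3 j4] := decaying_inversion s Dh2.
  under eq_Rintegral do rewrite eR.
  by rewrite RintegralZl//; [rewrite RintegralD// j2 j3 add0r v2|exact: RintegrableD].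
- move=> s; have [i1 i2 j1 j2] := decaying_inversion s Dh1.
  have [i3 i4 j3 j4] := decaying_inversion s Dh2.
  under eq_Rintegral do rewrite eI.
  rewrite RintegralZl//; last exact: RintegrableB.
  by rewrite RintegralB// j1 j4 subr0 v1 /ci mulNr.
Qed.

End CoordinateX.

(** * Functionals given by Schwartz functions *)
Section FunPairing.
Context {R : realType}.
Local Notation leb := (@lebesgue_measure R).
Local Notation S := (schwartzPos R).
Local Notation Re := (@complex.Re R).
Local Notation Im := (@complex.Im R).
Local Notation normc := (@Normc.normc R).
Implicit Types (phi psi chi g h : S) (s x : R) (c : R[i]).

Let hint (f : R -> R) : R := \int[leb]_(a in `]0, +oo[) (f (ln a) * a^-1).

Let hint_lin (a b : R) f1 f2 f3 : tame f1 -> tame f2 -> tame f3 ->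
  hint (fun s => a * f1 s + b * f2 s + f3 s) = a * hint f1 + b * hint f2 + hint f3.
Proof.
move=> t1 t2 t3.
have mD : measurable (`]0, +oo[%classic : set (measurableTypeR R)).
  exact: measurable_itv.
have i1 := tame_integrable t1; have i2 := tame_integrable t2.
have i3 := tame_integrable t3.
rewrite /hint -!RintegralZl// -!RintegralD//; try exact: RintegrableZl.
- by apply: eq_Rintegral => r _; ring.
- by apply: RintegrableD => //; exact: RintegrableZl.
Qed.

Lemma fun_pairing_antilinear g : antilinear (fun_pairing g).
Proof.
move=> c phi chi; rewrite !fun_pairingE.
have tr phi' := tame_pair_re phi' g; have ti phi' := tame_pair_im phi' g.
apply: complex_ext; rewrite !complex_partsE /=.
- have := hint_lin (Re c) (Im c) (tr phi) (ti phi) (tr chi).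
  rewrite /hint mulNr opprK => <-; apply: half_eq => s; rewrite expRK.
  by congr (_ * _); rewrite /pair_re /pair_im /log_re /log_im logfD logfZ !complex_partsE; ring.
- have := hint_lin (Re c) (- Im c) (ti phi) (tr phi) (ti chi).
  rewrite /hint => <-; apply: half_eq => s; rewrite expRK.
  by congr (_ * _); rewrite /pair_re /pair_im /log_re /log_im logfD logfZ !complex_partsE; ring.
Qed.

Lemma fun_pairing_lin c g h phi :
  fun_pairing (c *: g + h) phi = c * fun_pairing g phi + fun_pairing h phi.
Proof.
rewrite !fun_pairingE.
have tr g' := tame_pair_re phi g'; have ti g' := tame_pair_im phi g'.
apply: complex_ext; rewrite !complex_partsE /=.
- have := hint_lin (Re c) (- Im c) (tr g) (ti g) (tr h).
  rewrite /hint mulNr => <-; apply: half_eq => s; rewrite expRK.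
  by congr (_ * _); rewrite /pair_re /pair_im /log_re /log_im logfD logfZ !complex_partsE; ring.
- have := hint_lin (Re c) (Im c) (ti g) (tr g) (ti h).
  rewrite /hint => <-; apply: half_eq => s; rewrite expRK.
  by congr (_ * _); rewrite /pair_re /pair_im /log_re /log_im logfD logfZ !complex_partsE; ring.
Qed.

Lemma fun_pairingZ c g : fun_pairing (c *: g) = c *: fun_pairing g.
Proof.
apply/funext => phi; have := fun_pairing_lin c g 0 phi; rewrite addr0 => ->.
suff -> : fun_pairing (0 : S) phi = 0 by rewrite addr0.
by have := fun_pairing_lin (-1) 0 0 phi; rewrite scaler0 addr0 mulN1r addNr.
Qed.

Lemma fun_pairingB g h : fun_pairing (g - h) = fun_pairing g - fun_pairing h.
Proof.
apply/funext => phi; rewrite !fctE -[in RHS]mulN1r addrC -fun_pairing_lin.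
by rewrite scaleN1r addrC.
Qed.

Lemma seminorm_has_sup phi j k :
  has_sup (range (schwartz_weight j k (logf phi))).
Proof.
have [_ /(_ j k)[M hM]] := schwartz_logf phi.
split; first by exists (schwartz_weight j k (logf phi) 0), 0.
by exists M => _ [x _ <-]; exact: hM.
Qed.

Lemma seminorm_le phi j k (M : R) :
  (forall x, schwartz_weight j k (logf phi) x <= M) ->
  schwartz_seminorm j k (logf phi) <= M.
Proof.
move=> hM; apply: ge_sup; first by exists (schwartz_weight j k (logf phi) 0), 0.
by move=> _ [x _ <-]; exact: hM.
Qed.

Lemma normc_logf_le phi s : normc (logf phi s) <= schwartz_seminorm 0 0 (logf phi).
Proof.
apply: sup_upper_bound; first exact: seminorm_has_sup.
by exists s => //; rewrite /schwartz_weight expr0 mul1r.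
Qed.

Lemma tempered_fun_pairing g : tempered (fun_pairing g).
Proof.
split; first exact: fun_pairing_antilinear.
have [M hM] := logf_bound g.
pose K : R := \int[leb]_(a in `]0, +oo[) (lor (ln a) * a^-1).
have mD : measurable (`]0, +oo[%classic : set (measurableTypeR R)).
  exact: measurable_itv.
exists (4 * (M * K)), 0 => phi; rewrite !big_ord1.
set p := schwartz_seminorm 0 0 _.
have hp s : normc (logf phi s) <= p by exact: normc_logf_le.
have p0 : 0 <= p by exact: le_trans (normc_ge0 _) (hp 0).
have M0 : 0 <= M.
  have := le_trans (normc_ge0 _) (hM 0).
  by rewrite (pmulr_lge0 _ (exprn_gt0 2 (lor_gt0 (0 : R)))).
have gb s : normc (logf g s) <= M * lor s.
  apply: le_trans (hM s) _; rewrite ler_wpM2l// expr2.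
  by rewrite ler_piMr ?lor_ge0 ?lor_le1.
have bound f : tame f -> (forall s, `|f s| <= 2 * (M * lor s) * p) ->
    `|\int[leb]_(a in `]0, +oo[) (f (ln a) * a^-1)| <= 2 * M * p * K.
  move=> [cf _] fb; rewrite /K -RintegralZl//; last exact: integrable_lor_ln.
  apply: normr_Rintegral_le => //.
  - by have := measurable_comp_ln_div cf.
  - move=> a /=; rewrite in_itv /= andbT => a0.
    have a1 : 0 <= a^-1 by rewrite invr_ge0 ltW.
    rewrite normrM [`|a^-1|]ger0_norm// mulrA ler_wpM2r//.
    by apply: le_trans (fb _) _; rewrite le_eqVlt; apply/orP; left; apply/eqP; ring.
  - by apply: RintegrableZl => //; exact: integrable_lor_ln.
have prod (z w : R[i]) (m q : R) : normc z <= m -> normc w <= q ->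
    [/\ `|Re z * Re w| <= m * q, `|Im z * Im w| <= m * q,
        `|Im z * Re w| <= m * q & `|Re z * Im w| <= m * q].
  move=> zm wq; have zr := le_trans (normr_Re_le z) zm.
  have zi := le_trans (normr_Im_le z) zm; have wr := le_trans (normr_Re_le w) wq.
  have wi := le_trans (normr_Im_le w) wq.
  by split; rewrite normrM ler_pM.
rewrite fun_pairingE; apply: le_trans (normc_le _) _ => /=.
rewrite (_ : 4 * (M * K) * p = 2 * M * p * K + 2 * M * p * K); last by ring.
apply: lerD; apply: bound; try exact: tame_pair_re; try exact: tame_pair_im.
- move=> s; have [h1 h2 _ _] := prod _ _ _ _ (gb s) (hp s).
  apply: le_trans (ler_normD _ _) _.
  by rewrite -mulrA (mulr_natl _ 2) mulr2n; exact: lerD.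
- move=> s; have [_ _ h1 h2] := prod _ _ _ _ (gb s) (hp s).
  apply: le_trans (ler_normB _ _) _.
  by rewrite -mulrA (mulr_natl _ 2) mulr2n; exact: lerD.
Qed.

End FunPairing.

(** * Uniqueness of tempered functionals *)
Section Density.
Context {R : realType}.
Local Notation S := (schwartzPos R).
Local Notation normc := (@Normc.normc R).
Implicit Types (phi psi g : S) (s x e : R) (c : R[i]).

(** In the coordinate r = exp s this is e r / (1 + e r): its complement
    1 / (1 + e r) makes r * phi / (1 + e r) bounded by |phi| / e. *)
Definition tau e s : R := e * expR s / (1 + e * expR s).

Let den_gt0 e s : 0 < e -> 0 < 1 + e * expR s.
Proof. by move=> e0; rewrite ltr_pwDl// mulr_ge0 ?expR_ge0// ltW. Qed.

Lemma tau_ge0 e s : 0 < e -> 0 <= tau e s.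
Proof.
by move=> e0; rewrite divr_ge0 ?mulr_ge0 ?expR_ge0 ?(ltW e0)// ltW// den_gt0.
Qed.

Lemma tau_le1 e s : 0 < e -> tau e s <= 1.
Proof. by move=> e0; rewrite ler_pdivrMr ?den_gt0// mul1r lerDr. Qed.

Lemma tau_le e s : 0 < e -> tau e s <= e * expR s.
Proof.
move=> e0; have t0 : 0 <= e * expR s by rewrite mulr_ge0 ?expR_ge0// ltW.
by rewrite ler_pdivrMr ?den_gt0// ler_peMr// lerDl.
Qed.

(** The logistic equation tau' = tau (1 - tau): the s-derivatives of tau are
    polynomials in tau without constant term, with coefficients that do not
    depend on e. *)
Lemma is_derive_tau e s : 0 < e ->
  is_derive s (1 : R) (tau e) (tau e s * (1 - tau e s)).
Proof.
move=> e0; have d0 := lt0r_neq0 (den_gt0 s e0).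
have d1 : is_derive s (1 : R) (fun s => e * expR s) (e * expR s).
  by have := is_deriveZ e (is_derive_expR s).
have d2 : is_derive s (1 : R) (fun s => 1 + e * expR s) (e * expR s).
  have := is_deriveD (is_derive_cst (1 : R) s (1 : R)) d1.
  by rewrite add0r.
have := is_deriveM d1 (@is_deriveV _ (fun s => 1 + e * expR s) _ _ _ d0 d2).
move=> /is_derive_eq; apply; rewrite /GRing.scale /= /tau.
by field.
Qed.

(** Every generator keeps a factor tau, so that the whole span, which is
    stable under differentiation, becomes small with e. *)
Inductive tau_span : (R -> R -> R[i]) -> Prop :=
| TauBase i psi : tau_span (fun e s => (tau e s ^+ i.+1)%:C * logf psi s)
| TauLin c F G : tau_span F -> tau_span G ->
    tau_span (fun e s => c * F e s + G e s).

Lemma tau_span_derive F : tau_span F -> exists2 F', tau_span F' &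
  forall e s, 0 < e -> is_cderive (F e) s (F' e s).
Proof.
elim=> [i psi|c {}F G _ [F' tF dF] _ [G' tG dG]]; last first.
  exists (fun e s => c * F' e s + G' e s); first exact: TauLin.
  by move=> e s e0; apply: is_cderive_lin; [exact: dF|exact: dG].
exists (fun e s => i.+1%:R * ((tau e s ^+ i.+1)%:C * logf psi s) +
  (- i.+1%:R * ((tau e s ^+ i.+2)%:C * logf psi s) +
   (tau e s ^+ i.+1)%:C * logf (euler psi) s)).
  by apply: TauLin; [exact: TauBase|apply: TauLin; exact: TauBase].
move=> e s e0.
have dX : is_derive s (1 : R) (fun s => tau e s ^+ i.+1)
    (i.+1%:R * tau e s ^+ i * (tau e s * (1 - tau e s))).
  rewrite (_ : (fun s => _) = tau e ^+ i.+1); last first.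
    by apply/funext => t; rewrite exprfctE.
  by have := is_deriveX i.+1 (is_derive_tau s e0).
apply: is_cderive_eq (is_cderive_scale dX (is_cderive_logf psi s)).
move: (logf psi s) (logf (euler psi) s) (tau e s) => z w t.
rewrite !exprS !rmorphM rmorphB rmorph1 rmorph_nat.
move: (_%:R) => c; ring.
Qed.

(** On s <= L the factor tau <= e * exp L is small; on s > L, where tau is only
    bounded by 1, the decay of psi gains a factor 1 / L. *)
Lemma tau_span_small F (j : nat) (eta : R) : tau_span F -> 0 < eta ->
  \forall e \near 0^'+, forall s, `|s| ^+ j * normc (F e s) <= eta.
Proof.
move=> tF; elim: tF eta => [i psi|c {}F G _ IHF _ IHG] eta eta0; last first.
  have k0 : 0 < normc c + 1 by rewrite ltr_wpDl ?normc_ge0.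
  have hF := IHF (eta / 2 / (normc c + 1)).
  have hG := IHG (eta / 2).
  near=> e.
  have h1 : forall s, `|s| ^+ j * normc (F e s) <= eta / 2 / (normc c + 1).
    by near: e; apply: hF; rewrite !divr_gt0.
  have h2 : forall s, `|s| ^+ j * normc (G e s) <= eta / 2.
    by near: e; apply: hG; rewrite divr_gt0.
  move=> s; apply: le_trans (_ : normc c * (`|s| ^+ j * normc (F e s)) +
    `|s| ^+ j * normc (G e s) <= _).
    rewrite mulrCA -mulrDr ler_wpM2l ?exprn_ge0//.
    by rewrite -Normc.normcM; exact: normc_add.
  rewrite [leRHS]splitr lerD//.
  apply: le_trans (_ : normc c * (eta / 2 / (normc c + 1)) <= _).
    by rewrite ler_wpM2l ?normc_ge0.
  rewrite mulrCA ler_piMr ?divr_ge0 ?(ltW eta0)//.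
  by rewrite ler_pdivrMr// mul1r lerDl.
have [M hM] := schwartz_bound j (schwartz_logf psi).
have [M' hM'] := schwartz_bound j.+1 (schwartz_logf psi).
have M0 : 0 <= M by apply: le_trans (hM 0); rewrite mulr_ge0 ?exprn_ge0 ?normc_ge0.
have M'0 : 0 <= M' by apply: le_trans (hM' 0); rewrite mulr_ge0 ?exprn_ge0 ?normc_ge0.
(* L is chosen so that M' <= L * eta, and then e1 so that
   e1 * exp L * (M + 1) = eta. *)
pose L := M' / eta + 1.
have L0 : 0 < L by rewrite ltr_wpDl// divr_ge0// ltW.
pose e1 := eta / ((M + 1) * expR L).
have e10 : 0 < e1 by rewrite divr_gt0// mulr_gt0 ?expR_gt0// ltr_wpDl.
near=> e.
have e0 : 0 < e by near: e; exact: nbhs_right_gt.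
have ee1 : e <= e1 by near: e; exact: nbhs_right_le.
move=> s.
have t0 := tau_ge0 s e0; have t1 := tau_le1 s e0.
rewrite Normc.normcM.
have -> : normc ((tau e s ^+ i.+1)%:C) = tau e s ^+ i.+1.
  by rewrite /= expr0n addr0 sqrtr_sqr ger0_norm// exprn_ge0.
have w0 : 0 <= `|s| ^+ j * normc (logf psi s).
  by rewrite mulr_ge0 ?exprn_ge0 ?normc_ge0.
rewrite mulrCA; apply: le_trans (_ : tau e s * (`|s| ^+ j * normc (logf psi s)) <= _).
  by rewrite ler_wpM2r// exprS ler_piMr// exprn_ile1.
have [sL|Ls] := leP s L.
  apply: le_trans (_ : (e1 * expR L) * (M + 1) <= _); last first.
    rewrite /e1 le_eqVlt; apply/orP; left; apply/eqP; field.
    by rewrite !lt0r_neq0 ?expR_gt0// ltr_wpDl.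
  apply: ler_pM => //; last by apply: le_trans (hM s) _; rewrite lerDl.
  apply: le_trans (tau_le s e0) _.
  by apply: ler_pM; rewrite ?expR_ge0 ?(ltW e0)// ler_expR.
apply: le_trans (_ : `|s| ^+ j * normc (logf psi s) <= _); first by rewrite ler_piMl.
rewrite -(ler_pM2l L0); apply: le_trans (_ : M' <= _).
  apply: le_trans (hM' s); rewrite exprS -mulrA ler_wpM2r//.
  by apply: le_trans (ltW Ls) _; exact: ler_norm.
by rewrite /L mulrDl mul1r divfK ?gt_eqF// lerDl ltW.
Unshelve. all: by end_near. Qed.

Lemma tau_span_bounded F e (j : nat) : tau_span F -> 0 < e ->
  exists M : R, forall s, `|s| ^+ j * normc (F e s) <= M.
Proof.
move=> tF e0; elim: tF => [i psi|c {}F G _ [M hM] _ [N hN]]; last first.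
  exists (normc c * M + N) => s.
  apply: le_trans (_ : normc c * (`|s| ^+ j * normc (F e s)) +
    `|s| ^+ j * normc (G e s) <= _); last by rewrite lerD// ler_wpM2l ?normc_ge0.
  rewrite mulrCA -mulrDr ler_wpM2l ?exprn_ge0//.
  by rewrite -Normc.normcM; exact: normc_add.
have [M hM] := schwartz_bound j (schwartz_logf psi).
exists M => s; apply: le_trans (hM s); rewrite ler_wpM2l ?exprn_ge0//.
have t0 := tau_ge0 s e0; have t1 := tau_le1 s e0.
rewrite Normc.normcM ler_piMl ?normc_ge0//.
by rewrite /= expr0n addr0 sqrtr_sqr ger0_norm ?exprn_ge0// exprn_ile1.
Qed.

Lemma schwartz_tau_span F e : tau_span F -> 0 < e -> schwartz (F e).
Proof.
move=> tF e0.
apply: (@schwartz_class _ (fun f => exists2 F, tau_span F & f = F e)); last by exists F.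
- move=> _ [G tG ->]; have [G' tG' dG] := tau_span_derive tG.
  by exists (G' e); [move=> x; exact: dG|exists G'].
- by move=> _ j [G tG ->]; exact: tau_span_bounded.
Qed.

Lemma cderiven_tau_span F (k : nat) : tau_span F -> exists2 Fk, tau_span Fk &
  forall e, 0 < e -> cderiven k (F e) = Fk e.
Proof.
move=> tF; elim: k => [|k [Fk tFk hFk]]; first by exists F.
have [F' tF' dF] := tau_span_derive tFk; exists F' => // e e0.
rewrite /cderiven iterS -/(cderiven k (F e)) hFk//.
by apply/funext => s; exact: is_cderive_val (dF e s e0).
Qed.

(** tau_e phi as a Schwartz function; the value 0 for e <= 0 is arbitrary. *)
Definition tau_mul phi e : S :=
  match pselect (0 < e) with
  | left e0 => from_log (schwartz_tau_span (TauBase 0 phi) e0)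
  | right _ => 0
  end.

Lemma logf_tau_mul phi e s : 0 < e ->
  logf (tau_mul phi e) s = (tau e s)%:C * logf phi s.
Proof.
rewrite /tau_mul; case: pselect => // e0 _.
by rewrite logf_from_log expr1.
Qed.

Lemma tau_mul_small phi (T : S -> R[i]^o) (eta : R) : bounded_functional T ->
  0 < eta -> \forall e \near 0^'+, normc (T (tau_mul phi e)) <= eta.
Proof.
move=> [C [N hT]] eta0.
pose K : R := (`|C| + 1) * (N.+1%:R * N.+1%:R).
have K0 : 0 < K by rewrite !mulr_gt0 ?ltr0n// ltr_wpDl.
have small (j k : nat) : \forall e \near 0^'+,
    schwartz_seminorm j k (logf (tau_mul phi e)) <= eta / K.
  have [Fk tFk hFk] := cderiven_tau_span k (TauBase 0 phi).
  have h := tau_span_small j tFk (divr_gt0 eta0 K0).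
  near=> e; have e0 : 0 < e by near: e; exact: nbhs_right_gt.
  have he : forall s, `|s| ^+ j * normc (Fk e s) <= eta / K by near: e; exact: h.
  apply: seminorm_le => x; rewrite /schwartz_weight.
  rewrite (_ : logf (tau_mul phi e) = (fun s => (tau e s ^+ 1)%:C * logf phi s)).
    by rewrite hFk.
  by apply/funext => s; rewrite logf_tau_mul.
have all : \forall e \near 0^'+, forall (j k : 'I_N.+1),
    schwartz_seminorm j k (logf (tau_mul phi e)) <= eta / K.
  by apply: filter_forall => j; apply: filter_forall => k; exact: small.
apply: filterS all => e he; apply: le_trans (hT _) _.
have b : \sum_(j < N.+1) \sum_(k < N.+1) schwartz_seminorm j k (logf (tau_mul phi e))
    <= N.+1%:R * N.+1%:R * (eta / K).
  apply: le_trans (_ : \sum_(j < N.+1) \sum_(k < N.+1) (eta / K) <= _).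
    by apply: ler_sum => j _; apply: ler_sum => k _; exact: he.
  by rewrite !sumr_const !card_ord -mulrnA -natrM mulr_natl.
have s0 : 0 <= \sum_(j < N.+1) \sum_(k < N.+1) schwartz_seminorm j k (logf (tau_mul phi e)).
  apply: sumr_ge0 => j _; apply: sumr_ge0 => k _.
  have ub := sup_upper_bound (seminorm_has_sup (tau_mul phi e) j k).
  apply: le_trans (ub (schwartz_weight j k (logf (tau_mul phi e)) 0) _);
    last by exists 0.
  by rewrite /schwartz_weight mulr_ge0 ?exprn_ge0 ?normc_ge0.
apply: le_trans (_ : (`|C| + 1) * (N.+1%:R * N.+1%:R * (eta / K)) <= _).
  apply: le_trans (_ : (`|C| + 1) *
    \sum_(j < N.+1) \sum_(k < N.+1) schwartz_seminorm j k (logf (tau_mul phi e)) <= _).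
    by rewrite ler_wpM2r//; have := ler_norm C; lra.
  by rewrite ler_wpM2l// addr_ge0.
rewrite [leLHS](_ : _ = K * (eta / K)); last by rewrite /K -!mulrA.
by rewrite mulrCA mulfV ?mulr1// gt_eqF.
Unshelve. all: by end_near. Qed.

(** phi - tau_e phi = phi / (1 + e r), and its product with r is
    e^-1 tau_e phi. *)
Lemma is_mulr_tau_mul phi e : 0 < e ->
  is_mulr (phi - tau_mul phi e) (e^-1%:C *: tau_mul phi e).
Proof.
move=> e0 s; rewrite logfZ logfB logf_tau_mul//.
rewrite (_ : logf phi s - _ = (1 - (tau e s)%:C) * logf phi s); last first.
  by rewrite mulrBl mul1r.
rewrite !mulrA; congr (_ * _).
have key : e^-1 * tau e s = expR s * (1 - tau e s).
  have d0 := lt0r_neq0 (den_gt0 s e0); rewrite /tau; field.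
  by rewrite d0 lt0r_neq0.
by rewrite -rmorphM key rmorphM rmorphB rmorph1.
Qed.

(** phi is the sum of phi - tau_e phi, on which the two functionals agree, and
    of tau_e phi, on which both are small by continuity. *)
Lemma tempered_unique (T T' : S -> R[i]^o) : tempered T -> tempered T' ->
  (forall phi, (exists g, is_mulr phi g) -> T phi = T' phi) -> T = T'.
Proof.
move=> [aT bT] [aT' bT'] TT'; apply/funext => phi.
suff h (eta : R) : 0 < eta -> normc (T phi - T' phi) <= eta + eta.
  apply/eqP; rewrite -subr_eq0; apply/eqP/Normc.eq0_normc.
  apply/eqP; rewrite eq_le normc_ge0 andbT; apply/ler_addgt0Pr => eta eta0.
  by rewrite add0r [leRHS]splitr; apply: h; rewrite divr_gt0.
move=> eta0.
have [e [[h1 h2] e0]] : exists e, (normc (T (tau_mul phi e)) <= eta /\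
    normc (T' (tau_mul phi e)) <= eta) /\ 0 < e.
  near (0 : R)^'+ => e; exists e; split; first split.
  - by near: e; exact: tau_mul_small.
  - by near: e; exact: tau_mul_small.
  - by near: e; exact: nbhs_right_gt.
have split_ (U : S -> R[i]^o) : antilinear U ->
    U phi = U (phi - tau_mul phi e) + U (tau_mul phi e).
  move=> aU; have := aU 1 (phi - tau_mul phi e) (tau_mul phi e).
  by rewrite scale1r subrK conjc1 mul1r.
rewrite (split_ _ aT) (split_ _ aT') TT'; last first.
  by exists (e^-1%:C *: tau_mul phi e); exact: is_mulr_tau_mul.
rewrite opprD addrACA subrr add0r.
apply: le_trans (normc_add _ _) _; apply: lerD => //.
by case: (T' _) h2 => a b; rewrite /= !sqrrN.
Unshelve. all: by end_near. Qed.

End Density.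

(** * Smooth bumps *)
Section FlatFunctions.
Context {R : realType}.
Implicit Types (t s a b : R) (n i j k : nat).

(** The case n = 0 is the standard smooth function that vanishes to infinite
    order at 0; the factors t^-n arise from differentiation. *)
Definition flat n t : R := if 0 < t then t^-1 ^+ n * expR (- t^-1) else 0.

Lemma flat_ge0 n t : 0 <= flat n t.
Proof.
rewrite /flat; case: ifPn => // t0.
by rewrite mulr_ge0 ?expR_ge0 ?exprn_ge0// invr_ge0 ltW.
Qed.

Lemma flat_le0 n t : t <= 0 -> flat n t = 0.
Proof. by rewrite /flat ltNge => ->. Qed.

Lemma exprn_le_expR n (y : R) : 0 <= y ->
  y ^+ n.+1 <= n.+1%:R ^+ n.+1 * expR y.
Proof.
move=> y0; have N0 : 0 < n.+1%:R :> R by rewrite ltr0n.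
(* y <= N * exp (y / N), raised to the power N = n + 1 *)
have -> : expR y = expR (y / n.+1%:R) ^+ n.+1.
  by rewrite -expRM_natl mulrC divfK// gt_eqF.
rewrite -exprMn lerXn2r ?nnegrE ?mulr_ge0 ?expR_ge0 ?(ltW N0)//.
rewrite mulrC -ler_pdivrMr//; apply: le_trans (expR_ge1Dx _).
by rewrite lerDr.
Qed.

Lemma flat_le n t : flat n t <= n.+1%:R ^+ n.+1 * `|t|.
Proof.
have [t0|t0] := leP t 0.
  by rewrite flat_le0// mulr_ge0// exprn_ge0.
rewrite /flat t0 gtr0_norm// expRN ler_pdivrMr ?expR_gt0//.
rewrite -(ler_pM2r (_ : 0 < t^-1)) ?invr_gt0//.
rewrite -exprSr (_ : _ / t = n.+1%:R ^+ n.+1 * expR t^-1); last first.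
  by rewrite mulrAC mulfK// gt_eqF.
by apply: exprn_le_expR; rewrite invr_ge0 ltW.
Qed.

(** A quadratic bound is all that differentiability at 0, with derivative 0,
    requires. *)
Lemma flat_quadratic n t : `|flat n t| <= n.+2%:R ^+ n.+2 * t ^+ 2.
Proof.
rewrite ger0_norm ?flat_ge0//; have [t0|t0] := leP t 0.
  by rewrite flat_le0 //; apply: mulr_ge0; [exact: exprn_ge0|exact: sqr_ge0].
have -> : flat n t = t * flat n.+1 t.
  by rewrite /flat t0 exprS !mulrA mulfV ?mul1r// gt_eqF.
have := flat_le n.+1 t; rewrite gtr0_norm// => h.
by rewrite expr2 mulrCA ler_pM2l// mulrC in h *.
Qed.

Lemma is_derive_quadratic0 (f : R -> R) (C : R) : (forall t, `|f t| <= C * t ^+ 2) ->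
  is_derive (0 : R) (1 : R) f 0.
Proof.
move=> fC.
have f0 : f 0 = 0.
  by apply/eqP; rewrite -normr_le0; have := fC 0; rewrite expr0n mulr0.
have c : (fun h => h^-1 *: ((f \o shift 0) (h *: 1) - f 0)) @ 0^' --> (0 : R).
  apply: norm_cvg0.
  apply: (@squeeze_cvgr _ _ _ _ (cst 0) (fun h => C * `|h|)).
  - near=> h; have h0 : h != 0 by near: h; exact: nbhs_dnbhs_neq.
    rewrite normr_ge0 /= f0 subr0 addr0 {1}/GRing.scale /= normrM normfV.
    rewrite ler_pdivrMl ?normr_gt0// [_ *: 1]mulr1.
    by apply: le_trans (fC h) _; rewrite [leRHS]mulrCA -expr2 real_normK ?num_real.
  - exact: cvg_cst.
  - rewrite -[X in _ --> X](mulr0 C); apply: cvgM; first exact: cvg_cst.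
    rewrite -[X in _ --> X](@normr0 R R); apply: cvg_norm.
    by move=> A nA; exact: nbhs_dnbhs nA.
apply: DeriveDef; first by apply/cvg_ex; exists 0.
exact/cvg_lim.
Unshelve. all: by end_near. Qed.

Lemma is_derive_near (f g : R -> R) t df : (\near t, f t = g t) ->
  is_derive t (1 : R) f df -> is_derive t (1 : R) g df.
Proof.
move=> fg d; apply: DeriveDef; first by apply: near_eq_derivable fg _; exact: ex_derive.
by rewrite -(near_eq_derive _ fg) derive_val.
Qed.

Lemma is_derive_flat n t :
  is_derive t (1 : R) (flat n) (flat n.+2 t - n%:R * flat n.+1 t).
Proof.
have [t0|t0|->] := ltgtP t 0.
- rewrite !flat_le0 ?(ltW t0)// mulr0 subr0.
  apply: (@is_derive_near (fun=> 0)).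
  near=> s; rewrite flat_le0//; apply: ltW; near: s; exact: lt_nbhsl.
- rewrite /flat t0.
  apply: (@is_derive_near (fun t => t^-1 ^+ n * expR (- t^-1))).
    by near=> s; rewrite ifT//; near: s; exact: lt_nbhsr.
  have dv : is_derive t (1 : R) (fun t : R => t^-1) (- t ^- 2).
    have := is_deriveV (lt0r_neq0 t0) (is_derive_id t (1 : R)).
    by move=> /is_derive_eq; apply; rewrite /GRing.scale /= mulr1.
  have dX : is_derive t (1 : R) (fun t : R => t^-1 ^+ n) (- n%:R * t^-1 ^+ n.+1).
    rewrite (_ : (fun t => _) = (fun t : R => t^-1) ^+ n); last first.
      by apply/funext => s; rewrite exprfctE.
    have := is_deriveX n dv.
    move=> /is_derive_eq; apply; rewrite /GRing.scale /=.
    case: n => [|n]; first by rewrite !mulr0n !mul0r oppr0 mul0r.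
    rewrite -exprVn /= !exprS; ring.
  have dE : is_derive t (1 : R) (fun t : R => expR (- t^-1)) (expR (- t^-1) * t ^- 2).
    have := @is_derive1_comp _ (@expR R) (fun t => - t^-1) _ _ _
      (is_derive_expR (- t^-1)) (is_deriveN dv).
    by rewrite opprK.
  have := is_deriveM dX dE.
  move=> /is_derive_eq; apply; rewrite /GRing.scale /= -exprVn !exprS; ring.
- rewrite !(flat_le0 _ (lexx 0)) mulr0 subr0.
  exact: is_derive_quadratic0 (flat_quadratic n).
Unshelve. all: by end_near. Qed.

Lemma flat0_lower t s : 0 < t -> t <= s -> flat 0 t <= flat 0 s.
Proof.
move=> t0 ts; have s0 := lt_le_trans t0 ts.
by rewrite /flat t0 s0 !mul1r ler_expR lerN2 lef_pV2.
Qed.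

Section Bumps.
Variables a b : R.

Definition bump_term k i j s : R :=
  expR (k%:R * s) * (flat i (s - a) * flat j (b - s)).

(** Besides derivatives, the span contains the products of bumps with powers
    of r = exp s, thanks to the exponential factor in [bump_term]. *)
Inductive bump_span : (R -> R) -> Prop :=
| BumpTerm k i j : bump_span (bump_term k i j)
| BumpLin c f g : bump_span f -> bump_span g -> bump_span (fun s => c * f s + g s).

Lemma bump_span_derive f : bump_span f -> exists2 f', bump_span f' &
  forall s, is_derive s (1 : R) f (f' s).
Proof.
elim=> [k i j|c {}f g _ [f' bf df] _ [g' bg dg]]; last first.
  exists (fun s => c * f' s + g' s); first exact: BumpLin.
  by move=> s; have := is_deriveD (is_deriveZ c (df s)) (dg s).
exists (fun s => k%:R * bump_term k i j s + (- i%:R * bump_term k i.+1 j s +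
   (j%:R * bump_term k i j.+1 s + (- 1 * bump_term k i j.+2 s +
    bump_term k i.+2 j s)))).
  do 4 (apply: BumpLin; first exact: BumpTerm); exact: BumpTerm.
move=> s.
have dk : is_derive s (1 : R) (fun s => expR (k%:R * s)) (k%:R * expR (k%:R * s)).
  have := @is_derive1_comp _ (@expR R) ( *%R k%:R) _ _ _
    (is_derive_expR (k%:R * s)) (is_derive_mul k%:R s).
  by rewrite mulrC.
have da : is_derive s (1 : R) (fun s => s - a) 1.
  have := is_deriveB (is_derive_id s (1 : R)) (is_derive_cst a s (1 : R)).
  by rewrite subr0.
have db : is_derive s (1 : R) (fun s => b - s) (- 1).
  have := is_deriveB (is_derive_cst b s (1 : R)) (is_derive_id s (1 : R)).
  by rewrite sub0r.
have di := @is_derive1_comp _ (flat i) (fun s => s - a) _ _ _ (is_derive_flat i (s - a)) da.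
have dj := @is_derive1_comp _ (flat j) (fun s => b - s) _ _ _ (is_derive_flat j (b - s)) db.
have := is_deriveM dk (is_deriveM di dj).
move=> /is_derive_eq; apply; rewrite /bump_term !fctE.
rewrite /GRing.scale /= /GRing.scale /=; ring.
Qed.

Lemma bump_term_out k i j s : s <= a \/ b <= s -> bump_term k i j s = 0.
Proof.
rewrite /bump_term => -[sa|bs].
  by rewrite (@flat_le0 _ (s - a)) ?subr_le0// mul0r mulr0.
by rewrite (@flat_le0 _ (b - s)) ?subr_le0// !mulr0.
Qed.

Lemma bump_span_out f s : bump_span f -> s <= a \/ b <= s -> f s = 0.
Proof.
move=> bf sab; elim: bf => [k i j|c {}f g _ -> _ ->]; first exact: bump_term_out.
by rewrite mulr0 addr0.
Qed.

Lemma continuous_bump_span f : bump_span f -> continuous f.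
Proof. by move=> /bump_span_derive[f' _ df]; exact: is_derive_continuous df. Qed.

Lemma bounded_support (f : R -> R) : continuous f ->
  (forall s, s <= a \/ b <= s -> f s = 0) -> exists M : R, forall s, `|f s| <= M.
Proof.
move=> cf f0; have [ba|ab] := leP b a.
  exists 0 => s; rewrite f0 ?normr0//.
  by have [sa|/ltW as_] := leP s a; [left|right; exact: le_trans ba as_].
have [c _ hc] : exists2 c : R, c \in `[a, b] &
    forall t : R, t \in `[a, b] -> `|f t| <= `|f c|.
  apply: (@EVT_max _ (fun s : R => `|f s|)); first exact: ltW.
  by apply: continuous_subspaceT => s; apply: cvg_norm; exact: cf.
exists `|f c| => s; have [sab|] := boolP (s \in `[a, b]); first exact: hc.
rewrite in_itv /= negb_and -!ltNge => /orP h.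
by rewrite f0 ?normr0//; case: h => /ltW; [left|right].
Qed.

Lemma schwartz_bump_span f : bump_span f -> schwartz (fun s => (f s)%:C).
Proof.
move=> bf; apply: (@schwartz_class _ (fun h => exists2 f, bump_span f &
  h = (fun s => (f s)%:C))); last by exists f.
- move=> _ [g bg ->]; have [g' bg' dg] := bump_span_derive bg.
  exists (fun s => (g' s)%:C); last by exists g'.
  by move=> s; split; [exact: dg|exact: is_derive_cst].
- move=> _ j [g bg ->].
  have [M hM] : exists M : R, forall s, `|(`|s| ^+ j * g s)| <= M.
    apply: bounded_support.
      move=> s; apply: cvgM; last exact: continuous_bump_span bg s.
      apply: (@continuous_comp _ _ _ (fun x : R => `|x|) (fun x => x ^+ j)).
        exact: norm_continuous.
      exact: exprn_continuous.
    by move=> s sab; rewrite (bump_span_out bg sab) mulr0.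
  exists M => s; apply: le_trans (hM s).
  by rewrite /= expr0n addr0 sqrtr_sqr normrM ger0_norm ?exprn_ge0.
Qed.

Definition smooth_bump : schwartzPos R := from_log (schwartz_bump_span (BumpTerm 0 0 0)).

Lemma logf_bump s : logf smooth_bump s = (flat 0 (s - a) * flat 0 (b - s))%:C.
Proof. by rewrite logf_from_log /bump_term mul0r expR0 mul1r. Qed.

Lemma bump_pow_mul n : pow_mul_schwartz n smooth_bump.
Proof.
apply/pow_mul_schwartzP; exists (from_log (schwartz_bump_span (BumpTerm n 0 0))) => s.
rewrite logf_from_log logf_bump -rmorphM; congr (_%:C).
by rewrite /bump_term -expRM_natl.
Qed.

Lemma bump_compactly_supported : compactly_supported smooth_bump.
Proof.
exists (expR a), (expR b); split; first exact: expR_gt0.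
move=> r; have [r0|r0] := leP r 0; first by rewrite schwartzPos_le0// eqxx.
rewrite -[r]lnK ?posrE// -[smooth_bump _]/(logf smooth_bump (ln r)) => h; rewrite !ler_expR.
apply/andP; split; rewrite leNgt; apply/negP => /ltW hs; move: h; rewrite logf_bump.
- by rewrite (@flat_le0 _ (ln r - a)) ?subr_le0// mul0r eqxx.
- by rewrite (@flat_le0 _ (b - ln r)) ?subr_le0// mulr0 eqxx.
Qed.

End Bumps.
End FlatFunctions.

(** * Testing against bumps *)
Section TestFunctions.
Context {R : realType}.
Local Notation leb := (@lebesgue_measure R).
Local Notation S := (schwartzPos R).
Implicit Types (F : R -> R) (a b s : R) (phi psi g : S).

Lemma log_re_bump a b s : log_re (smooth_bump a b) s = flat 0 (s - a) * flat 0 (b - s).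
Proof. by rewrite /log_re logf_bump. Qed.

Lemma log_im_bump a b s : log_im (smooth_bump a b) s = 0.
Proof. by rewrite /log_im logf_bump. Qed.

Lemma log_re_bump_ge0 a b s : 0 <= log_re (smooth_bump a b) s.
Proof. by rewrite log_re_bump mulr_ge0 ?flat_ge0. Qed.

Lemma log_re_bump_out a b s : s <= a \/ b <= s -> log_re (smooth_bump a b) s = 0.
Proof.
rewrite log_re_bump => -[h|h].
  by rewrite (@flat_le0 _ _ (s - a)) ?mul0r// subr_le0.
by rewrite (@flat_le0 _ _ (b - s)) ?mulr0// subr_le0.
Qed.

Lemma tame_mul_bump F a b : continuous F ->
  tame (fun s => F s * log_re (smooth_bump a b) s).
Proof.
move=> cF; have [cb _] := tame_log_re (smooth_bump a b).
have c : continuous (fun s => F s * log_re (smooth_bump a b) s).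
  by move=> s; apply: cvgM; [exact: cF|exact: cb].
split=> //.
have [M hM] : exists M : R, forall s,
    `|(1 + s ^+ 2) * (F s * log_re (smooth_bump a b) s)| <= M.
  apply: (@bounded_support _ a b).
    by move=> s; apply: cvgM; [exact: continuous_oneDsqr|exact: c].
  by move=> s h; rewrite log_re_bump_out// !mulr0.
exists M => s; have h0 : 0 < 1 + s ^+ 2 by rewrite ltr_pwDl// sqr_ge0.
rewrite /lor ler_pdivlMr// mulrC; apply: le_trans (hM s).
by rewrite [leRHS]normrM [`|1 + _|]gtr0_norm.
Qed.

(** The bump is supported in an interval around s0 on which F > F s0 / 2, and
    it is bounded below on the concentric interval of half the length. *)
Let bump_integral_pos F s0 : continuous F -> 0 < F s0 -> exists a b : R,
  0 < \int[leb]_(r in `]0, +oo[) (F (ln r) * log_re (smooth_bump a b) (ln r) * r^-1).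
Proof.
move=> cF F0.
have F2 : 0 < F s0 / 2 by rewrite divr_gt0.
have := cF s0; move=> /cvgrPdist_lt/(_ _ F2)[d /= d0 hd].
pose a := s0 - d; pose b := s0 + d; exists a, b.
pose c : R := flat 0 (d / 2) * flat 0 (d / 2).
have c0 : 0 < c.
  have h : 0 < flat 0 (d / 2) by rewrite /flat divr_gt0// mulr_gt0 ?expR_gt0.
  exact: mulr_gt0.
pose m := F s0 / 2 * c; have m0 : 0 < m by exact: mulr_gt0.
have Fpos s : a < s < b -> F s0 / 2 <= F s.
  move=> /andP[as_ sb]; have : `|F s0 - F s| < F s0 / 2.
    by apply: hd => /=; rewrite ltr_norml; apply/andP; split; rewrite /a /b in as_ sb; lra.
  by rewrite ltr_norml => /andP[_]; lra.
pose G s := F s * log_re (smooth_bump a b) s.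
have tG : tame G by exact: tame_mul_bump.
have G0 s : 0 <= G s.
  have [as_|sa] := ltP a s; last by rewrite /G log_re_bump_out ?mulr0//; left.
  have [sb|bs] := ltP s b; last by rewrite /G log_re_bump_out ?mulr0//; right.
  rewrite mulr_ge0 ?log_re_bump_ge0//; apply: le_trans (Fpos s _); first exact: ltW.
  by rewrite as_.
have Gm s : s0 - d / 2 <= s <= s0 + d / 2 -> m <= G s.
  move=> /andP[h1 h2]; apply: ler_pM => //; first exact: ltW.
  - exact: ltW.
  - by apply: Fpos; rewrite /a /b; apply/andP; split; lra.
  - rewrite log_re_bump /c; apply: ler_pM; rewrite ?flat_ge0//;
      by apply: flat0_lower; rewrite ?divr_gt0// /a /b; lra.
pose I := `[expR (s0 - d / 2), expR (s0 + d / 2)]%classic : set (measurableTypeR R).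
have Ipos r : I r -> 0 < r.
  by rewrite /I /= in_itv /= => /andP[h _]; apply: lt_le_trans h; exact: expR_gt0.
have mI : measurable I by exact: measurable_itv.
have mD : measurable (`]0, +oo[%classic : set (measurableTypeR R)).
  exact: measurable_itv.
have intI : \int[leb]_(r in I) (m * r^-1) = m * d.
  have lt_ends : expR (s0 - d / 2) < expR (s0 + d / 2) by rewrite ltr_expR; lra.
  have inI r : expR (s0 - d / 2) <= r <= expR (s0 + d / 2) -> 0 < r.
    by move=> /andP[h _]; apply: lt_le_trans h; exact: expR_gt0.
  have dln r : expR (s0 - d / 2) <= r <= expR (s0 + d / 2) ->
      is_derive r (1 : R) (fun r => m * ln r) (m * r^-1).
    by move=> /inI r0; have := is_deriveZ m (is_derive1_ln r0).
  have cln r : expR (s0 - d / 2) <= r <= expR (s0 + d / 2) ->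
      {for r, continuous (fun r : R => m * r^-1)}.
    move=> /inI r0; apply: cvgM; first exact: cvg_cst.
    by apply: cvgV; [rewrite gt_eqF|exact: cvg_id].
  rewrite /Rintegral (Rintegral_FTC2 lt_ends dln cln) /= !expRK -mulrBr; congr (_ * _); lra.
have iI : leb.-integrable I (EFin \o (fun r => m * r^-1)).
  apply: continuous_compact_integrable; first exact: segment_compact.
  apply: continuous_in_subspaceT => r; rewrite inE => /Ipos r0.
  apply: cvgM; first exact: cvg_cst.
  by apply: cvgV; [rewrite gt_eqF|exact: cvg_id].
have iD := tame_integrable tG.
have iDI : leb.-integrable I (EFin \o (fun r => G (ln r) * r^-1)).
  by apply: (integrableS mD) iD => // r /Ipos; rewrite /= in_itv /= andbT.
apply: (@lt_le_trans _ _ (m * d)); first exact: mulr_gt0.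
rewrite -intI; apply: (@le_trans _ _ (\int[leb]_(r in I) (G (ln r) * r^-1))).
  apply: le_Rintegral => // r Ir; have r0 := Ipos r Ir.
  rewrite ler_wpM2r ?invr_ge0 ?(ltW r0)//; apply: Gm.
  by move: Ir; rewrite /I /= in_itv /= -{1 2}[r]lnK ?posrE// !ler_expR.
rewrite /Rintegral; apply: fine_le.
- exact: integrable_fin_num iDI.
- exact: integrable_fin_num iD.
apply: ge0_subset_integral => //.
- exact: measurable_int iD.
- move=> r /=; rewrite in_itv /= andbT => r0.
  by rewrite lee_fin mulr_ge0 ?invr_ge0 ?(ltW r0)//; exact: G0.
- by move=> r /Ipos; rewrite /= in_itv /= andbT.
Qed.

Lemma test_bump_zero F : continuous F ->
  (forall a b, \int[leb]_(r in `]0, +oo[)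
     (F (ln r) * log_re (smooth_bump a b) (ln r) * r^-1) = 0) ->
  forall s, F s = 0.
Proof.
move=> cF hF s0; apply/eqP; rewrite eq_le; apply/andP; split; rewrite leNgt;
  apply/negP => F0.
- by have [a [b]] := bump_integral_pos cF F0; rewrite hF ltxx.
- have cN : continuous (fun s => - F s) by move=> s; apply: cvgN; exact: cF.
  have F1 : 0 < - F s0 by rewrite oppr_gt0.
  have [a [b]] := bump_integral_pos cN F1.
  rewrite (@eq_Rintegral _ _ _ leb _
    (fun r => -1 * (F (ln r) * log_re (smooth_bump a b) (ln r) * r^-1))); last first.
    by move=> r _; ring.
  have i1 := tame_integrable (tame_mul_bump a b cF).
  have mD : measurable (`]0, +oo[%classic : set (measurableTypeR R)).
    exact: measurable_itv.
  by rewrite (RintegralZl _ mD i1) hF mulr0 ltxx.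
Qed.

Lemma test_bump_eq F F' : continuous F -> continuous F' ->
  (forall a b, \int[leb]_(r in `]0, +oo[)
      (F (ln r) * log_re (smooth_bump a b) (ln r) * r^-1) =
    \int[leb]_(r in `]0, +oo[)
      (F' (ln r) * log_re (smooth_bump a b) (ln r) * r^-1)) ->
  F =1 F'.
Proof.
move=> cF cF' e s; apply/eqP; rewrite -subr_eq0; apply/eqP.
apply: (@test_bump_zero (fun s => F s - F' s)) => [x|a b].
  by apply: cvgB; [exact: cF|exact: cF'].
have i1 := tame_integrable (tame_mul_bump a b cF).
have i2 := tame_integrable (tame_mul_bump a b cF').
rewrite (@eq_Rintegral _ _ _ leb _
  (fun r => F (ln r) * log_re (smooth_bump a b) (ln r) * r^-1 -
            F' (ln r) * log_re (smooth_bump a b) (ln r) * r^-1)); last first.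
  by move=> r _; ring.
by rewrite RintegralB ?e ?subrr//; exact: measurable_itv.
Qed.

Let pair_re_bump a b psi s :
  pair_re (smooth_bump a b) psi s = log_re psi s * log_re (smooth_bump a b) s.
Proof. by rewrite /pair_re log_im_bump mulr0 addr0. Qed.

Let pair_im_bump a b psi s :
  pair_im (smooth_bump a b) psi s = log_im psi s * log_re (smooth_bump a b) s.
Proof. by rewrite /pair_im log_im_bump mulr0 subr0. Qed.

Lemma fun_pairing_inj g psi : fun_pairing g = fun_pairing psi -> g = psi.
Proof.
move=> e; have {e}e a b : fun_pairing g (smooth_bump a b) = fun_pairing psi (smooth_bump a b).
  by rewrite e.
apply: schwartzPos_ext => s; apply: complex_ext.
- apply: (@test_bump_eq (log_re g) (log_re psi)) => [||a b].
  + by case: (tame_log_re g).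
  + by case: (tame_log_re psi).
  + have := congr1 (@complex.Re R) (e a b); rewrite !fun_pairingE /=.
    by under eq_Rintegral do rewrite pair_re_bump;
       under [RHS]eq_Rintegral do rewrite pair_re_bump.
- apply: (@test_bump_eq (log_im g) (log_im psi)) => [||a b].
  + by case: (tame_log_im g).
  + by case: (tame_log_im psi).
  + have := congr1 (@complex.Im R) (e a b); rewrite !fun_pairingE /=.
    by under eq_Rintegral do rewrite pair_im_bump;
       under [RHS]eq_Rintegral do rewrite pair_im_bump.
Qed.

(** Compactly supported phi are admissible test functions for the coordinate
    a whatever psi is, and they see exp s * Psi s pointwise. *)
Lemma weyl_a_fun_pairing psi g :
  weyl (@coord_a R) psi (fun_pairing g) -> is_mulr psi g.
Proof.
move=> [_ cv val] s.
have {cv val}e a b : fun_pairing g (smooth_bump a b) =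
    aff_pairing (@coord_a R) (wigner (smooth_bump a b) psi) /\
    aff_pairing_converges (@coord_a R) (wigner (smooth_bump a b) psi).
  by have c := cv _ (@bump_compactly_supported R a b); split=> //; exact: val.
have cl (f : R -> R) : tame f -> continuous (fun s => expR s * f s).
  by move=> [cf _] x; apply: cvgM; [exact: continuous_expR|exact: cf].
apply: complex_ext.
- rewrite Re_mul /= mul0r subr0.
  apply: (@test_bump_eq (log_re g) (fun s => expR s * log_re psi s)) => [||a b].
  + by case: (tame_log_re g).
  + exact: cl (tame_log_re psi).
  + have [h c] := e a b; have {h} := congr1 (@complex.Re R) h.
    rewrite fun_pairingE (coord_a_pairing c) /=.
    under eq_Rintegral do rewrite pair_re_bump.
    by move=> ->; apply: half_eq => r; rewrite pair_re_bump; ring.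
- rewrite Im_mul /= mul0r addr0.
  apply: (@test_bump_eq (log_im g) (fun s => expR s * log_im psi s)) => [||a b].
  + by case: (tame_log_im g).
  + exact: cl (tame_log_im psi).
  + have [h c] := e a b; have {h} := congr1 (@complex.Im R) h.
    rewrite fun_pairingE (coord_a_pairing c) /=.
    under eq_Rintegral do rewrite pair_im_bump.
    by move=> ->; apply: half_eq => r; rewrite pair_im_bump; ring.
Qed.

End TestFunctions.

(** * The two quantizations and their commutator *)
Section Quantizations.
Context {R : realType}.
Local Notation leb := (@lebesgue_measure R).
Local Notation S := (schwartzPos R).
Implicit Types (s t : R) (phi psi g : S) (c : R[i]).

Lemma weyl_x psi :
  weyl (@coord_x R) psi (fun_pairing (two_pi_i^-1 *: euler psi)).
Proof.
split; first exact: tempered_fun_pairing.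
- by move=> phi _; exact: coord_x_converges.
- by move=> phi _; rewrite coord_x_pairing.
Qed.

Lemma weyl_x_unique psi T : weyl (@coord_x R) psi T ->
  T = fun_pairing (two_pi_i^-1 *: euler psi).
Proof.
move=> [_ _ TE]; apply/funext => phi.
by rewrite TE ?coord_x_pairing//; exact: coord_x_converges.
Qed.

Lemma coord_a_pairing_mulr phi psi g : is_mulr psi g ->
  aff_pairing_converges (@coord_a R) (wigner phi psi) ->
  aff_pairing (@coord_a R) (wigner phi psi) = fun_pairing g phi.
Proof.
move=> gE cv; rewrite coord_a_pairing// fun_pairingE; congr (_ +i* _);
  apply: half_eq => s; rewrite expRK /pair_re /pair_im /log_re /log_im gE;
  by rewrite !complex_partsE /=; ring.
Qed.

Lemma weyl_a psi g : is_mulr psi g -> weyl (@coord_a R) psi (fun_pairing g).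
Proof.
move=> gE; split; first exact: tempered_fun_pairing.
- move=> phi cphi; apply: coord_a_converges.
    exact: rapid_compactly_supported.
  by apply: rapid_mulr; exists g.
- by move=> phi cv; rewrite (coord_a_pairing_mulr gE).
Qed.

(** The pairing converges for every phi such that r * phi is Schwartz, and
    these phi determine a tempered functional. *)
Lemma weyl_a_unique psi g T : is_mulr psi g -> weyl (@coord_a R) psi T ->
  T = fun_pairing g.
Proof.
move=> gE [tT _ TE]; apply: tempered_unique => //; first exact: tempered_fun_pairing.
move=> phi rphi; have cv : aff_pairing_converges (@coord_a R) (wigner phi psi).
  by apply: coord_a_converges; apply: rapid_mulr => //; exists g.
by rewrite TE// (coord_a_pairing_mulr gE).
Qed.

Lemma is_mulrZ c psi g : is_mulr psi g -> is_mulr (c *: psi) (c *: g).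
Proof. by move=> gE t; rewrite !logfZ gE mulrCA. Qed.

Lemma is_mulr_unique psi g g' : is_mulr psi g -> is_mulr psi g' -> g = g'.
Proof. by move=> gE gE'; apply: schwartzPos_ext => t; rewrite gE gE'. Qed.

Lemma commutator_exists psi g : is_mulr psi g ->
  op_commutator (weyl (@coord_x R)) (weyl (@coord_a R)) psi
    (two_pi_i^-1 *: fun_pairing g).
Proof.
move=> gE.
exists (fun_pairing (two_pi_i^-1 *: euler g)),
  (fun_pairing (two_pi_i^-1 *: (euler g - g))); split.
- by exists g; split; [exact: weyl_a|exact: weyl_x].
- exists (two_pi_i^-1 *: euler psi); split; first exact: weyl_x.
  by apply: weyl_a; apply: is_mulrZ; exact: is_mulr_euler.
- by rewrite -fun_pairingB -scalerBr subKr fun_pairingZ.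
Qed.

(** The intermediate functions in the definition of the two compositions are
    determined by injectivity of [fun_pairing], and the composition in which
    the coordinate a acts first forces r * psi to be Schwartz. *)
Lemma commutator_mulr psi T :
  op_commutator (weyl (@coord_x R)) (weyl (@coord_a R)) psi T ->
  exists2 g, is_mulr psi g & T = two_pi_i^-1 *: fun_pairing g.
Proof.
move=> [T1 [T2 [[g [/weyl_a_fun_pairing gE /weyl_x_unique T1E]]]]].
move=> [h [/weyl_x_unique/fun_pairing_inj hE hT2]] ->; exists g => //.
have hE' : is_mulr h (two_pi_i^-1 *: (euler g - g)).
  by rewrite hE; apply: is_mulrZ; exact: is_mulr_euler.
rewrite T1E (weyl_a_unique hE' hT2).
by rewrite -fun_pairingB -scalerBr subKr fun_pairingZ.
Qed.

End Quantizations.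

(** * The representation of the Lie algebra *)
Section Representation.
Context {R : realType}.
Local Notation S := (schwartzPos R).
Implicit Types (s t : R) (phi psi g : S) (c : R[i]) (M N : 'M[R]_2) (n : nat).

Lemma logfN psi t : logf (- psi) t = - logf psi t. Proof. by []. Qed.

Lemma logf0 t : logf (0 : S) t = 0. Proof. by []. Qed.

(** Multiplication by r as an operator; the value 0 where r * psi is not
    Schwartz is arbitrary. *)
Definition mulr psi : S :=
  match pselect (exists g, is_mulr psi g) with
  | left h => projT1 (cid h)
  | right _ => 0
  end.

Lemma mulrP psi : aff_dom psi -> is_mulr psi (mulr psi).
Proof.
move=> /(_ 1)/pow_mul_schwartz1P h; rewrite /mulr; case: pselect => // h'.
by case: cid.
Qed.

Lemma mulr_eq psi g : is_mulr psi g -> mulr psi = g.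
Proof.
move=> gE; rewrite /mulr; case: pselect => [h|[]]; last by exists g.
by case: cid => g' /= g'E; exact: is_mulr_unique g'E gE.
Qed.

Lemma aff_dom_lin c phi psi : aff_dom phi -> aff_dom psi -> aff_dom (c *: phi + psi).
Proof.
move=> dphi dpsi n; have /pow_mul_schwartzP[g gE] := dphi n.
have /pow_mul_schwartzP[h hE] := dpsi n.
apply/pow_mul_schwartzP; exists (c *: g + h) => t.
by rewrite !logfD !logfZ gE hE mulrDr mulrCA.
Qed.

Lemma aff_domZ c psi : aff_dom psi -> aff_dom (c *: psi).
Proof.
move=> dpsi n; have /pow_mul_schwartzP[g gE] := dpsi n.
apply/pow_mul_schwartzP; exists (c *: g) => t.
by rewrite !logfZ gE mulrCA.
Qed.

Lemma aff_dom_mulr psi : aff_dom psi -> aff_dom (mulr psi).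
Proof.
move=> dpsi n; have /pow_mul_schwartzP[g gE] := dpsi n.+1.
apply/pow_mul_schwartzP; exists g => t.
by rewrite gE (mulrP dpsi) exprSr rmorphM mulrA.
Qed.

Lemma aff_dom_euler psi : aff_dom psi -> aff_dom (euler psi).
Proof.
move=> dpsi n; have /pow_mul_schwartzP[g gE] := dpsi n.
apply/pow_mul_schwartzP; exists (euler g - n%:R *: g) => t.
have dX : is_derive t (1 : R) (fun t => expR t ^+ n) (n%:R * expR t ^+ n).
  have := @is_derive1_comp _ (@expR R) ( *%R n%:R) _ _ _
    (is_derive_expR (n%:R * t)) (is_derive_mul n%:R t).
  rewrite [X in is_derive _ _ X _](_ : _ = (fun t => expR t ^+ n)); last first.
    by apply/funext => x /=; rewrite expRM_natl.
  by rewrite expRM_natl mulrC.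
have d := is_cderive_scale dX (is_cderive_logf psi t).
rewrite logfB logfZ logf_euler (_ : logf g = (fun t => (expR t ^+ n)%:C * logf psi t)).
  by rewrite (is_cderive_val d) rmorphM rmorph_nat mulrA addrK.
exact/funext.
Qed.

Lemma mulr_euler psi : aff_dom psi -> mulr (euler psi) = euler (mulr psi) - mulr psi.
Proof. by move=> dpsi; apply: mulr_eq; apply: is_mulr_euler; exact: mulrP. Qed.

Lemma mulr_lin c phi psi : aff_dom phi -> aff_dom psi ->
  mulr (c *: phi + psi) = c *: mulr phi + mulr psi.
Proof.
move=> dphi dpsi; apply: mulr_eq => t.
by rewrite !logfD !logfZ (mulrP dphi) (mulrP dpsi) mulrDr mulrCA.
Qed.

Definition aff_rep M psi : S :=
  (M 0 0)%:C *: euler psi + (M 0 1)%:C *: mulr psi.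

Lemma aff_row1 M j : aff M -> M 1 j = 0.
Proof. by move=> /rowP/(_ j); rewrite !mxE. Qed.

Lemma aff_bracketE M N : aff M -> aff N ->
  aff_bracket M N 0 0 = 0 /\
  aff_bracket M N 0 1 = M 0 0 * N 0 1 - N 0 0 * M 0 1.
Proof.
move=> aM aN; rewrite /aff_bracket !mxE !big_ord_recl !big_ord0.
rewrite (_ : lift 0 0 = 1 :> 'I_2); last exact: val_inj.
rewrite !(aff_row1 _ aM) !(aff_row1 _ aN) !mulr0 !addr0; split=> //.
by rewrite mulrC subrr.
Qed.

Lemma faithful_aff_rep_euler : faithful_aff_rep (@aff_dom R) aff_rep.
Proof.
split.
- move=> M psi _ dpsi; apply: aff_dom_lin; first exact: aff_dom_euler.
  by apply: aff_domZ; exact: aff_dom_mulr.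
- move=> M c phi psi _ dphi dpsi; rewrite /aff_rep euler_lin mulr_lin//.
  by apply: schwartzPos_ext => t; rewrite !(logfD, logfZ); ring.
- move=> k M N psi _ _ _; rewrite /aff_rep !mxE !rmorphD !rmorphM.
  by apply: schwartzPos_ext => t; rewrite !(logfD, logfZ); ring.
- move=> M N psi aM aN dpsi; have [e0 e1] := aff_bracketE aM aN.
  have de := aff_dom_euler dpsi; have dm := aff_dom_mulr dpsi.
  rewrite /aff_rep e0 e1 !euler_lin !mulr_lin//; try exact: aff_domZ.
  have eZ c phi : euler (c *: phi) = c *: euler phi.
    have := euler_lin c phi 0; rewrite addr0 => ->.
    have := euler_lin (-1) 0 (0 : S); rewrite scaler0 addr0 => e.
    have -> : euler (0 : S) = 0 by rewrite e scaleN1r addNr.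
    by rewrite addr0.
  have mZ c phi : aff_dom phi -> mulr (c *: phi) = c *: mulr phi.
    by move=> dphi; apply: mulr_eq; apply: is_mulrZ; exact: mulrP.
  rewrite !eZ !mZ// mulr_euler// rmorphB !rmorphM.
  by apply: schwartzPos_ext => t; rewrite !(logfD, logfN, logfZ) rmorph0; ring.
- move=> M N aM aN MN.
  (* K = M - N acts by c r d/dr + d r.  The relations K psi = 0,
     K (r psi) = 0 and r (K psi) = 0 are evaluated at s = 1/2, inside the
     support of the bump; the difference of the last two is c r psi = 0. *)
  pose psi := smooth_bump (0 : R) 1.
  have dpsi : aff_dom psi by move=> n; exact: bump_pow_mul.
  have dm := aff_dom_mulr dpsi.
  have p0 : logf psi 2^-1 != 0.
    rewrite logf_bump.
    have h : 0 < flat 0 (2^-1 : R) by rewrite /flat invr_gt0 ltr0n mulr_gt0 ?expR_gt0.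
    rewrite subr0 (_ : 1 - 2^-1 = 2^-1 :> R); last by lra.
    by rewrite eq_complex /= negb_and gt_eqF// mulr_gt0.
  have e0 : (expR (2^-1 : R))%:C != 0 :> R[i].
    by rewrite eq_complex /= negb_and gt_eqF// expR_gt0.
  have E phi : aff_dom phi ->
      ((M 0 0)%:C - (N 0 0)%:C) *: euler phi +
      ((M 0 1)%:C - (N 0 1)%:C) *: mulr phi = 0.
    move=> dphi; have := MN _ dphi; rewrite /aff_rep => /eqP.
    by rewrite -subr_eq0 opprD addrACA -!scalerBl => /eqP.
  pose c := (M 0 0)%:C - (N 0 0)%:C; pose d := (M 0 1)%:C - (N 0 1)%:C.
  have at_half phi : phi = 0 -> logf phi 2^-1 = 0 by move=> ->.
  have E1 := at_half _ (E _ dpsi); have E2 := at_half _ (E _ dm).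
  have E3 : c *: (euler (mulr psi) - mulr psi) + d *: mulr (mulr psi) = 0.
    have de := aff_dom_euler dpsi.
    rewrite -mulr_euler// -[d *: _](mulr_eq (is_mulrZ d (mulrP dm))).
    rewrite -mulr_lin//; last exact: aff_domZ.
    by rewrite (E _ dpsi); apply: mulr_eq => t; rewrite !logf0 mulr0.
  have {E3}E3 := at_half _ E3.
  rewrite !(logfD, logfN, logfZ) -/c -/d in E1 E2 E3.
  have cm : c * logf (mulr psi) 2^-1 = 0.
    rewrite -[RHS](subrr 0) -{1}E2 -E3; ring.
  rewrite (mulrP dpsi) in cm E1.
  have c0 : c = 0.
    by move/eqP: cm; rewrite !mulf_eq0 (negbTE e0) (negbTE p0) !orbF => /eqP.
  have d0 : d = 0.
    move/eqP: E1; rewrite c0 mul0r add0r !mulf_eq0 (negbTE e0) (negbTE p0) !orbF.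
    by move=> /eqP.
  have i2 (i : 'I_2) : i = 0 \/ i = 1.
    by case: i => [[|[|//]] ?]; [left|right]; exact: val_inj.
  apply/matrixP => i j; have [->|->] := i2 i; last by rewrite !aff_row1.
  have [->|->] := i2 j.
  + by move/eqP: c0; rewrite subr_eq0 => /eqP/complexI.
  + by move/eqP: d0; rewrite subr_eq0 => /eqP/complexI.
Qed.

End Representation.

Theorem theorem2 (R : realType) :
  let Ax := weyl (@coord_x R) in
  let Aa := weyl (@coord_a R) in
  [/\ forall psi : schwartzPos R,
        (forall phi, aff_pairing_converges (@coord_x R) (wigner phi psi)) /\
        (exists g : schwartzPos R, Ax psi (fun_pairing g)),
      forall psi : schwartzPos R,
        (exists T, op_commutator Ax Aa psi T) <-> pow_mul_schwartz 1 psi,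
      forall (psi : schwartzPos R) (T : schwartzPos R -> R[i]^o),
        op_commutator Ax Aa psi T ->
        op_scale (2 * pi%:C * 'i%C)^-1 Aa psi T
    & exists rho : 'M[R]_2 -> schwartzPos R -> schwartzPos R,
        faithful_aff_rep (@aff_dom R) rho /\
        (forall psi, aff_dom psi ->
           op_scale (2 * pi%:C * 'i%C) Ax psi (fun_pairing (rho (affX R) psi)) /\
           Aa psi (fun_pairing (rho (affY R) psi)))].
Proof.
move=> Ax Aa; rewrite -[2 * pi%:C * 'i%C]/(@two_pi_i R); split.
- move=> psi; split; first by move=> phi; exact: coord_x_converges.
  by exists (two_pi_i^-1 *: euler psi); exact: weyl_x.
- move=> psi; split.
    by move=> [T /commutator_mulr[g gE _]]; apply/pow_mul_schwartz1P; exists g.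
  move=> /pow_mul_schwartz1P[g gE]; exists (two_pi_i^-1 *: fun_pairing g).
  exact: commutator_exists.
- move=> psi T /commutator_mulr[g gE ->]; exists (fun_pairing g) => //.
  exact: weyl_a.
- exists (@aff_rep R); split; first exact: faithful_aff_rep_euler.
  move=> psi dpsi; rewrite /aff_rep /affX /affY !mxE /=.
  rewrite !scale1r !scale0r addr0 add0r; split; last first.
    by apply: weyl_a; exact: mulrP.
  exists (fun_pairing (two_pi_i^-1 *: euler psi)); first exact: weyl_x.
  by rewrite -fun_pairingZ scalerA mulfV ?two_pi_i_neq0// scale1r.
Qed.
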